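(* Let $\Gamma$ be a distance regular graph and let $\star$ be the Norton product on the eigenspace $V_1$ of the second largest eigenvalue of $\Gamma$. (1) If $\Gamma$ is the Johnson graph $J(2k,k)$ (some $k\ge1$) or the Hamming graph $H(d,2)$ (some $d\ge1$), then $C_{\star,m}=1$ for all $m\ge0$, i.e. $\star$ is associative. (2) If $\Gamma$ is $J(3,1)$, $H(d,3)$ (some $d\ge1$), or the dual polar graph $D_2(2)$, then $C_{\star,m}=C_{\ominus,m}$ for all $m\ge0$; moreover $C_{\ominus,m}=\lfloor 2^{m+1}/3\rfloor$ for all $m\ge1$ (the $m$th term of OEIS sequence A000975), while $C_{\ominus,0}=1$. (3) If $\Gamma$ is $J(n,k)$ with $n>2k$ and $n\ge4$, or $H(d,e)$ with $e\ge4$, or a dual polar graph of diameter $d\ge2$ other than $D_2(2)$, then $C_{\star,m}=C_m=\frac{1}{m+1}\binom{2m}{m}$ for all $m\ge0$, i.e. $\star$ is totally nonassociative.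
   Context: Distance regular graph: a connected graph $\Gamma=(X,E)$ such that for all $i,j,k$ and all $x,y\in X$ at distance $k$, the number of $z$ with $d(x,z)=i$, $d(y,z)=j$ depends only on $i,j,k$. If $\Gamma$ has diameter $d$, its adjacency matrix has exactly $d+1$ distinct eigenvalues $\theta_0>\theta_1>\cdots>\theta_d$ with eigenspaces $V_0,\dots,V_d\subseteq \mathbb R^X=\{f:X\to\mathbb R\}$, and $\mathbb R^X=V_0\oplus\cdots\oplus V_d$ orthogonally (standard inner product). Let $\pi_1:\mathbb R^X\to V_1$ be the orthogonal projection. The Norton product on $V_1$ is $u\star v:=\pi_1(u\cdot v)$, where $(u\cdot v)(x)=u(x)v(x)$. For a binary operation $*$ on a set $S$, let $\mathcal T_m$ be the set of (full) binary trees with $m+1$ leaves; each $t\in\mathcal T_m$ gives a parenthesization $(z_0*z_1*\cdots*z_m)_t$ (leaves labelled $0,\dots,m$ left to right). Two trees $t,t'\in\mathcal T_m$ are $*$-equivalent if $(z_0*\cdots*z_m)_t=(z_0*\cdots*z_m)_{t'}$ for all $z_0,\dots,z_m\in S$. $C_{*,m}$ denotes the number of $*$-equivalence classes in $\mathcal T_m$; $*$ is totally nonassociative if $C_{*,m}=C_m$ (the Catalan number) for all $m$. The double minus operation is $a\ominus b:=-a-b$ on $\mathbb C$. Graphs: $J(n,k)$ has vertices the $k$-subsets of $\{1,\dots,n\}$, with $x\sim y$ iff $|x\cap y|=k-1$. $H(d,e)$ ($e\ge2$) has vertices the words of length $d$ over $\{1,\dots,e\}$, adjacent iff they differ in exactly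 one position. A dual polar graph has as vertices the maximal isotropic subspaces of one of the following spaces over $\mathbb F_q$ with nondegenerate form, adjacent iff their intersection has dimension $d-1$ where $d$ is the common dimension of maximal isotropic subspaces (the diameter): $C_d(q)$: $\mathbb F_q^{2d}$, symplectic form; $B_d(q)$: $\mathbb F_q^{2d+1}$, quadratic form; $D_d(q)$: $\mathbb F_q^{2d}$, quadratic form of Witt index $d$; ${}^2D_{d+1}(q)$: $\mathbb F_q^{2d+2}$, quadratic form of Witt index $d$; $A_{2d}(r)$: $\mathbb F_q^{2d+1}$, Hermitian form, $q=r^2$; $A_{2d-1}(r)$: $\mathbb F_q^{2d}$, Hermitian form, $q=r^2$. Thus $D_2(2)$ is the graph of maximal isotropic subspaces of $\mathbb F_2^4$ with a quadratic form of Witt index 2. *)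

(* Defs.v *)
From HB Require Import structures.
From mathcomp Require Import all_boot all_order all_algebra.
From mathcomp Require Import sesquilinear.
From mathcomp Require Import boolp classical_sets reals.
From mathcomp.real_closed Require Import complex.

Set Implicit Arguments.
Unset Strict Implicit.
Unset Printing Implicit Defensive.

Import GRing.Theory Num.Theory.

Local Open Scope ring_scope.

Inductive bintree := Leaf | Node of bintree & bintree.

Fixpoint bintree_encode (t : bintree) : GenTree.tree unit :=
  match t with
  | Leaf => GenTree.Leaf tt
  | Node l r => GenTree.Node 0 [:: bintree_encode l; bintree_encode r]
  end.

Fixpoint bintree_decode (u : GenTree.tree unit) : option bintree :=
  match u with
  | GenTree.Leaf _ => Some Leaf
  | GenTree.Node _ [:: l; r] =>
      if (bintree_decode l, bintree_decode r) is (Some l', Some r')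
      then Some (Node l' r') else None
  | _ => None
  end.

Lemma bintree_encodeK : pcancel bintree_encode bintree_decode.
Proof. by elim=> //= l -> r ->. Qed.

HB.instance Definition _ := Countable.copy bintree (pcan_type bintree_encodeK).

Fixpoint leaves (t : bintree) : nat :=
  if t is Node l r then (leaves l + leaves r)%N else 1%N.

Lemma leaves_gt0 t : (0 < leaves t)%N.
Proof. by elim: t => //= l l0 r _; rewrite addn_gt0 l0. Qed.

(* [tree m] is the set T_m of binary trees with m + 1 leaves. *)
Definition tree (m : nat) := {t : bintree | leaves t == m.+1}.

Fixpoint bintrees_upto (h : nat) : seq bintree :=
  if h is h'.+1 then
    Leaf :: [seq Node l r | l <- bintrees_upto h', r <- bintrees_upto h']
  else [::].

Lemma mem_bintrees_upto h t : (leaves t <= h)%N -> t \in bintrees_upto h.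
Proof.
elim: h t => [|h IHh] [|l r] //=; first by rewrite leqNgt addn_gt0 leaves_gt0.
move=> lth; rewrite inE /=; apply/allpairsP; exists (l, r) => /=.
split=> //; apply: IHh; rewrite -ltnS; apply: leq_trans lth.
  by rewrite -{1}[leaves l]addn0 ltn_add2l leaves_gt0.
by rewrite -{1}[leaves r]add0n ltn_add2r leaves_gt0.
Qed.

Definition tree_enum m : seq (tree m) :=
  undup (pmap insub (bintrees_upto m.+1)).

Lemma tree_enumP m : Finite.axiom (tree_enum m).
Proof.
apply: Finite.uniq_enumP; first exact: undup_uniq.
move=> t; rewrite mem_undup mem_pmap_sub.
by rewrite mem_bintrees_upto // (eqP (valP t)).
Qed.

HB.instance Definition _ m := Countable.on (tree m).
HB.instance Definition _ m := isFinite.Build (tree m) (@tree_enumP m).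

(* (z_0 * z_1 * ... * z_m)_t, the leaves of t being labelled from left to
   right; only the first [leaves t] values of z matter. *)
Fixpoint paren (S : Type) (op : S -> S -> S) (z : nat -> S) (t : bintree) : S :=
  if t is Node l r then
    op (paren op z l) (paren op (fun i => z (leaves l + i)%N) r)
  else z 0%N.

Definition tree_equiv (S : Type) (op : S -> S -> S) m (t t' : tree m) : Prop :=
  forall z : nat -> S, paren op z (val t) = paren op z (val t').

(* The number C_{*,m} of *-equivalence classes. *)
Definition num_classes (S : Type) (op : S -> S -> S) (m : nat) : nat :=
  #|equivalence_partition (fun t t' : tree m => `[< tree_equiv op t t' >])
      [set: tree m]%SET|.

Definition catalan (m : nat) : nat := 'C(2 * m, m) %/ m.+1.

Definition totally_nonassociative (S : Type) (op : S -> S -> S) : Prop :=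
  forall m : nat, num_classes op m = catalan m.

Definition double_minus (R : rcfType) (a b : R[i]) : R[i] := - a - b.

Definition graph_iso (X Y : Type) (e : rel X) (e' : rel Y) : Prop :=
  exists2 f : X -> Y, bijective f & forall x y, e' (f x) (f y) = e x y.

Section Graph.
Variables (X : finType) (e : rel X).

Definition walk (n : nat) (x y : X) : bool :=
  [exists p : n.-tuple X, path e x p && (last x p == y)].

(* The distance is #|X| when y cannot be reached from x. *)
Definition dist (x y : X) : nat := find (fun n => walk n x y) (iota 0 #|X|).

Definition distance_regular : Prop :=
  [/\ symmetric e, irreflexive e, (forall x y : X, connect e x y)
    & forall (i j : nat) (x y x' y' : X), dist x y = dist x' y' ->
        #|[pred z | (dist x z == i) && (dist y z == j)]|
        = #|[pred z | (dist x' z == i) && (dist y' z == j)]| ].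

End Graph.

Section Norton.
Variables (R : realType) (X : finType) (e : rel X).

Local Notation RX := {ffun X -> R^o}.

Definition adjacency_fun (f : RX) : RX := [ffun x => \sum_(y | e x y) f y].

Lemma adjacency_fun_is_linear : linear adjacency_fun.
Proof.
move=> a f g; apply/ffunP=> x; rewrite !ffunE scaler_sumr -big_split /=.
by apply: eq_bigr => y _; rewrite !ffunE.
Qed.

HB.instance Definition _ := GRing.isSemilinear.Build R RX RX _ adjacency_fun
  (GRing.semilinear_linear adjacency_fun_is_linear).

Definition adjacency : 'End(RX) := linfun adjacency_fun.

Definition second_largest_eigenvalue (theta : R) : Prop :=
  passmx.leigenvalue adjacency theta /\
  exists theta0 : R, [/\ passmx.leigenvalue adjacency theta0, theta < theta0
    & forall a : R, passmx.leigenvalue adjacency a -> a = theta0 \/ a <= theta].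

Definition inner (f g : RX) : R := \sum_(x : X) f x * g x.

Definition is_orthogonal_proj (V : {vspace RX}) (f : RX) (p : subvs_of V) :=
  forall v : subvs_of V, inner (f - vsval p) (vsval v) = 0.

Definition orthogonal_proj (V : {vspace RX}) (f : RX) : subvs_of V :=
  xget 0 (is_orthogonal_proj f).

Lemma inner_is_scalar (g : RX) : scalar (fun f : RX => inner f g).
Proof.
move=> a f1 f2; rewrite /inner mulr_sumr -big_split /=.
by apply: eq_bigr => x _; rewrite !ffunE mulrDl mulrA.
Qed.

Lemma innerC (f g : RX) : inner f g = inner g f.
Proof. by apply: eq_bigr => x _; rewrite mulrC. Qed.

Lemma inner_eq0 (f : RX) : inner f f = 0 -> f = 0.
Proof.
move=> /eqP; rewrite psumr_eq0 => [/allP f0|x _]; last by rewrite -expr2 sqr_ge0.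
apply/ffunP => x; rewrite ffunE; apply/eqP.
by have := f0 x (mem_index_enum _); rewrite mulf_eq0 orbb.
Qed.

(* [orthogonal_proj] never takes the default value of [xget]. *)
Lemma orthogonal_projP (V : {vspace RX}) (f : RX) :
  is_orthogonal_proj f (orthogonal_proj V f).
Proof.
pose b (i : 'I_(\dim V)) := (vbasis V)`_i.
pose phi (p : RX) : 'rV[R]_(\dim V) := \row_i inner p (b i).
have phi_lin : linear phi.
  by move=> a p q; apply/rowP => i; rewrite !mxE inner_is_scalar.
pose PHI : {linear RX -> 'rV[R]_(\dim V)} :=
  HB.pack phi (GRing.isSemilinear.Build R RX _ _ phi
                 (GRing.semilinear_linear phi_lin)).
have orthV (p : RX) : phi p = 0 -> forall v, v \in V -> inner p v = 0.
  move=> p0 v /coord_vbasis ->; rewrite /inner.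
  under eq_bigr => x _ do rewrite sum_ffunE mulr_sumr.
  rewrite exchange_big big1 //= => i _.
  have /rowP/(_ i) := p0; rewrite !mxE /inner => pi0.
  under eq_bigr => x _ do rewrite ffunE mulrCA.
  by rewrite -mulr_sumr pi0 mulr0.
have ker0 : (V :&: lker (linfun PHI))%VS = 0%VS.
  apply/eqP; rewrite -subv0; apply/subvP => p.
  rewrite memv_cap memv_ker lfunE /= => /andP[pV /eqP p0].
  by rewrite memv0; apply/eqP/inner_eq0/orthV.
have /eqP imgT : (linfun PHI @: V)%VS == fullv.
  by rewrite eqEdim subvf limg_dim_eq // dimvf /dim /= mul1n.
have : linfun PHI f \in (linfun PHI @: V)%VS by rewrite imgT memvf.
case/memv_imgP => p pV; rewrite !lfunE /= => fp.
have projp : is_orthogonal_proj f (Subvs pV).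
  move=> v; apply: orthV (subvsP v).
  by have := linearB PHI f p => /= ->; rewrite fp subrr.
exact: (xgetI 0 projp).
Qed.

Definition norton (theta : R) (u v : subvs_of (passmx.leigenspace adjacency theta)) :
    subvs_of (passmx.leigenspace adjacency theta) :=
  orthogonal_proj _ [ffun x => vsval u x * vsval v x].

End Norton.

Section Families.
Variables (X : finType) (e : rel X).

Definition johnson_rel (n k : nat) : rel {A : {set 'I_n} | #|A| == k} :=
  fun A B => #|val A :&: val B|.+1 == k.

Definition hamming_rel (d m : nat) : rel {ffun 'I_d -> 'I_m} :=
  fun x y => #|[pred i | x i != y i]| == 1%N.

Definition is_johnson (n k : nat) : Prop := graph_iso e (@johnson_rel n k).

Definition is_hamming (d m : nat) : Prop := graph_iso e (@hamming_rel d m).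

End Families.

(* The subtype structure of [{vspace V}] over matrices is not exported. *)
Import VectorInternalTheory.

HB.instance Definition _ (F : finFieldType) (V : vectType F) :=
  [Countable of {vspace V} by <:].
HB.instance Definition _ (F : finFieldType) (V : vectType F) :=
  [Finite of {vspace V} by <:].

Section DualPolar.
Variables (F : finFieldType) (V : vectType F).
Variable isotropic : pred {vspace V}.

Definition maximal_isotropic (U : {vspace V}) : bool :=
  isotropic U && [forall W, isotropic W ==> (U <= W)%VS ==> (W == U)].

(* This is the dual polar graph when d is the common dimension of the maximal
   isotropic subspaces. *)
Definition dual_polar_rel (d : nat) :
    rel {U : {vspace V} | maximal_isotropic U} :=
  fun U W => (\dim (val U :&: val W)).+1 == d.

End DualPolar.

Section Forms.
Variables (F : finFieldType) (N : nat).
Local Notation V := 'rV[F]_N.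

Definition form_isotropic (eps : bool) (theta : {rmorphism F -> F})
    (f : {hermitian V for eps & theta}) : pred {vspace V} :=
  fun U => (U <= orthov f U)%VS.

(* In characteristic 2 a quadratic form is not determined by its polar form,
   and the polar form of a nondegenerate quadratic form on a space of odd
   dimension is degenerate. *)
Definition polar_form (Q : V -> F) (u v : V) : F := Q (u + v) - Q u - Q v.

Definition quadratic_form (Q : V -> F) : Prop :=
  (forall (a : F) (u : V), Q (a *: u) = a ^+ 2 * Q u)
  /\ (forall v : V, scalar (fun u : V => polar_form Q u v)).

Definition nondegenerate_quadratic_form (Q : V -> F) : Prop :=
  quadratic_form Q
  /\ forall u : V, Q u = 0 -> (forall v : V, polar_form Q u v = 0) -> u = 0.

Definition quadratic_isotropic (Q : V -> F) : pred {vspace V} :=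
  fun U => [forall u : V, (u \in U) ==> (Q u == 0)].

Definition witt_index (Q : V -> F) (d : nat) : Prop :=
  (exists2 U : {vspace V}, quadratic_isotropic Q U & \dim U = d)
  /\ forall U : {vspace V}, quadratic_isotropic Q U -> (\dim U <= d)%N.

End Forms.

(* The families C_d(q), B_d(q), D_d(q), 2D_(d+1)(q), A_(2d)(r), A_(2d-1)(r). *)
Variant polar_type := PolarC | PolarB | PolarD | Polar2D | PolarAeven | PolarAodd.

(* Over the field with r ^ 2 elements, x |-> x ^ r is the involution with
   respect to which Hermitian forms are taken. *)
Definition is_hermitian_dual_polar (X : finType) (e : rel X) (F : finFieldType)
    (N d : nat) : Prop :=
  exists (r : nat) (theta : {rmorphism F -> F})
         (f : {hermitian 'rV[F]_N for false & theta}),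
    [/\ #|F| = (r ^ 2)%N, (forall x : F, theta x = x ^+ r), is_unitary f
      & graph_iso e (dual_polar_rel (isotropic := form_isotropic f) d)].

Definition is_quadratic_dual_polar (X : finType) (e : rel X) (F : finFieldType)
    (N : nat) (Q : 'rV[F]_N -> F) (d : nat) : Prop :=
  graph_iso e (dual_polar_rel (isotropic := quadratic_isotropic Q) d).

Definition is_symplectic_dual_polar (X : finType) (e : rel X) (F : finFieldType)
    (N d : nat) : Prop :=
  exists f : {hermitian 'rV[F]_N for true & idfun},
    is_psymplectic f
    /\ graph_iso e (dual_polar_rel (isotropic := form_isotropic f) d).

Definition is_dual_polar (X : finType) (e : rel X) (t : polar_type)
    (d q : nat) : Prop :=
  exists2 F : finFieldType, #|F| = q &
    match t with
    | PolarC => is_symplectic_dual_polar e F (2 * d) d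
    | PolarB => exists2 Q : 'rV[F]_((2 * d).+1) -> F,
        nondegenerate_quadratic_form Q & is_quadratic_dual_polar e Q d
    | PolarD => exists2 Q : 'rV[F]_(2 * d) -> F,
        nondegenerate_quadratic_form Q /\ witt_index Q d
        & is_quadratic_dual_polar e Q d
    | Polar2D => exists2 Q : 'rV[F]_((2 * d).+2) -> F,
        nondegenerate_quadratic_form Q /\ witt_index Q d
        & is_quadratic_dual_polar e Q d
    | PolarAeven => is_hermitian_dual_polar e F (2 * d).+1 d
    | PolarAodd => is_hermitian_dual_polar e F (2 * d) d
    end.

(* Main.v *)
(* Put an idempotent c of the Norton algebra at all leaves of a tree but one, and
   at that leaf an eigenvector z of the multiplication by c, with eigenvalue l:
   the parenthesized product is l^h z, where h is the depth of the leaf.  As the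
   depths of the leaves determine a tree, the product is totally nonassociative
   as soon as the powers of l are distinct; when l = -1 one reads the parities of
   the depths.  For a Hamming or dual polar graph, c is a multiple of the centered
   indicator of the set P of vertices incident to a point (a letter at a position,
   an isotropic point), z is a difference of two such indicators with supports
   disjoint from P, and l = -1/(|X|/|P| - 2); for J(n, k), l = -1/(n - 2).
     Conversely, for H(d, 3) and for the complete bipartite graph D_2(2) the
   Fourier coefficients of an element of V_1 turn the Norton product into
   conj(a b), so that a product only depends on the parities of the depths, as it
   does for the double minus operation.  The words of parities of trees are the
   words, not alternating when m > 0, with #even - #odd = 1 modulo 3, whence the
   count.  For J(2k, k) and H(d, 2) the antipodal automorphism negates V_1, so that
   the Norton product vanishes. *)
Require Import Defs.
From HB Require Import structures.
From mathcomp Require Import all_boot all_order all_algebra.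
From mathcomp Require Import sesquilinear perm finfield boolp reals.
From mathcomp Require Import zify ring lra.
From mathcomp.real_closed Require Import complex.

Set Implicit Arguments.
Unset Strict Implicit.
Unset Printing Implicit Defensive.

Import Order.TTheory GRing.Theory Num.Theory.

(** * Trees, depths and parities *)

(** No projection is computed and no complete spectrum is determined. A candidate for a Norton
    product is certified by the orthogonality of the error to the eigenspace; this error is 0, a
    constant function or, for J(n, k), an element of the next eigenspace. The second largest
    eigenvalue is recognized by bounding the values attached to subobjects, and exhibiting one
    eigenvector. For dual polar graphs, |X|/|P| = s q^(d-1) + 1, where s + 1 is the number of
    maximal isotropic subspaces through a common subspace of dimension d - 1. Distance regularity
    spares the computation of s in six families: s - 1 is the number of common neighbours of two
    adjacent vertices, hence a constant, and all that total nonassociativity requires is s q^(d-1)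
    >= 3. The exception D_2(2) has s = 1 and q = d = 2, so that |X|/|P| = 3 and l = -1. *)

Fixpoint depths (t : bintree) : seq nat :=
  if t is Node l r then map succn (depths l ++ depths r) else [:: 0].

Lemma size_depths t : size (depths t) = leaves t.
Proof. by elim: t => //= l IHl r IHr; rewrite size_map size_cat IHl IHr. Qed.

(** Depth sequences form a prefix code, so the induction carries an offset and arbitrary tails. A
    leaf starts with n exactly, whereas all depths in a node exceed n. *)
Lemma depths_cat_inj n t t' s s' :
  map (addn n) (depths t) ++ s = map (addn n) (depths t') ++ s' ->
  t = t' /\ s = s'.
Proof.
have deep l r k : exists a q, map (addn k) (depths (Node l r)) = (k + a.+1) :: q.
  have : 0 < size (depths l) by rewrite size_depths leaves_gt0.
  by rewrite /=; case: (depths l) => // a q _; exists a; eexists; rewrite /= addnS.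
elim: t n t' s s' => [|l IHl r IHr] n [|l' r'] s s'.
- by case.
- have [a [q ->]] := deep l' r' n; rewrite /= addn0 => -[/eqP].
  by rewrite -[X in X == _]addn0 eqn_add2l.
- have [a [q ->]] := deep l r n; rewrite /= addn0 => -[/eqP].
  by rewrite -[X in _ == X]addn0 eqn_add2l.
rewrite /= -!map_comp !(eq_map (g := addn n.+1)); first last.
- by move=> i /=; rewrite addSnnS.
- by move=> i /=; rewrite addSnnS.
by rewrite !map_cat -!catA => /IHl[-> /IHr[-> ->]].
Qed.

Lemma depths_inj : injective depths.
Proof.
move=> t t' tt'; have := @depths_cat_inj 0 t t' [::] [::].
by rewrite tt' => /(_ erefl)[].
Qed.

Lemma paren_ext (S : Type) (op : S -> S -> S) (z z' : nat -> S) t :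
  (forall i, i < leaves t -> z i = z' i) -> paren op z t = paren op z' t.
Proof.
elim: t z z' => [|l IHl r IHr] z z' zz' /=; first exact: zz'.
congr op; [apply: IHl | apply: IHr] => i i_lt; apply: zz' => /=.
  by rewrite (leq_trans i_lt) // leq_addr.
by rewrite ltn_add2l.
Qed.

Lemma paren_morph (S T : Type) (op : S -> S -> S) (op' : T -> T -> T) (f : S -> T) :
  {morph f : a b / op a b >-> op' a b} ->
  forall z t, f (paren op z t) = paren op' (fun i => f (z i)) t.
Proof.
by move=> fM z t; elim: t z => //= l IHl r IHr z; rewrite fM IHl IHr.
Qed.

(* With the idempotent c at every leaf but one, carrying an eigenvector of the
   multiplication by c, the value of a parenthesization reads off the depth of
   that leaf. *)
Section DepthProbe.
Variables (S : Type) (op : S -> S -> S) (c : S) (z : nat -> S).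
Hypothesis opcc : op c c = c.
Hypothesis opcz : forall n, op c (z n) = z n.+1.
Hypothesis opzc : forall n, op (z n) c = z n.+1.

Lemma paren_idem t : paren op (fun _ => c) t = c.
Proof. by elim: t => //= l -> r ->. Qed.

Lemma paren_probe t k i : i < leaves t ->
  paren op (fun j => if j == i then z k else c) t = z (k + nth 0 (depths t) i).
Proof.
elim: t i => [|l IHl r IHr] i /=; first by case: i => //= _; rewrite addn0.
move=> i_lt; have lt_size : i < size (depths l ++ depths r).
  by rewrite size_cat !size_depths.
rewrite (nth_map 0) // nth_cat size_depths addnS.
have [il|li] := ltnP i (leaves l).
  rewrite IHl // (@paren_ext _ _ _ (fun _ => c)) ?paren_idem ?opzc // => j _.
  by case: eqP => // ji; move: il; rewrite -ji ltnNge leq_addr.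
rewrite (@paren_ext _ _ _ (fun _ => c) l) ?paren_idem; last first.
  by move=> j jl; case: eqP => // ji; move: jl; rewrite ji ltnNge li.
rewrite (@paren_ext _ _ _ (fun j => if j == i - leaves l then z k else c) r).
  by rewrite IHr ?opcz // ltn_subLR.
by move=> j _; rewrite -(eqn_add2l (leaves l) j) subnKC.
Qed.

Lemma tree_equiv_depths m (t t' : tree m) i : tree_equiv op t t' -> i < m.+1 ->
  z (nth 0 (depths (val t)) i) = z (nth 0 (depths (val t')) i).
Proof.
move=> /(_ (fun j => if j == i then z 0 else c)) tt' im.
by rewrite !paren_probe ?(eqP (valP t)) ?(eqP (valP t')) // in tt'.
Qed.

Lemma tree_equiv_inj m (t t' : tree m) :
  injective z -> tree_equiv op t t' -> t = t'.
Proof.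
move=> z_inj tt'; apply/val_inj/depths_inj/(@eq_from_nth _ 0).
  by rewrite !size_depths (eqP (valP t)) (eqP (valP t')).
move=> i; rewrite size_depths (eqP (valP t)) => im.
exact/z_inj/tree_equiv_depths.
Qed.

End DepthProbe.

Lemma num_classes_imset (S : Type) (op : S -> S -> S) m (T : finType) (f : tree m -> T) :
  (forall t t', tree_equiv op t t' <-> f t = f t') ->
  num_classes op m = #|f @: [set: tree m]|.
Proof.
move=> opf; rewrite /num_classes /equivalence_partition.
pose g c := [set t : tree m | f t == c].
have -> : [set [set y in [set: tree m] | `[< tree_equiv op x y >] ]
            | x in [set: tree m]] = g @: (f @: [set: tree m]).
  rewrite -imset_comp; apply: eq_imset => t /=; apply/setP => u.
  by rewrite !inE; apply/asboolP/eqP => [/opf|/esym/opf].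
rewrite card_in_imset // => _ _ /imsetP[t _ ->] /imsetP[u _ ->] /setP/(_ t).
by rewrite !inE eqxx => /esym/eqP.
Qed.

Lemma eq_num_classes (S T : Type) (op : S -> S -> S) (op' : T -> T -> T) m :
  (forall t t' : tree m, tree_equiv op t t' <-> tree_equiv op' t t') ->
  num_classes op m = num_classes op' m.
Proof.
move=> opop'; rewrite /num_classes; congr #|pred_of_set _|.
apply: eq_imset => t; apply/setP => u.
by rewrite !inE (asbool_equiv_eq (opop' t u)).
Qed.

Lemma tree0 (t t' : tree 0) : t = t'.
Proof.
suff leaf (u : tree 0) : val u = Leaf by apply: val_inj; rewrite !leaf.
case: u => -[|l r] //= /eqP ulr; exfalso.
by have := leaves_gt0 l; have := leaves_gt0 r; lia.
Qed.

(** A witness that [tree m] is inhabited, without which there would be no class at all. *)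
Fixpoint left_comb m := if m is m'.+1 then Node (left_comb m') Leaf else Leaf.

Lemma leaves_left_comb m : leaves (left_comb m) == m.+1.
Proof. by elim: m => //= m /eqP->; rewrite addn1. Qed.

Lemma num_classes_trivial (S : Type) (op : S -> S -> S) m :
  (forall t t' : tree m, tree_equiv op t t') -> num_classes op m = 1.
Proof.
move=> triv; rewrite (@num_classes_imset _ _ _ unit (fun _ => tt)) //.
have -> : [set tt | _ in [set: tree m]] = [set tt].
  apply/setP => -[]; rewrite !inE eqxx; apply/imsetP.
  by exists (exist (fun t => leaves t == m.+1) _ (leaves_left_comb m)).
by rewrite cards1.
Qed.

(** * Parity words of trees and their number *)

Definition parities t := map odd (depths t).

Lemma parities_Node l r :
  parities (Node l r) = map negb (parities l ++ parities r).
Proof. by rewrite /parities /= -map_comp -map_cat -map_comp. Qed.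

Lemma size_parities t : size (parities t) = leaves t.
Proof. by rewrite size_map size_depths. Qed.

(** Modulo 3 this is #[false] - #[true], since each [true] weighs 2 = -1; the natural number form
    avoids subtraction. *)
Definition weight (w : seq bool) := size w + count id w.

Definition alternating (w : seq bool) := sorted (fun a b => a != b) w.

Lemma weight_negb w : weight (map negb w) + weight w = 3 * size w.
Proof.
by elim: w => //= b w; rewrite /weight /= => IHw; case: b => /=; lia.
Qed.

Lemma weight_cat w1 w2 : weight (w1 ++ w2) = weight w1 + weight w2.
Proof. by rewrite /weight size_cat count_cat; lia. Qed.

(** Negating a word negates its weight modulo 3, and -(1 + 1) = 1. *)
Lemma parities_weight t : weight (parities t) %% 3 = 1.
Proof.
elim: t => // l IHl r IHr; rewrite parities_Node.
by have := weight_negb (parities l ++ parities r); rewrite weight_cat; lia.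
Qed.

Lemma alternating_negb w : alternating (map negb w) = alternating w.
Proof.
case: w => //= a w; elim: w a => //= b w IHw a; rewrite IHw.
by case: a b => [] [].
Qed.

Lemma alternating_cat w1 w2 :
  alternating (w1 ++ w2) -> alternating w1 /\ alternating w2.
Proof.
by case: w1 => //= a w1; rewrite cat_path => /andP[-> /path_sorted].
Qed.

(** Infixes of alternating words alternate, so in a minimal counterexample both children are leaves;
    but then the word is [true true]. *)
Lemma parities_Node_alternating l r : ~~ alternating (parities (Node l r)).
Proof.
have [h] := ubnP (leaves (Node l r)); elim: h => // h IHh in l r *.
rewrite parities_Node alternating_negb => lth.
case: l lth => [|l1 l2] lth; last first.
  apply/negP => /alternating_cat[+ _]; apply/negP/IHh; move: lth => /=.
  by have := leaves_gt0 r; lia.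
case: r lth => [|r1 r2] lth //; apply/negP => /alternating_cat[_]; apply/negP/IHh.
exact: lth.
Qed.

Lemma cat_eq_cat_cons (T : Type) (w1 w2 u1 u2 : seq T) b :
  w1 ++ w2 = u1 ++ b :: u2 ->
  (exists v, w1 = u1 ++ b :: v /\ u2 = v ++ w2) \/
  (exists v, u1 = w1 ++ v /\ w2 = v ++ b :: u2).
Proof.
elim: w1 u1 => [|a w1 IHw] [|c u1] /=; try by right; eexists.
  by case=> -> <-; left; exists w1.
case=> -> /IHw[[v [-> ->]]|[v [-> ->]]]; [left|right]; exists v => //.
Qed.

(** Two leaves are grown under the leaf that carries the letter b. Read backwards, a repeated letter
    can be contracted to its opposite. *)
Lemma parities_graft t s1 b s2 : parities t = s1 ++ b :: s2 ->
  exists t', parities t' = s1 ++ [:: ~~ b, ~~ b & s2].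
Proof.
have mapK : involutive (map negb) := mapK negbK.
elim: t s1 b s2 => [|l IHl r IHr] s1 b s2.
  case: s1 => [|a [|//]] //= [<- <-]; by exists (Node Leaf Leaf).
rewrite parities_Node => /(congr1 (map negb)); rewrite mapK map_cat /=.
move=> w_eq; case: (cat_eq_cat_cons w_eq) => [[v [lE s2E]]|[v [s1E rE]]].
  have [l' l'E] := IHl _ _ _ lE.
  exists (Node l' r); rewrite parities_Node l'E -catA /= -s2E map_cat /=.
  by rewrite !mapK !negbK.
have [r' r'E] := IHr _ _ _ rE; exists (Node l r'); rewrite parities_Node r'E catA -s1E map_cat /=.
by rewrite !mapK !negbK.
Qed.

(** A nonconstant word with a repetition has one next to a different letter. Contracting that pair
    creates a new repetition with this letter, so the word stays nonalternating. *)
Lemma not_alternatingP w : ~~ alternating w ->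
  (exists b, w = nseq (size w) b) \/
  exists s1 b s2, w = s1 ++ [:: b; b; ~~ b] ++ s2 \/ w = s1 ++ [:: ~~ b; b; b] ++ s2.
Proof.
elim: w => // a [|a' w] // IHw /=; rewrite negb_and negbK.
have [aa' _|aa' /= w_alt] := eqVneq a a'.
  case: w IHw => [|c w] IHw; first by left; exists a; rewrite aa'.
  have [ac|ac] := eqVneq a c; last first.
    right; exists [::], a, w; left; rewrite -aa'; congr [:: _, _, _ & _].
    by case: a c ac {IHw aa'} => [] [].
  rewrite -aa' -ac in IHw *; case: IHw => [|[b w_eq]|[s1 [b [s2 w_eq]]]].
  - by rewrite /= eqxx.
  - by left; exists b; case: w_eq => -> _ w_eq; rewrite /= {1}w_eq.
  - right; exists (a :: s1), b, s2 => /=.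
    by case: w_eq => ->; [left|right].
case: (IHw w_alt) => [[b]|[s1 [b [s2 w_eq]]]].
  case: w w_alt {IHw} => //= c w w_alt [a'b cb w_eq]; right; exists [::], b, w; right => /=.
  by rewrite cb a'b; congr (_ :: _); rewrite a'b in aa'; case: (a) (b) aa' => [] [].
right; exists (a :: s1), b, s2 => /=.
by case: w_eq => ->; [left|right].
Qed.

(** Contracting a repeated letter to its opposite preserves the weight modulo 3 and shortens the
    word; [parities_graft] undoes it on the tree. *)
Lemma parities_surj w : ~~ alternating w -> weight w %% 3 = 1 ->
  exists t, parities t = w.
Proof.
have [h] := ubnP (size w); elim: h => // h IHh in w *.
have step s1 b s2 : w = s1 ++ [:: b, b & s2] -> size w < h.+1 ->
    ~~ alternating (s1 ++ ~~ b :: s2) -> weight w %% 3 = 1 ->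
    exists t, parities t = w.
  move=> w_eq wh na ww; case: (IHh (s1 ++ ~~ b :: s2)) => //.
  - by move: wh; rewrite w_eq !size_cat /=; lia.
  - move: ww; rewrite w_eq !weight_cat /weight /=; case: b {w_eq na} => /=; lia.
  - by move=> t /parities_graft[t' tE]; exists t'; rewrite tE w_eq !negbK.
move=> wh na ww; case: (not_alternatingP na) => [[b w_eq]|[s1 [b [s2 [w_eq|w_eq]]]]].
(* In a constant word of length at least 4, a repetition survives behind the contracted pair. Among
   shorter nonalternating ones the weight only leaves [true true]. *)
- have cnt : count id w = b * size w by rewrite {1}w_eq count_nseq.
  move: ww; rewrite /weight cnt => ww.
  case: (size w) w_eq wh cnt ww => [|[|[|[|n]]]] w_eq wh cnt ww.
  + by rewrite w_eq in na.
  + by rewrite w_eq in na.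
  + case: b w_eq ww {cnt} => [] w_eq // _; exists (Node Leaf Leaf).
    by rewrite w_eq.
  + by case: b ww {w_eq cnt}.
  apply: (step [::] b (nseq n.+2 b)) => //; rewrite ?w_eq ?size_nseq //=.
    by rewrite eqxx andbF.
  by rewrite /weight /= count_nseq size_nseq; case: b ww {w_eq cnt} => /=; lia.
- apply: (step s1 b (~~ b :: s2)) => //.
  by apply/negP => /alternating_cat[_] /=; rewrite eqxx.
- apply: (step (rcons s1 (~~ b)) b s2); rewrite ?cat_rcons //.
  by apply/negP => /alternating_cat[_] /=; rewrite eqxx.
Qed.

Fixpoint words n : seq (seq bool) :=
  if n is n'.+1 then map (cons false) (words n') ++ map (cons true) (words n')
  else [:: [::]].

Lemma mem_words n w : (w \in words n) = (size w == n).
Proof.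
elim: n w => [|n IHn] [|b w] //=; first by rewrite mem_cat; apply/norP; split; apply/mapP=> -[].
rewrite eqSS -IHn mem_cat; apply/orP/idP => [[]/mapP[v v_n [_ ->]]|wn] //.
by case: b; [right|left]; exact: map_f.
Qed.

Lemma words_uniq n : uniq (words n).
Proof.
have cinj b : injective (cons b : seq bool -> _) by move=> u v [].
elim: n => //= n IHn; rewrite cat_uniq !map_inj_uniq // IHn andbT /=.
by apply/hasP => -[_ /mapP[u _ ->]] /mapP[].
Qed.

Lemma card_words n (P : pred (seq bool)) :
  #|[set w : n.-tuple bool | P w]| = count P (words n).
Proof.
rewrite cardE -(size_map val) -size_filter; apply/perm_size/uniq_perm.
- by rewrite map_inj_uniq ?enum_uniq //; exact: val_inj.
- by rewrite filter_uniq // words_uniq.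
move=> w; rewrite mem_filter mem_words; apply/mapP/andP => [[v + ->]|[Pw sw]].
  by rewrite mem_enum inE size_tuple.
by exists (Tuple sw) => //; rewrite mem_enum inE.
Qed.

(** Three times the count is 2^n + 2 (-1)^n for r = 0 and 2^n - (-1)^n otherwise; the corrections
    are spread over both sides to remain in nat. *)
Lemma count_weight n r : r < 3 ->
  3 * count (fun w => weight w %% 3 == r) (words n)
    + odd n * (if r == 0 then 2 else 0) + (~~ odd n) * (if r == 0 then 0 else 1)
  = 2 ^ n + odd n * (if r == 0 then 0 else 1) + (~~ odd n) * (if r == 0 then 2 else 0).
Proof.
pose cnt m k := count (fun w => weight w %% 3 == k) (words m).
have shift m i j k : j < 3 -> k < 3 -> (k + i) %% 3 = j ->
    count (fun w => (weight w + i) %% 3 == j) (words m) = cnt m k.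
  by move=> j3 k3 kij; apply: eq_count => w /=; apply/eqP/eqP; lia.
have cntS m j k k' : j < 3 -> k < 3 -> k' < 3 ->
    (k + 1) %% 3 = j -> (k' + 2) %% 3 = j -> cnt m.+1 j = cnt m k + cnt m k'.
  move=> j3 k3 k'3 kj k'j; rewrite -(shift m _ _ _ j3 k3 kj) -(shift m _ _ _ j3 k'3 k'j).
  rewrite /cnt /= count_cat !count_map; congr (_ + _); apply: eq_count => w /=;
    rewrite /weight /=; congr (_ %% 3 == j); lia.
rewrite -/(cnt n r); elim: n r => [|n IHn] r r3; first by case: r r3 => [|[|[|]]].
have IH0 := IHn 0 isT; have IH1 := IHn 1 isT; have IH2 := IHn 2 isT.
rewrite expnS; move: IH0 IH1 IH2; rewrite /=.
case: r r3 => [|[|[|//]]] _ /=.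
- by rewrite (cntS n 0 2 1) //; case: (odd n) => /=; lia.
- by rewrite (cntS n 1 0 2) //; case: (odd n) => /=; lia.
- by rewrite (cntS n 2 1 0) //; case: (odd n) => /=; lia.
Qed.

(** Just one alternating word of length n can follow b. Its consecutive pairs weigh 3, so only a
    possible odd letter [~~ b] counts; k is the weight already read. *)
Lemma count_alternating_from n b k :
  count (fun w => path (fun a c => a != c) b w && ((weight w + k) %% 3 == 1)) (words n)
  = ((odd n * (1 + ~~ b) + k) %% 3 == 1).
Proof.
elim: n b k => [|n IHn] b k; first by rewrite /= addn0.
rewrite /= count_cat !count_map.
have cntE c : count (preim (cons c) (fun w => path (fun a c => a != c) b w
      && ((weight w + k) %% 3 == 1))) (words n) =
    (b != c) * ((odd n * (1 + ~~ c) + (1 + c + k)) %% 3 == 1).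
  case: (b != c) / idP => bc; last first.
    rewrite mul0n; apply/eqP; rewrite -leqn0 leqNgt -has_count.
    by apply/hasPn => w _ /=; case: (b != c) bc.
  rewrite mul1n -IHn; apply: eq_count => w /=; rewrite bc /weight /=.
  by congr (_ && (_ %% 3 == 1)); lia.
rewrite !cntE; case: b {cntE}; case: (odd n) => /=; rewrite ?mul0n ?mul1n ?addn0 ?add0n;
  congr nat_of_bool; apply/eqP/eqP; lia.
Qed.

Lemma count_alternating n :
  count (fun w => alternating w && (weight w %% 3 == 1)) (words n.+1) = ~~ odd n.
Proof.
have := count_alternating_from n; rewrite /= count_cat !count_map => cnt.
transitivity (((odd n * 2 + 1) %% 3 == 1) + ((odd n * 1 + 2) %% 3 == 1)); last by case: (odd n).
rewrite -(cnt false 1) -(cnt true 2); congr (_ + _); apply: eq_count => w /=;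
  rewrite /weight /=; congr (_ && (_ %% 3 == 1)); lia.
Qed.

(** For m odd the number of words of weight 1 is (2^(m+1) - 1)/3 and none alternates; for m even it
    is (2^(m+1) + 1)/3 and exactly one alternates. Either way the difference is the floor. *)
Lemma count_parities m : 0 < m ->
  count (fun w => ~~ alternating w && (weight w %% 3 == 1)) (words m.+1)
  = 2 ^ m.+1 %/ 3.
Proof.
move=> m0; have := @count_weight m.+1 1 isT; have := count_alternating m.
have -> : count (fun w => weight w %% 3 == 1) (words m.+1) =
  count (fun w => alternating w && (weight w %% 3 == 1)) (words m.+1) +
  count (fun w => ~~ alternating w && (weight w %% 3 == 1)) (words m.+1).
  by elim: (words m.+1) => //= w ws ->; case: alternating; case: (_ == 1); lia.
by move=> -> /=; case: (odd m) => /=; lia.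
Qed.

Lemma eq_parities t t' : leaves t = leaves t' ->
  (forall i, i < leaves t -> odd (nth 0 (depths t) i) = odd (nth 0 (depths t') i)) ->
  parities t = parities t'.
Proof.
move=> tt' odd_eq; apply: (@eq_from_nth _ false); first by rewrite !size_parities.
move=> i; rewrite size_parities => it.
by rewrite !(nth_map 0) ?size_depths -?tt' // odd_eq.
Qed.

(* op a b = s (a b) for an involutive endomorphism s of a commutative monoid:
   each leaf contributes s^depth of its label. *)
Section TwistedMonoid.
Variables (S : Type) (one : S) (mul : Monoid.com_law one) (s : S -> S).
Hypotheses (s1 : s one = one) (sM : {morph s : a b / mul a b}) (ss : involutive s).

Let twist (b : bool) x := if b then s x else x.

Lemma paren_twisted z t :
  paren (fun a b => s (mul a b)) z t =
  \big[mul/one]_(i < leaves t) twist (nth false (parities t) i) (z i).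
Proof.
elim: t z => [|l IHl r IHr] z; first by rewrite /= big_ord_recl big_ord0 /= Monoid.mulm1.
rewrite [LHS]/= sM IHl IHr !(big_morph s sM s1) parities_Node /= big_split_ord /=.
have tw b x : s (twist b x) = twist (~~ b) x by case: b => //=; rewrite ss.
congr (mul _ _); apply: eq_bigr => i _; rewrite tw (nth_map false) ?size_cat ?size_parities.
- by rewrite nth_cat size_parities ltn_ord.
- by rewrite (leq_trans (ltn_ord i)) ?leq_addr.
- by rewrite nth_cat size_parities ltnNge leq_addr /= addKn.
- by rewrite ltn_add2l.
Qed.

Lemma tree_equiv_twisted m (t t' : tree m) :
  parities (val t) = parities (val t') ->
  tree_equiv (fun a b => s (mul a b)) t t'.
Proof.
move=> tt' z; rewrite !paren_twisted.
by rewrite tt' (eqP (valP t)) (eqP (valP t')).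
Qed.

End TwistedMonoid.

Section DoubleMinus.
Import GRing.Theory Num.Theory.
Local Open Scope ring_scope.
Variable R : realType.

Lemma double_minus_equiv m (t t' : tree m) :
  tree_equiv (@double_minus R) t t' <-> parities (val t) = parities (val t').
Proof.
have twisted := @tree_equiv_twisted _ _ +%R%R (@GRing.opp R[i]) (oppr0 _) (@opprD _) (@opprK _).
split=> [tt'|/twisted tt' z].
  apply: eq_parities => [|i]; first by rewrite (eqP (valP t)) (eqP (valP t')).
  rewrite (eqP (valP t)) => im.
  (* The probe has idempotent 0, whose multiplication is negation, with eigenvalue -1. *)
  have := @tree_equiv_depths _ _ 0 (fun n => (-1) ^+ n : R[i]) _ _ _ m t t' i tt' im.
  move=> /(_ _ _ _)/eqP; rewrite -[X in _ == X]signr_odd -[X in X == _]signr_odd.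
  rewrite (inj_eq signr_inj); move=> sgn; apply/eqP/sgn => [|n|n].
  - by rewrite /double_minus subr0 oppr0.
  - by rewrite /double_minus oppr0 add0r exprS mulN1r.
  - by rewrite /double_minus subr0 exprS mulN1r.
have eqop : (@double_minus R) = (fun a b => - (a + b)).
  by apply/funext => a; apply/funext => b; rewrite /double_minus opprD.
by rewrite eqop; exact: tt'.
Qed.

End DoubleMinus.

Lemma num_classes_double_minus (R : realType) m : 0 < m ->
  num_classes (@double_minus R) m = 2 ^ m.+1 %/ 3.
Proof.
move=> m0.
have par_size (t : tree m) : size (parities (val t)) == m.+1.
  by rewrite size_parities (valP t).
rewrite (@num_classes_imset _ _ _ _ (fun t => Tuple (par_size t))); last first.
  by move=> t t'; rewrite double_minus_equiv; split=> [E|[//]]; apply: val_inj.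
rewrite -count_parities // -card_words; apply: eq_card => w; rewrite inE.
apply/imsetP/andP => [[t _ ->]|[w_na /eqP w_wt]] /=.
  split; last by rewrite parities_weight.
  have na u : leaves u == m.+1 -> ~~ alternating (parities u).
    case: u => [/= /eqP[mE]|l r _]; last exact: parities_Node_alternating.
    by rewrite -mE in m0.
  exact: na (valP t).
have [t tE] := parities_surj w_na w_wt.
have t_lv : leaves t == m.+1 by rewrite -size_parities tE size_tuple.
by exists (exist (fun t => leaves t == m.+1) t t_lv); [rewrite inE|apply/val_inj => /=; rewrite tE].
Qed.

(** * The number of binary trees *)

Fixpoint nodes (t : bintree) := if t is Node l r then (nodes l + nodes r).+1 else 0.

Lemma leaves_nodes t : leaves t = (nodes t).+1.
Proof. by elim: t => //= l -> r ->; rewrite addSn addnS. Qed.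

Definition merge_head (f : seq bintree) :=
  if f is l :: r :: f' then Node l r :: f' else f.

(* The forests of k trees with n internal nodes, when h = 2 n + k: the first
   tree of a nonempty forest is a leaf, or its two subtrees start a forest with
   one more tree and one internal node less. *)
Fixpoint forests h k n : seq (seq bintree) :=
  if h is h'.+1 then
    if k is k'.+1 then
      map (cons Leaf) (forests h' k' n) ++
      (if n is n'.+1 then map merge_head (forests h' k'.+2 n') else [::])
    else [::]
  else [:: [::]].

Lemma mem_forests h k n f : h = 2 * n + k ->
  (f \in forests h k n) = (size f == k) && (sumn (map nodes f) == n).
Proof.
elim: h k n f => [|h IHh] k n f hE.
  have [-> ->] : n = 0 /\ k = 0 by lia.
  by case: f.
case: k hE => [|k] hE /=.
  by case: n hE => [|n] hE; [lia|case: f].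
have hE1 : h = 2 * n + k by lia.
rewrite mem_cat; case: f => [|[|l r] f].
- rewrite /=; apply/norP; split; first by apply/mapP => -[].
  case: n hE {hE1} => // n hE; apply/mapP => -[g]; rewrite IHh; last lia.
  by case: g => [|a [|b g]].
- rewrite /= eqSS -IHh // orbC; case: n hE hE1 => [|n] hE hE1 /=.
    by apply/mapP/idP => [[g gf [->]]|fE] //; exists f.
  apply/orP/idP => [[/mapP[g]|/mapP[g gf [->]]]|fE] //.
    by rewrite IHh; [case: g => [|a [|b g]]|lia].
  by right; apply/mapP; exists f.
- rewrite /= (_ : (Node l r :: f \in [seq Leaf :: i | i <- forests h k n]) = false) /=; last first.
    by apply/mapP => -[].
  case: n hE hE1 => [|n] hE hE1; first by rewrite andbF.
  have -> : (size f).+1 == k.+1 = ((size [:: l, r & f]) == k.+2) by [].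
  have -> : (nodes l + nodes r).+1 + sumn (map nodes f) == n.+1 =
     (sumn (map nodes [:: l, r & f]) == n) by rewrite /= addSn eqSS addnA.
  rewrite -IHh; last lia.
  apply/mapP/idP => [[g]|lrf]; last by exists [:: l, r & f].
  rewrite IHh; last lia.
  by case: g => [|a [|b g]] //= ? [-> -> ->]; rewrite IHh //; lia.
Qed.

Lemma forests_uniq h k n : h = 2 * n + k -> uniq (forests h k n).
Proof.
elim: h k n => [|h IHh] [|k] n hE //=.
rewrite cat_uniq map_inj_uniq ?IHh; [|lia|by move=> ? ? []].
case: n hE => [|n] hE //=; apply/andP; split; last first.
  rewrite map_inj_in_uniq ?IHh //; first lia.
  move=> f g; rewrite !mem_forests; [|lia..].
  by case: f g => [|a [|b f]] // [|c [|d g]] //= _ _ [-> -> ->].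
apply/hasPn => f /mapP[g]; rewrite mem_forests; last lia.
by case: g => [|a [|b g]] //= _ ->; apply/mapP => -[].
Qed.

(** The ballot number C(h-1, n) - C(h-1, n-1), with the subtracted term moved to the left. Counting
    forests instead of trees replaces the Catalan convolution by Pascal's rule. *)
Lemma size_forests h k n : h = 2 * n + k -> 0 < h ->
  size (forests h k n) + (if n is n'.+1 then 'C(h.-1, n') else 0) = 'C(h.-1, n).
Proof.
elim: h k n => // h IHh [|k] n hE _ /=.
  case: n hE => [|n] hE; first by lia.
  by rewrite add0n -[RHS]bin_sub; [congr 'C(_, _)|]; lia.
rewrite size_cat size_map.
case: h => [|h] in IHh hE *.
  have [-> ->] : n = 0 /\ k = 0 by lia.
  by [].
case: n hE => [|n] hE.
  by have := IHh k 0 ltac:(lia) isT; rewrite /= !bin0 !addn0.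
have := IHh k n.+1 ltac:(lia) isT; have := IHh k.+2 n ltac:(lia) isT.
rewrite size_map /= [in X in _ -> _ -> X]binS.
by case: n hE => [|n] hE; rewrite ?bin0 ?binS; lia.
Qed.

Lemma card_tree m : #|{: tree m}| = catalan m.
Proof.
have -> : #|{: tree m}| = size (forests (2 * m + 1) 1 m).
  rewrite cardE -(size_map (fun t : tree m => [:: val t])).
  apply/perm_size/uniq_perm.
  - by rewrite map_inj_uniq ?enum_uniq // => t u [] /val_inj.
  - exact: forests_uniq.
  move=> f; rewrite mem_forests //; apply/mapP/andP => [[t _ ->]|] /=.
    by have /eqP := valP t; rewrite leaves_nodes addn0 => -[->].
  move=> [fs fn]; case: f fs fn => [|t [|]] //= _; rewrite addn0 => tm.
  have t_lv : leaves t == m.+1 by rewrite leaves_nodes eqSS.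
  by exists (exist (fun t => leaves t == m.+1) t t_lv); rewrite ?mem_enum.
have := @size_forests (2 * m + 1) 1 m erefl; rewrite addn1 /= => /(_ isT).
rewrite /catalan; case: m => [|m]; first by rewrite bin0 addn0 => ->.
have := mul_bin_left (2 * m.+1) m.
set a := 'C(_, m.+1); set b := 'C(_, m); set x := size _ => ab xab.
have -> : a = x * m.+2 by nia.
by rewrite mulnK.
Qed.

Lemma totally_nonassociative_of_probe (S : Type) (op : S -> S -> S) (c : S) (z : nat -> S) :
  op c c = c -> (forall n, op c (z n) = z n.+1) -> (forall n, op (z n) c = z n.+1) ->
  injective z -> totally_nonassociative op.
Proof.
move=> opcc opcz opzc z_inj m.
rewrite (@num_classes_imset _ _ _ _ id); last first.
  by move=> t t'; split=> [/(tree_equiv_inj opcc opcz opzc z_inj)|->].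
by rewrite imset_id cardsT card_tree.
Qed.

(** * Hyperplanes of a finite vector space *)

Section HyperplaneCount.
Variables (F : finFieldType) (N : nat).
Local Notation V := 'rV[F]_N.
Local Notation q := #|F|.
Implicit Types U W H : {vspace V}.

Lemma dim_line (v : V) : v != 0%R -> \dim <[v]> = 1.
Proof. by rewrite dim_vline => ->. Qed.

Lemma cap_line0 U (v : V) : v \notin U -> (U :&: <[v]> = 0)%VS.
Proof.
move=> vU; apply/eqP; rewrite -subv0; apply/subvP => u; rewrite memv_cap memv0.
case/andP => uU /vlineP[a ua]; have [a0|a0] := eqVneq a 0%R; first by rewrite ua a0 scale0r.
by case/negP: vU; rewrite -(scalerK a0 v) -ua rpredZ.
Qed.

Lemma dimD_line U (v : V) : v \notin U -> \dim (U + <[v]>) = (\dim U).+1.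
Proof.
move=> vU; rewrite dimv_disjoint_sum ?cap_line0 // dim_line ?addn1 //.
by apply: contraNneq vU => ->; rewrite mem0v.
Qed.

Definition hyperplanes U W : {set {vspace V}} :=
  [set H | [&& (W <= H)%VS, (H <= U)%VS & (\dim H).+1 == \dim U]].

Lemma card_field_gt1 : 1 < q.
Proof. exact: card_finNzRing_gt1. Qed.

Lemma card_space U : \sum_(v in U) 1 = q ^ \dim U.
Proof. by rewrite sum1_card card_vspace. Qed.

(** The q-integer [i] = (q^i - 1)/(q - 1). *)
Definition qnum i := \sum_(m < i) q ^ m.

Lemma qnumS i : qnum i.+1 = qnum i + q ^ i.
Proof. by rewrite /qnum big_ord_recr. Qed.

Lemma qnum_leq i j : i <= j -> qnum i <= qnum j.
Proof.
by move=> /subnK <-; elim: (j - i) => //= k /leq_trans->; rewrite ?addSn ?qnumS ?leq_addr.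
Qed.

(** Induction on the codimension of W by counting pairs of a hyperplane H above W and a vector v of
    H: a vector of W lies in all of them, and for v outside W the induction hypothesis applies to W
    + <v>. *)
Lemma card_hyperplanes U W : (W <= U)%VS ->
  #|hyperplanes U W| = qnum (\dim U - \dim W).
Proof.
move: {2}(_ - _) (erefl (\dim U - \dim W)) => i; elim: i W => [|i IHi] W iE WU.
  rewrite iE /qnum big_ord0; apply: eq_card0 => H; rewrite inE.
  apply/negP => /and3P[/dimvS WH _ /eqP HU]; have := dimvS WU; lia.
have dWU := dimvS WU; rewrite iE.
case: i IHi iE => [|i] IHi iE.
  rewrite /qnum big_ord1 expn0; apply: eq_trans (cards1 W); apply: eq_card => H; rewrite !inE.
  apply/and3P/eqP => [[WH _ /eqP HU]|->]; last by split=> //; apply/eqP; lia.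
  by apply/eqP; rewrite eq_sym eqEdim WH /=; lia.
set x := #|_|; set g := qnum i.+1 in IHi *.
have gE : g * (q - 1) + 1 = q ^ i.+1.
  by rewrite /g /qnum subn1 mulnC -predn_exp addn1 prednK // expn_gt0 ltnW // card_field_gt1.
have count : x * q ^ (\dim U).-1 = q ^ \dim W * x + (q ^ \dim U - q ^ \dim W) * g.
  transitivity (\sum_(H in hyperplanes U W) \sum_(v in H) 1).
    rewrite -sum_nat_const; apply: eq_bigr => H; rewrite inE => /and3P[_ _ /eqP HU].
    by rewrite card_space -HU.
  transitivity (\sum_(v in U) #|hyperplanes U (W + <[v]>)|).
    rewrite (exchange_big_dep (mem U)) /= => [|H v]; last first.
      by rewrite inE => /and3P[_ /subvP HU _] /HU.
    apply: eq_bigr => v vU; rewrite sum1_card; apply: eq_card => H.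
    rewrite [in RHS]inE subv_add -memvE unfold_in inE; case: (v \in H); rewrite ?andbF ?andbT //.
  rewrite (bigID (mem W)) /=; congr (_ + _).
    rewrite (eq_bigr (fun => x)) => [|v /andP[vU vW]]; last first.
      by rewrite (addv_idPl _) // -memvE.
    rewrite sum_nat_const; congr (_ * _); rewrite -card_vspace; apply: eq_card => v.
    by rewrite unfold_in; apply: andb_idl => /(subvP WU).
  rewrite (eq_bigr (fun => g)) => [|v /andP[vU vW]]; last first.
    have dWv := dimD_line vW.
    rewrite IHi ?dWv; first by congr qnum; lia.
      lia.
    by rewrite subv_add WU -memvE.
  rewrite sum_nat_const; congr (_ * _); rewrite -!card_vspace.
  rewrite -(cardID (mem W) (mem U)) addnC.
  have -> : #|[predI U & W]| = #|W|.
    by apply: eq_card => v; rewrite inE; apply: andb_idl => /(subvP WU).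
  by rewrite addnK; apply: eq_card => v; rewrite !inE andbC.
have q1 := card_field_gt1.
have UE : \dim U = \dim W + i.+2 by lia.
move: count; rewrite UE addnS /= [X in _ = _ + (X - _) * _]expnS !expnD.
have w0 : 0 < q ^ \dim W by rewrite expn_gt0 ltnW.
have Q2 : 1 < q ^ i.+1 by rewrite -(expn0 q) ltn_exp2l.
rewrite qnumS -/g; move: gE Q2 w0; move: (q ^ i.+1) (q ^ \dim W) => Q w gE Q2 w0 E.
(* The double count divided by q^(dim W). With Q = g (q - 1) + 1 its solution is x = g + Q. *)
have {}E : x * Q = x + (q * Q - 1) * g.
  apply/eqP; rewrite -(eqn_pmul2l w0); apply/eqP.
  have -> : w * (x * Q) = x * (w * Q) by lia.
  rewrite E mulnDr; congr (_ + _).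
  by rewrite [RHS]mulnA [in RHS]mulnBr muln1 [in RHS]mulnCA.
nia.
Qed.

End HyperplaneCount.

Local Open Scope ring_scope.

(** * Eigenspaces and the Norton product *)

Section Spectrum.
Variables (R : realType) (X : finType) (e : rel X).
Hypothesis e_sym : symmetric e.

Local Notation RX := {ffun X -> R^o}.
Local Notation A := (@adjacency_fun R X e).
Local Notation V := (passmx.leigenspace (adjacency R e)).

Definition ind (P : pred X) : RX := [ffun x => (P x)%:R].
Definition pmul (f g : RX) : RX := [ffun x => f x * g x].

Lemma adjacencyE f x : A f x = \sum_(y | e x y) f y.
Proof. by rewrite ffunE. Qed.

Lemma mem_leigenspace th f : (f \in V th) = (A f == th *: f).
Proof.
rewrite memv_ker add_lfunE opp_lfunE scale_lfunE id_lfunE lfunE /=.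
by rewrite subr_eq0.
Qed.

Lemma leigenvalueP th :
  reflect (exists2 f : RX, f != 0 & A f = th *: f) (passmx.leigenvalue (adjacency R e) th).
Proof.
apply: (iffP idP) => [V_neq0|[f f_neq0 /eqP Af]].
  exists (vpick (V th)); first by rewrite vpick0.
  by apply/eqP; rewrite -mem_leigenspace memv_pick.
by apply: contra_neq f_neq0 => V0; apply/eqP; rewrite -memv0 -V0 mem_leigenspace.
Qed.

Lemma innerDl (f g h : RX) : inner (f + g) h = inner f h + inner g h.
Proof. by have := inner_is_scalar h 1 f g; rewrite scale1r mul1r. Qed.

Lemma innerZl a (f h : RX) : inner (a *: f) h = a * inner f h.
Proof.
have in0 : inner 0 h = 0 by rewrite /inner big1 // => x _; rewrite ffunE mul0r.
by have := inner_is_scalar h a f 0; rewrite addr0 in0 addr0.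
Qed.

Lemma innerNl (f h : RX) : inner (- f) h = - inner f h.
Proof. by rewrite -scaleN1r innerZl mulN1r. Qed.

Lemma innerDr (f g h : RX) : inner f (g + h) = inner f g + inner f h.
Proof. by rewrite !(innerC f) innerDl. Qed.

Lemma innerZr a (f h : RX) : inner f (a *: h) = a * inner f h.
Proof. by rewrite !(innerC f) innerZl. Qed.

Lemma innerNr (f h : RX) : inner f (- h) = - inner f h.
Proof. by rewrite !(innerC f) innerNl. Qed.

Lemma inner0r (f : RX) : inner f 0 = 0.
Proof. by rewrite -(scale0r (0 : RX)) innerZr mul0r. Qed.

Lemma inner_sumr (I : Type) (r : seq I) (P : pred I) (F : I -> RX) f :
  inner f (\sum_(i <- r | P i) F i) = \sum_(i <- r | P i) inner f (F i).
Proof. by apply: (big_morph (inner f)) => [g h|]; rewrite ?innerDr ?inner0r. Qed.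

Lemma eq_indicator (P Q : pred X) : P =1 Q -> ind P = ind Q.
Proof. by move=> PQ; apply/ffunP => x; rewrite !ffunE PQ. Qed.

Lemma inner_ind (f : RX) P : inner f (ind P) = \sum_(x | P x) f x.
Proof.
rewrite /inner [RHS]big_mkcond; apply: eq_bigr => x _; rewrite ffunE.
by case: (P x); rewrite ?mulr1 ?mulr0.
Qed.

Lemma adjacency_self_adjoint f g : inner (A f) g = inner f (A g).
Proof.
rewrite /inner; under eq_bigr => x _ do rewrite adjacencyE mulr_suml.
under [RHS]eq_bigr => x _ do rewrite adjacencyE mulr_sumr.
rewrite (exchange_big_dep xpredT) //=; apply: eq_bigr => x _.
by apply: eq_bigl => y; rewrite e_sym.
Qed.

Lemma eigenvectors_orthogonal a b f g :
  A f = a *: f -> A g = b *: g -> a != b -> inner f g = 0.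
Proof.
move=> Af Ag ab; have := adjacency_self_adjoint f g.
rewrite Af Ag innerZl innerZr => /eqP; rewrite -subr_eq0 -mulrBl mulf_eq0.
by rewrite subr_eq0 (negPf ab) => /eqP.
Qed.

(** The difference between the true projection and the candidate w lies in the eigenspace, so it may
    serve as its own test vector. *)
Lemma norton_eq th (u v w : subvs_of (V th)) :
  (forall t, t \in V th -> inner (pmul (vsval u) (vsval v) - vsval w) t = 0) ->
  norton u v = w.
Proof.
move=> uvw; apply: val_inj; apply/eqP; rewrite -subr_eq0; apply/eqP/inner_eq0.
set p := norton u v; pose d := vsval p - vsval w.
have dV : d \in V th by rewrite rpredB ?subvsP.
have /(_ (Subvs dV)) := @orthogonal_projP R X (V th) (pmul (vsval u) (vsval v)).
rewrite -/p /= => pd; have wd := uvw _ dV.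
rewrite -/d -[d in inner d _](subrKA (pmul (vsval u) (vsval v))) addrC.
by rewrite innerDl wd add0r -opprB innerNl pd oppr0.
Qed.

Lemma norton_proj th (u v : subvs_of (V th)) t : t \in V th ->
  inner (pmul (vsval u) (vsval v)) t = inner (vsval (norton u v)) t.
Proof.
move=> tV; have /(_ (Subvs tV)) := @orthogonal_projP R X (V th) (pmul (vsval u) (vsval v)).
by move/eqP; rewrite innerDl innerNl subr_eq0 => /eqP.
Qed.

(* The eigenvalues come from an induction over a family O of subobjects of the
   vertices (partial words, subsets, isotropic subspaces): for an eigenvector f
   whose sums over the vertices incident to a subobject all vanish below rank
   rk W, the sum over the vertices incident to W forces the eigenvalue al W. *)
Section Subobjects.
Variables (O : Type) (good : O -> Prop) (inc : O -> pred X) (rk : O -> nat) (al : O -> R).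
Hypothesis incA : forall W, good W -> forall f : RX,
  (forall H, good H -> (rk H < rk W)%N -> inner f (ind (inc H)) = 0) ->
  inner f (A (ind (inc W))) = al W * inner f (ind (inc W)).
Hypothesis inc_vertex : forall x, exists2 W, good W & inc W =1 pred1 x.

Lemma eigenvector_eq0 lam f : A f = lam *: f ->
  (forall W, good W -> al W = lam -> inner f (ind (inc W)) = 0) -> f = 0.
Proof.
move=> Af f_lam.
have f_inc W : good W -> inner f (ind (inc W)) = 0.
  have [h] := ubnP (rk W); elim: h => // h IHh in W *; rewrite ltnS => Wh gW.
  have := incA gW (fun H gH HW => IHh H (leq_trans HW Wh) gH).
  rewrite -adjacency_self_adjoint Af innerZl => /eqP.
  rewrite -subr_eq0 -mulrBl mulf_eq0 subr_eq0 => /orP[/eqP lamW|/eqP//].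
  exact/f_lam.
apply/ffunP => x; have [W gW incW] := inc_vertex x.
have := f_inc W gW; rewrite inner_ind (eq_bigl _ _ incW) big_pred1_eq => ->.
by rewrite ffunE.
Qed.

Lemma eigenvalue_rank lam : passmx.leigenvalue (adjacency R e) lam ->
  exists2 W, good W & al W = lam.
Proof.
move=> /leigenvalueP[f f_neq0 Af]; apply: contrapT => noW; case/eqP: f_neq0.
by apply: (eigenvector_eq0 Af) => W gW alW; case: noW; exists W.
Qed.

Lemma second_largest_eigenvalueE (K tau th : R) :
  passmx.leigenvalue (adjacency R e) K -> passmx.leigenvalue (adjacency R e) tau ->
  tau < K -> (forall W, good W -> al W = K \/ al W <= tau) ->
  second_largest_eigenvalue e th -> th = tau.
Proof.
move=> K_eig tau_eig tauK al_le [th_eig [th0 [th0_eig th_lt th_max]]].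
have bnd lam : passmx.leigenvalue (adjacency R e) lam -> lam = K \/ lam <= tau.
  by move=> /eigenvalue_rank[W gW <-]; exact: al_le.
have th0K : th0 = K.
  case: (th_max _ K_eig) => // K_le; case: (bnd _ th0_eig) => // th0_le.
  by have := lt_le_trans th_lt th0_le; lra.
case: (bnd _ th_eig) => [thK|th_le]; first by rewrite th0K thK ltxx in th_lt.
case: (th_max _ tau_eig) => [tauE|tau_le]; last by apply/eqP; rewrite eq_le th_le tau_le.
by rewrite th0K in tauE; rewrite tauE ltxx in tauK.
Qed.

(** The function f + f o s is again an eigenvector. On a subobject of eigenvalue th, s exchanges
    incident and nonincident vertices, so its sum there is the sum of f over all vertices, which is
    0 by orthogonality to the constants. *)
Lemma eigenvector_antisymmetric (s : X -> X) th K f : involutive s ->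
  (forall x y, e (s x) (s y) = e x y) ->
  (forall W, good W -> al W = th -> forall x, inc W (s x) = ~~ inc W x) ->
  A (ind predT) = K *: ind predT -> K != th -> f \in V th ->
  forall x, f (s x) = - f x.
Proof.
move=> ss es sW A1 Kth; rewrite mem_leigenspace => /eqP Af x.
pose g : RX := [ffun x => f x + f (s x)].
have Ag : A g = th *: g.
  apply/ffunP => y; rewrite adjacencyE.
  have -> : (th *: g) y = th * f y + th * f (s y).
    by rewrite !ffunE /= /GRing.scale /= mulrDr.
  have Afy z : \sum_(w | e z w) f w = th * f z.
    by have /ffunP/(_ z) := Af; rewrite adjacencyE [X in _ = X -> _]ffunE.
  under eq_bigr => z _ do rewrite ffunE.
  rewrite big_split /= Afy; congr (_ + _).
  rewrite -Afy (reindex_inj (inv_inj ss)) /=; apply: eq_big => [z|z _]; last by rewrite ss.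
  by rewrite -es ss.
have g0 : g = 0.
  apply: (eigenvector_eq0 Ag) => W gW alW; rewrite inner_ind.
  under eq_bigr => y _ do rewrite ffunE.
  rewrite big_split /= [X in _ + X](reindex_inj (inv_inj ss)) /=.
  rewrite [X in _ + X](eq_big (fun y => ~~ inc W y) f) => [|y|y _]; last by rewrite ss.
    transitivity (\sum_y f y); first by rewrite [RHS](bigID (inc W)).
    transitivity (inner f (ind predT)); first by rewrite inner_ind.
    by apply: (eigenvectors_orthogonal Af A1); rewrite eq_sym.
  exact: sW.
by have /ffunP/(_ x) := g0; rewrite !ffunE => /eqP; rewrite addrC addr_eq0 => /eqP.
Qed.

End Subobjects.

(** A product of three functions that are odd under s sums to 0. *)
Lemma norton_eq0 th (s : X -> X) : involutive s ->
  (forall f, f \in V th -> forall x, f (s x) = - f x) ->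
  forall u v : subvs_of (V th), norton u v = 0.
Proof.
move=> ss anti u v; apply: norton_eq => t tV; rewrite subr0.
set S := inner _ _; suff : S = - S by lra.
rewrite {1}/S /inner (reindex_inj (inv_inj ss)) /= -sumrN.
apply: eq_bigr => x _; rewrite !ffunE (anti _ tV) (anti _ (subvsP u)) (anti _ (subvsP v)).
ring.
Qed.

(** * Idempotents and eigenvectors of their multiplications *)

Section Probe.
Variables (th : R) (c z : RX) (mu nu : R).
Hypotheses (cV : c \in V th) (zV : z \in V th) (z_neq0 : z != 0) (mu_neq0 : mu != 0).
Hypothesis cc : forall t, t \in V th -> inner (pmul c c - mu *: c) t = 0.
Hypothesis cz : forall t, t \in V th -> inner (pmul c z - nu *: z) t = 0.

Let C : subvs_of (V th) := mu^-1 *: Subvs cV.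
Let Z n : subvs_of (V th) := (nu / mu) ^+ n *: Subvs zV.

Let vsC : vsval C = mu^-1 *: c. Proof. by rewrite /C linearZ. Qed.

Let vsZ n : vsval (Z n) = (nu / mu) ^+ n *: z. Proof. by rewrite /Z linearZ. Qed.

Lemma probe_idem : norton C C = C.
Proof.
apply: norton_eq => t /cc ct; rewrite vsC.
have -> : pmul (mu^-1 *: c) (mu^-1 *: c) - mu^-1 *: c =
   mu^-2 *: (pmul c c - mu *: c).
  by apply/ffunP => x; rewrite !ffunE /=; rewrite /GRing.scale /=; field.
by rewrite innerZl ct mulr0.
Qed.

Lemma probe_step n : norton C (Z n) = Z n.+1.
Proof.
apply: norton_eq => t /cz ct; rewrite vsC !vsZ.
have -> : pmul (mu^-1 *: c) ((nu / mu) ^+ n *: z) - (nu / mu) ^+ n.+1 *: z =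
   (mu^-1 * (nu / mu) ^+ n) *: (pmul c z - nu *: z).
  by apply/ffunP => x; rewrite !ffunE /= /GRing.scale /= exprS; ring.
by rewrite innerZl ct mulr0.
Qed.

Lemma nortonC (u v : subvs_of (V th)) : norton u v = norton v u.
Proof. by congr orthogonal_proj; apply/ffunP => x; rewrite !ffunE mulrC. Qed.

Lemma probe_stepC n : norton (Z n) C = Z n.+1.
Proof. by rewrite nortonC probe_step. Qed.

Lemma probe_inj m n : Z m = Z n -> (nu / mu) ^+ m = (nu / mu) ^+ n.
Proof.
move=> /(congr1 vsval); rewrite !vsZ => /eqP.
by rewrite -subr_eq0 -scalerBl scaler_eq0 (negPf z_neq0) orbF subr_eq0 => /eqP.
Qed.

Lemma probe_totally_nonassociative : nu != 0 -> `|nu| < `|mu| ->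
  totally_nonassociative (@norton R X e th).
Proof.
move=> nu_neq0 nu_mu; apply: (totally_nonassociative_of_probe probe_idem probe_step probe_stepC).
move=> m n /probe_inj/(congr1 Num.norm); rewrite !normrX.
have lam0 : 0 < `|nu / mu| by rewrite normr_gt0 mulf_neq0 ?invr_neq0.
have lam1 : `|nu / mu| < 1 by rewrite normf_div ltr_pdivrMr ?normr_gt0 // mul1r.
by apply: ieexprIn; rewrite ?lt_eqF.
Qed.

Lemma probe_parities m (t t' : tree m) : nu = - mu ->
  tree_equiv (@norton R X e th) t t' -> parities (val t) = parities (val t').
Proof.
move=> nuE tt'; apply: eq_parities; first by rewrite (eqP (valP t)) (eqP (valP t')).
move=> i; rewrite (eqP (valP t)) => im.
have /probe_inj := tree_equiv_depths probe_idem probe_step probe_stepC tt' im.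
rewrite nuE mulNr divff // -[LHS]signr_odd -[RHS]signr_odd.
by move/signr_inj.
Qed.

End Probe.

Lemma leigenvalue_valency K (x : X) :
  A (ind predT) = K *: ind predT -> passmx.leigenvalue (adjacency R e) K.
Proof.
move=> A1; apply/leigenvalueP; exists (ind predT) => //.
by apply/eqP => /ffunP/(_ x); rewrite !ffunE => /eqP; rewrite oner_eq0.
Qed.

(* Sets whose indicators lie in the span of the constants and of V th. *)
Section Points.
Variables (th K c0 : R) (M : nat) (P Pa Pb : pred X).
Hypothesis A1 : A (ind predT) = K *: ind predT.
Hypothesis Kth : K != th.
Hypothesis AP : A (ind P) = th *: ind P + c0 *: ind predT.
Hypothesis APa : A (ind Pa) = th *: ind Pa + c0 *: ind predT.
Hypothesis APb : A (ind Pb) = th *: ind Pb + c0 *: ind predT.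
(** M is the ratio |X|/|P|: pairing [AP] with the constants gives K |P| = th |P| + c0 |X|. This
    relation makes the centered indicator of P an eigenvector. *)
Hypotheses (c0M : K - th = c0 * M%:R) (M_ge3 : (3 <= M)%N).
Hypotheses (PPa : forall x, P x -> Pa x = false) (PPb : forall x, P x -> Pb x = false).
Variable x0 : X.
Hypothesis Pab : Pa x0 != Pb x0.

Let A_lin := @adjacency_fun_is_linear R X e.
Let M_neq0 : M%:R != 0 :> R. Proof. by rewrite pnatr_eq0; lia. Qed.

Let c : RX := ind P - M%:R^-1 *: ind predT.
Let z : RX := ind Pa - ind Pb.

Let AB f a g : A (f - a *: g) = A f - a *: A g.
Proof. by rewrite addrC -scaleNr A_lin addrC scaleNr. Qed.

Lemma points_c : c \in V th.
Proof.
rewrite mem_leigenspace AB AP A1; apply/eqP/ffunP => x.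
rewrite !ffunE /= /GRing.scale /=.
have -> : K = th + c0 * M%:R by rewrite -c0M; ring.
by field; exact: M_neq0.
Qed.

Lemma points_z : z \in V th.
Proof.
rewrite mem_leigenspace /z -[ind Pb]scale1r AB APa APb scale1r; apply/eqP.
by rewrite scale1r scalerBr opprD addrACA subrr addr0.
Qed.

Lemma points_z_neq0 : z != 0.
Proof.
apply/eqP => /ffunP/(_ x0); rewrite !ffunE => /eqP; rewrite subr_eq0 eqr_nat.
by case: (Pa x0) (Pb x0) Pab => [] [].
Qed.

(** As [ind P] is idempotent, the square of c is a combination of c and of a constant, and constants
    are orthogonal to the eigenspace. *)
Lemma points_cc t : t \in V th ->
  inner (pmul c c - (1 - 2 / M%:R) *: c) t = 0.
Proof.
rewrite mem_leigenspace => /eqP At.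
have -> : pmul c c - (1 - 2 / M%:R) *: c = (M%:R^-1 - M%:R^-2) *: ind predT.
  apply/ffunP => x; rewrite !ffunE /= /GRing.scale /=.
  by case: (P x) => /=; field; exact: M_neq0.
by rewrite innerZl (eigenvectors_orthogonal A1 At) ?mulr0.
Qed.

(** An identity of functions, before any projection: z vanishes on P, and c equals -1/M off P. *)
Lemma points_cz t : t \in V th -> inner (pmul c z - (- M%:R^-1) *: z) t = 0.
Proof.
move=> _; have -> : pmul c z - (- M%:R^-1) *: z = 0; last by rewrite innerC inner0r.
apply/ffunP => x; rewrite !ffunE /= /GRing.scale /=.
have [Px|_] := boolP (P x); last by rewrite /=; ring.
by rewrite PPa // PPb //= subrr !mulr0 subrr.
Qed.

Lemma points_mu_neq0 : 1 - 2 / M%:R != 0 :> R.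
Proof.
have M3 : 3 <= M%:R :> R by rewrite ler_nat.
have -> : 1 - 2 / M%:R = (M%:R - 2) / M%:R :> R by field; exact: M_neq0.
by rewrite mulf_neq0 ?invr_neq0 //; apply: lt0r_neq0; lra.
Qed.

Lemma points_totally_nonassociative : (4 <= M)%N ->
  totally_nonassociative (@norton R X e th).
Proof.
move=> M4; apply: (probe_totally_nonassociative points_c points_z points_z_neq0
  points_mu_neq0 points_cc points_cz); first by rewrite oppr_eq0 invr_neq0.
have M4' : 4 <= M%:R :> R by rewrite ler_nat.
have -> : 1 - 2 / M%:R = (M%:R - 2) / M%:R :> R by field; exact: M_neq0.
rewrite normrN normf_div ltr_pdivlMr ?normr_gt0 // normfV mulVf ?normr_eq0 //.
by rewrite ger0_norm; lra.
Qed.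

(** For M = 3 both 1 - 2/M and 1/M are 1/3, so the eigenvalue is -1. *)
Lemma points_parities m (t t' : tree m) : M = 3%N ->
  tree_equiv (@norton R X e th) t t' -> parities (val t) = parities (val t').
Proof.
move=> M3; apply: (probe_parities points_c points_z points_z_neq0
  points_mu_neq0 points_cc points_cz).
by rewrite M3; field.
Qed.

End Points.
End Spectrum.

Lemma conj_tree_equiv (R : rcfType) (S : Type) (op : S -> S -> S) (I : Type)
    (Phi : S -> I -> R[i]) :
  (forall u v, Phi u =1 Phi v -> u = v) ->
  (forall u v i, Phi (op u v) i = ((Phi u i * Phi v i)^*)%C) ->
  forall m (t t' : tree m), parities (val t) = parities (val t') ->
  tree_equiv op t t'.
Proof.
move=> Phi_inj PhiM m t t' tt' z; apply: Phi_inj => i.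
pose op' (a b : R[i]) := ((a * b)^*)%C.
rewrite !(@paren_morph _ _ op op' (fun u => Phi u i)) => [|u v|u v] //.
apply: (@tree_equiv_twisted _ _ *%R%R (fun a : R[i] => (a^*)%C)) => //.
- exact: rmorph1.
- exact: rmorphM.
- by move=> a; rewrite conjcK.
Qed.

(** * Hamming graphs *)

Section CubeRoot.
Variable R : realType.

(** The primitive cube root of unity exp(2 i pi / 3). *)
Definition cube_root : R[i] := (- (1 / 2) +i* (Num.sqrt 3 / 2))%C.

Lemma sqrt3_sqr : Num.sqrt 3 ^+ 2 = 3 :> R.
Proof. by rewrite sqr_sqrtr. Qed.

Lemma cube_root_sqr : cube_root ^+ 2 = (cube_root^*)%C.
Proof.
have h : Num.sqrt 3 * Num.sqrt 3 = 3 :> R by rewrite -expr2 sqrt3_sqr.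
apply/eqP; rewrite expr2 eq_complex /=; apply/andP; split; apply/eqP; first by nra.
by field.
Qed.

Lemma cube_root_sum : 1 + cube_root + cube_root ^+ 2 = 0.
Proof.
rewrite cube_root_sqr; apply/eqP; rewrite eq_complex /=.
by apply/andP; split; apply/eqP; field.
Qed.

(** Real relations between the three cube roots of unity have equal coefficients, which vanish when
    their sum does. *)
Lemma cube_root_free (a b c : R) : a + b + c = 0 ->
  a%:C%C + b%:C%C * cube_root + c%:C%C * cube_root ^+ 2 = 0 -> [/\ a = 0, b = 0 & c = 0].
Proof.
have h : Num.sqrt 3 != 0 :> R by rewrite sqrtr_eq0 -ltNge.
rewrite cube_root_sqr => abc /eqP; rewrite eq_complex /= => /andP[/eqP re /eqP im].
have bc : b = c.
  apply/eqP; rewrite -subr_eq0; apply/eqP/(mulIf h); rewrite mul0r.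
  by rewrite -[RHS](mulr0 2) -[in RHS]im; field.
by rewrite bc in abc re *; split; lra.
Qed.

(* On zero-sum functions on three points, the product followed by the
   projection onto zero-sum functions is, in terms of Fourier coefficients,
   the conjugate of the product of complex numbers. *)
Lemma fourier3 (a0 a1 a2 b0 b1 b2 : R) : a0 + a1 + a2 = 0 -> b0 + b1 + b2 = 0 ->
  3 * ((a0 * b0)%:C%C + (a1 * b1)%:C%C * cube_root + (a2 * b2)%:C%C * cube_root ^+ 2) =
  (((a0%:C%C + a1%:C%C * cube_root + a2%:C%C * cube_root ^+ 2) *
   (b0%:C%C + b1%:C%C * cube_root + b2%:C%C * cube_root ^+ 2))^*)%C.
Proof.
move=> a b; have -> : a0 = - a1 - a2 by lra.
have -> : b0 = - b1 - b2 by lra.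
rewrite cube_root_sqr; apply/eqP; rewrite eq_complex /=.
have := sqrt3_sqr; move: (Num.sqrt 3) => s h.
by apply/andP; split; apply/eqP; field: h.
Qed.

Lemma conjc_scale (n : R) (x y : R[i]) :
  ((n%:C * x * (n%:C * y))^* = n%:C * n%:C * (x * y)^*)%C.
Proof.
case: x y => [x1 x2] [y1 y2]; apply/eqP; rewrite eq_complex /=.
by apply/andP; split; apply/eqP; ring.
Qed.

End CubeRoot.

Section Hamming.
Variables (R : realType) (X : finType) (e : rel X) (d' m' : nat).
Let d := d'.+1. Let m := m'.+2.
Variables (w : X -> {ffun 'I_d -> 'I_m}) (g : {ffun 'I_d -> 'I_m} -> X).
Hypotheses (wK : cancel w g) (gK : cancel g w).
Hypothesis we : forall x y, @hamming_rel d m (w x) (w y) = e x y.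

Local Notation RX := {ffun X -> R^o}.
Local Notation A := (@adjacency_fun R X e).
Local Notation V := (passmx.leigenspace (adjacency R e)).

Definition upd x l b := g [ffun i => if i == l then b else w x i].

Lemma w_upd x l b i : w (upd x l b) i = if i == l then b else w x i.
Proof. by rewrite gK ffunE. Qed.

Lemma w_eq x y : w x =1 w y -> x = y.
Proof. by move=> /ffunP/(can_inj wK). Qed.

Lemma hamming_sym : symmetric e.
Proof.
move=> x y; rewrite -!we /hamming_rel; congr (_ == _).
by apply: eq_card => i; rewrite !inE eq_sym.
Qed.

Lemma hamming_adjacency (f : RX) x :
  A f x = \sum_l \sum_b f (upd x l b) - d%:R * f x.
Proof.
rewrite adjacencyE; transitivity (\sum_l \sum_(b | b != w x l) f (upd x l b)).
  rewrite pair_big_dep /=.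
  (* The inverse of changing one letter: the position where y differs from x, and its letter there.
     The default is not reached for a neighbour y. *)
  pose h y := let l := odflt ord0 [pick l | w x l != w y l] in (l, w y l).
  rewrite (reindex_onto (fun p => upd x p.1 p.2) h) /= => [|y].
    apply: eq_bigl => -[l b] /=; rewrite -we /hamming_rel.
    have diff : [pred i | w x i != w (upd x l b) i] =1 [pred i | (i == l) && (b != w x l)].
      move=> i; rewrite /= w_upd; have [->|] := eqVneq i l; first by rewrite eq_sym.
      by rewrite eqxx.
    rewrite (eq_card diff) /h (eq_pick diff); have [bxl|bxl] := eqVneq b (w x l).
      by rewrite (@eq_card _ _ pred0) ?card0 // => i; rewrite inE /= andbF.
    rewrite (@eq_card _ _ (pred1 l)) ?card1 => [|i]; last by rewrite !inE ?andbT.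
    case: pickP => [i /=|/(_ l)/=]; last by rewrite eqxx.
    by rewrite ?andbT => /eqP->; rewrite w_upd !eqxx.
  rewrite -we /hamming_rel /h => /eqP/mem_card1[l xy].
  have diff i : (w x i != w y i) = (i == l) by have := xy i; rewrite !inE.
  apply: w_eq => i; rewrite w_upd; case: pickP => [l' /=|/(_ l)]; last by rewrite /= diff eqxx.
  rewrite diff => /eqP->; case: (eqVneq i l) => [->//|il].
  by apply/eqP; rewrite -[_ == _]negbK diff.
have -> : d%:R * f x = \sum_(l < d) f x by rewrite sumr_const card_ord mulr_natl.
rewrite -sumrB; apply: eq_bigr => l _; rewrite [in RHS](bigD1 (w x l)) //=.
have -> : upd x l (w x l) = x by apply: w_eq => i; rewrite w_upd; case: eqP => [->|].
by rewrite addrC addrK.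
Qed.

(** A partial word with domain S is represented by S and any vertex extending it, whose other
    letters are ignored. *)
Definition subword (W : {set 'I_d} * X) : pred X :=
  [pred x | [forall i in W.1, w x i == w W.2 i]].

Lemma subword_upd S v x l b : subword (S, v) (upd x l b) =
  if l \in S then subword (S :\ l, v) x && (b == w v l) else subword (S, v) x.
Proof.
case: ifP => lS /=.
  apply/forall_inP/andP => [Sv|[/forall_inP Sv /eqP bl] i iS]; last first.
    by rewrite w_upd; have [->|il] := eqVneq i l; [rewrite bl|apply: Sv; rewrite !inE il].
  split; last by have := Sv l lS; rewrite w_upd eqxx.
  by apply/forall_inP => i; rewrite !inE => /andP[/negPf il /Sv]; rewrite w_upd il.
by apply: eq_forallb => i; rewrite w_upd; have [->|] := eqVneq i l; rewrite ?lS.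
Qed.

Definition hamming_eigenvalue (j : nat) : R := m%:R * (d%:R - j%:R) - d%:R.

(** At a position l of S exactly one letter agrees with v, which leaves the condition on S minus l;
    at a position outside S all m letters are allowed. *)
Lemma adjacency_subword S v :
  A (ind _ (subword (S, v))) = hamming_eigenvalue #|S| *: ind _ (subword (S, v))
    + \sum_(l in S) ind _ (subword (S :\ l, v)).
Proof.
apply/ffunP => x; rewrite hamming_adjacency [RHS]ffunE sum_ffunE [(_ *: _ : RX) x]ffunE.
have -> : \sum_l \sum_b (ind R (subword (S, v)) : RX) (upd x l b) =
    \sum_l (if l \in S then (ind R (subword (S :\ l, v)) : RX) x
            else m%:R * (ind R (subword (S, v)) : RX) x).
  apply: eq_bigr => l _; have [lS|lS] := boolP (l \in S).
    rewrite (bigD1 (w v l)) //= big1 ?addr0 => [|b /negPf bl].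
      by rewrite !ffunE subword_upd lS eqxx andbT.
    by rewrite ffunE subword_upd lS bl andbF.
  rewrite (eq_bigr (fun _ => (ind R (subword (S, v)) : RX) x)) => [|b _].
    by rewrite sumr_const card_ord mulr_natl.
  by rewrite !ffunE subword_upd (negPf lS).
rewrite (bigID (mem S)) /= (eq_bigr (fun l => (ind R (subword (S :\ l, v)) : RX) x)); last first.
  by move=> l ->.
rewrite [X in _ + X - _](eq_bigr (fun l => m%:R * (ind R (subword (S, v)) : RX) x)); last first.
  by move=> l /negPf->.
rewrite sumr_const; set k := #|_|; rewrite -[_ *+ k]mulr_natr.
have -> : k%:R = d%:R - #|S|%:R :> R.
  by rewrite -[in d%:R](card_ord d) -(cardC (mem S)) natrD addrC addKr.
by rewrite /hamming_eigenvalue /GRing.scale /=; ring.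
Qed.

Definition letter l a : pred X := [pred x | w x l == a].

Lemma letter_subword l v : subword ([set l], v) =1 letter l (w v l).
Proof.
move=> x; apply/forall_inP/idP => [/(_ l (set11 l))//|/= xl i].
by rewrite inE => /eqP->.
Qed.

Lemma subword0 v : subword (set0, v) =1 predT.
Proof. by move=> x; apply/forall_inP => i; rewrite inE. Qed.

Local Notation K := (hamming_eigenvalue 0).
Local Notation tau := (hamming_eigenvalue 1).

Let x0 : X := g [ffun => ord0].

Lemma hamming_adjacency_const : A (ind R predT) = K *: ind R predT.
Proof.
have := adjacency_subword set0 x0.
by rewrite big_set0 addr0 cards0 !(eq_indicator R (subword0 x0)).
Qed.

Lemma adjacency_letter l a : A (ind R (letter l a)) = tau *: ind R (letter l a) + 1 *: ind R predT.
Proof.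
have := adjacency_subword [set l] (upd x0 l a).
rewrite big_set1 cards1 setDv !(eq_indicator R (letter_subword _ _)) w_upd eqxx.
by rewrite (eq_indicator R (subword0 _)) scale1r.
Qed.

Lemma subword_vertex x : subword (setT, x) =1 pred1 x.
Proof.
move=> y; apply/forall_inP/eqP => [xy|-> //].
by apply: w_eq => i; apply/eqP/xy.
Qed.

Lemma adjacency_subword_inner (W : {set 'I_d} * X) (f : RX) :
  (forall H : {set 'I_d} * X, True -> (#|H.1| < #|W.1|)%N -> inner f (ind R (subword H)) = 0) ->
  inner f (A (ind R (subword W))) =
  hamming_eigenvalue #|W.1| * inner f (ind R (subword W)).
Proof.
case: W => S v f0; rewrite adjacency_subword innerDr innerZr inner_sumr.
rewrite big1 ?addr0 // => l lS; apply: f0 => //=.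
by rewrite [in X in (_ < X)%N](cardsD1 l) lS.
Qed.

Lemma hamming_gap : tau < K.
Proof.
have m0 : 0 < m%:R :> R by rewrite ltr0n.
by rewrite /hamming_eigenvalue subr0 ltrD2r ltr_pM2l // ltrBlDr ltrDl.
Qed.

Lemma hamming_gapE : K - tau = 1 * m%:R.
Proof. by rewrite /hamming_eigenvalue; ring. Qed.

Lemma letter_gt0 l a : (0 < #|letter l a|)%N.
Proof.
by apply/card_gt0P; exists (upd x0 l a); rewrite !inE w_upd eqxx.
Qed.

Let a1 : 'I_m := Ordinal (isT : (1 < m)%N).

Lemma hamming_second_largest th : second_largest_eigenvalue e th -> th = tau.
Proof.
apply: (second_largest_eigenvalueE hamming_sym (good := fun _ => True)
  (fun W _ f => @adjacency_subword_inner W f)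
  _ (leigenvalue_valency x0 hamming_adjacency_const) _ hamming_gap) => [x|| [S v] _].
- by exists (setT, x) => //; exact: subword_vertex.
(* The constant terms in the images of two letters cancel in their difference. *)
- apply/leigenvalueP; exists (ind R (letter ord0 ord0) - ind R (letter ord0 a1)).
    apply/eqP => /ffunP/(_ (upd x0 ord0 ord0)); rewrite !ffunE /letter /= !w_upd /= => /eqP.
    by rewrite subr0 oner_eq0.
  rewrite -[ind R (letter ord0 a1)]scale1r addrC -scaleNr.
  rewrite adjacency_fun_is_linear !adjacency_letter; apply/ffunP => x.
  by rewrite !ffunE /= /GRing.scale /=; ring.
rewrite /=; case: #|S| => [|j]; [by left | right].
have m0 : 0 <= m%:R :> R by rewrite ler0n.
rewrite /hamming_eigenvalue lerD2r ler_wpM2l // lerB // ler1n //.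
Qed.

Lemma hamming_totally_nonassociative th : (4 <= m)%N -> second_largest_eigenvalue e th ->
  totally_nonassociative (@norton R X e th).
Proof.
move=> m4 /hamming_second_largest->.
have m2 : (2 < m)%N by lia.
have disj a b : a != b -> forall x, letter ord0 a x -> letter ord0 b x = false.
  by move=> ab x; rewrite /letter /= => /eqP->; exact: negbTE.
apply: (points_totally_nonassociative hamming_sym hamming_adjacency_const _
  (adjacency_letter ord0 ord0) (adjacency_letter ord0 a1)
  (adjacency_letter ord0 (Ordinal m2)) hamming_gapE _
  (disj _ _ _) (disj _ _ _) (x0 := upd x0 ord0 a1)) => //.
- by rewrite gt_eqF ?hamming_gap.
- by rewrite /letter /= !w_upd.
Qed.

Lemma hamming_parities th (n : nat) (t t' : tree n) : m = 3%N ->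
  second_largest_eigenvalue e th ->
  tree_equiv (@norton R X e th) t t' -> parities (val t) = parities (val t').
Proof.
move=> m3 /hamming_second_largest->.
have m2 : (2 < m)%N by lia.
have disj a b : a != b -> forall x, letter ord0 a x -> letter ord0 b x = false.
  by move=> ab x; rewrite /letter /= => /eqP->; exact: negbTE.
apply: (points_parities hamming_sym hamming_adjacency_const _
  (adjacency_letter ord0 ord0) (adjacency_letter ord0 a1)
  (adjacency_letter ord0 (Ordinal m2)) hamming_gapE _
  (disj _ _ _) (disj _ _ _) (x0 := upd x0 ord0 a1)) => //.
- by rewrite gt_eqF ?hamming_gap.
- by rewrite /letter /= !w_upd.
Qed.

Lemma hamming_eigenvalue_inj i j : hamming_eigenvalue i = hamming_eigenvalue j -> i = j.
Proof.
have m0 : m%:R != 0 :> R by rewrite pnatr_eq0.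
by move=> /addIr/(mulfI m0)/(addrI d%:R)/oppr_inj/eqP; rewrite eqr_nat => /eqP.
Qed.

Lemma hamming_norton_eq0 th : m = 2%N -> second_largest_eigenvalue e th ->
  forall u v : subvs_of (V th), norton u v = 0.
Proof.
move=> m2 /hamming_second_largest->.
(* Over two letters, [rev_ord] exchanges them, so s is the antipodal map. *)
pose s x := g [ffun i => rev_ord (w x i)].
have ss : involutive s by move=> x; apply: w_eq => i; rewrite /s !gK !ffunE rev_ordK.
have ws x i : w (s x) i = rev_ord (w x i) by rewrite gK ffunE.
have rev2 (a b : 'I_m) : (rev_ord a == b) = (a != b).
  by rewrite -!val_eqE /=; case: a b => [a am] [b bm] /=; lia.
apply: (norton_eq0 (s := s)) => // f fV.
apply: (eigenvector_antisymmetric hamming_sym (good := fun _ => True)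
  (fun W _ f => @adjacency_subword_inner W f) _ _ _ _ hamming_adjacency_const _ fV) => //.
- by move=> x; exists (setT, x) => //; exact: subword_vertex.
- move=> x y; rewrite -!we /hamming_rel; congr (_ == _); apply: eq_card => i.
  by rewrite !inE !ws (inj_eq rev_ord_inj).
- move=> [S v] _ /= /hamming_eigenvalue_inj/eqP/cards1P[l ->] x.
  by rewrite !letter_subword /letter /= ws rev2.
- by rewrite gt_eqF ?hamming_gap.
Qed.


Definition swap l a b x := g [ffun i => if i == l then tperm a b (w x i) else w x i].

Lemma w_swap l a b x i : w (swap l a b x) i = if i == l then tperm a b (w x i) else w x i.
Proof. by rewrite gK ffunE. Qed.

Lemma swapK l a b : involutive (swap l a b).
Proof.
by move=> x; apply: w_eq => i; rewrite !w_swap; case: (i == l); rewrite ?tpermK.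
Qed.

Lemma swap_upd l b x : swap l (w x l) b x = upd x l b.
Proof.
by apply: w_eq => i; rewrite w_swap w_upd; have [->|] := eqVneq i l; rewrite ?tpermL.
Qed.

Lemma swap_adj l a b x y : e (swap l a b x) (swap l a b y) = e x y.
Proof.
rewrite -!we /hamming_rel; congr (_ == _); apply: eq_card => i.
by rewrite !inE !w_swap; case: (i == l); rewrite ?(inj_eq perm_inj).
Qed.

Lemma mem_V_pointwise th (f : RX) : f \in V th -> forall x, \sum_(y | e x y) f y = th * f x.
Proof.
rewrite mem_leigenspace => /eqP/ffunP Af x.
by have := Af x; rewrite adjacencyE [X in _ = X -> _]ffunE.
Qed.

Definition letter_mean (u : X -> R) l a : R :=
  (\sum_(x | letter l a x) u x) / #|letter l a|%:R.

Lemma sum_letter_swap (T : nmodType) (f : X -> T) l a b :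
  \sum_(x | letter l a x) f x = \sum_(x | letter l b x) f (swap l a b x).
Proof.
rewrite (reindex_inj (inv_inj (swapK l a b))); apply: eq_bigl => x.
by rewrite /letter /= w_swap eqxx -(inj_eq (@perm_inj _ (tperm a b))) tpermK tpermL.
Qed.

Lemma card_letterE l a b : #|letter l a| = #|letter l b|.
Proof. by rewrite -!sum1_card; exact: sum_letter_swap. Qed.

Lemma sum_V_eq0 (u : RX) : u \in V tau -> \sum_x u x = 0.
Proof.
rewrite mem_leigenspace => /eqP Au.
have := eigenvectors_orthogonal hamming_sym Au hamming_adjacency_const.
by rewrite inner_ind lt_eqF ?hamming_gap // => ->.
Qed.

Lemma sum_letter_mean (u : X -> R) l : \sum_x u x = 0 -> \sum_a letter_mean u l a = 0.
Proof.
move=> u0; rewrite (eq_bigr (fun a => (\sum_(x | letter l a x) u x) / #|letter l ord0|%:R)).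
  have E : \sum_a \sum_(x | letter l a x) u x = \sum_x u x.
    by rewrite [RHS](partition_big (fun x => w x l) xpredT).
  by rewrite -mulr_suml E u0 mul0r.
by move=> a _; rewrite /letter_mean (card_letterE l a ord0).
Qed.

Lemma sum_letter_residual (u : X -> R) l a :
  \sum_(x | letter l a x) (u x - letter_mean u l (w x l)) = 0.
Proof.
rewrite sumrB (eq_bigr (fun=> letter_mean u l a) (F1 := fun x => letter_mean _ _ _));
  last by move=> x /eqP->.
rewrite sumr_const -[_ *+ _]mulr_natr divfK ?subrr // pnatr_eq0 -lt0n.
exact: letter_gt0.
Qed.

(* Hence an element of the eigenspace is a sum of functions of one letter. *)
Lemma residual_upd (u : RX) l x b : u \in V tau ->
  u (upd x l b) - letter_mean u l b = u x - letter_mean u l (w x l).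
Proof.
(* Removing from u the means over the letters at l leaves an element of the eigenspace: these means
   add up to 0, so the constants produced by [adjacency_letter] cancel. *)
move=> uV; pose r : RX := [ffun y => u y - letter_mean u l (w y l)].
have rV : r \in V tau.
  rewrite mem_leigenspace; apply/eqP/ffunP => y.
  rewrite [RHS]ffunE [r y]ffunE /GRing.scale /= mulrBr adjacencyE.
  under eq_bigr => z _ do rewrite ffunE.
  rewrite sumrB (mem_V_pointwise uV); congr (_ - _).
  pose h : RX := \sum_a letter_mean u l a *: ind R (letter l a).
  have hE z : h z = letter_mean u l (w z l).
    rewrite /h sum_ffunE (bigD1 (w z l)) //= !ffunE /letter /= eqxx big1 => [|a aw].
      by rewrite /GRing.scale /= mulr1 addr0.
    by rewrite !ffunE /= eq_sym (negPf aw) /GRing.scale /= mulr0.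
  under eq_bigr => z _ do rewrite -hE.
  rewrite -hE -adjacencyE; have -> : A h = tau *: h; last by rewrite ffunE.
  rewrite /h linear_sum (eq_bigr (fun a => tau *: (letter_mean u l a *: ind R (letter l a))
      + letter_mean u l a *: ind R predT)) => [|a _].
    by rewrite big_split /= -scaler_sumr -scaler_suml sum_letter_mean ?scale0r ?addr0 // sum_V_eq0.
  by rewrite linearZ /= adjacency_letter scale1r scalerDr !scalerA mulrC.
pose s := swap l (w x l) b; have ss : involutive s := swapK _ _ _.
(* The claim is that r is invariant under exchanging two letters at l. The defect f is an
   eigenvector with zero sum over every letter at every position: at l because r has zero sums
   there, elsewhere because s preserves the set summed over. Hence f = 0. *)
pose f : RX := [ffun y => r y - r (s y)].
have Af : A f = tau *: f.
  apply/ffunP => y; rewrite [RHS]ffunE [f y]ffunE /GRing.scale /= mulrBr adjacencyE.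
  under eq_bigr => z _ do rewrite ffunE.
  rewrite sumrB (mem_V_pointwise rV); congr (_ - _).
  rewrite -(mem_V_pointwise rV) [RHS](reindex_inj (inv_inj ss)) /=.
  by apply: eq_bigl => z; rewrite swap_adj.
suff /ffunP/(_ x) : f = 0.
  by rewrite !ffunE /s swap_upd w_upd eqxx => /eqP; rewrite subr_eq0 => /eqP.
apply: (eigenvector_eq0 hamming_sym (good := fun _ => True)
  (fun W _ f => @adjacency_subword_inner W f) _ Af) => [y|[S v] _].
  by exists (setT, y) => //; exact: subword_vertex.
move=> /= /hamming_eigenvalue_inj/eqP/cards1P[j ->]; rewrite inner_ind.
under eq_bigl => y do rewrite letter_subword.
under eq_bigr => y _ do rewrite ffunE.
have r0 a : \sum_(y | letter l a y) r y = 0.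
  by under eq_bigr => y _ do rewrite ffunE; exact: sum_letter_residual.
rewrite sumrB; have [->|jl] := eqVneq j l.
  rewrite r0 sub0r; apply/eqP; rewrite oppr_eq0; apply/eqP.
  transitivity (\sum_(y | letter l (tperm (w x l) b (w v l)) y) r y); last exact: r0.
  rewrite [RHS](reindex_inj (inv_inj ss)) /=.
  by apply: eq_bigl => y; rewrite /letter /= w_swap eqxx (inj_eq perm_inj).
apply/eqP; rewrite subr_eq0 [eqbLHS](reindex_inj (inv_inj ss)) /=; apply/eqP.
by apply: eq_bigl => y; rewrite /letter /= w_swap (negPf jl).
Qed.

End Hamming.

(** * Fourier coefficients for H(d, 3) *)

Section HammingThree.
Variables (R : realType) (X : finType) (e : rel X) (d' : nat).
Local Notation d := d'.+1.
Variables (w : X -> {ffun 'I_d -> 'I_3}) (g : {ffun 'I_d -> 'I_3} -> X).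
Hypotheses (wK : cancel w g) (gK : cancel g w).
Hypothesis we : forall x y, @hamming_rel d 3 (w x) (w y) = e x y.

Local Notation RX := {ffun X -> R^o}.
Local Notation V := (passmx.leigenspace (adjacency R e)).
Local Notation tau := (hamming_eigenvalue R d' 1 1).
Local Notation om := (cube_root R).
Local Notation C x := (x%:C%C : R[i]).
Local Notation letter := (letter w).
Local Notation mean := (letter_mean w).

Let N (l : 'I_d) : nat := #|letter l ord0|.

Lemma card_letter3 l a : #|letter l a| = N l.
Proof. exact: (@card_letterE X d' 1 w g wK gK). Qed.

(** Fubini: q does not depend on the letter at l, and h depends on nothing else. *)
Lemma sum_mul_letter (q : X -> R[i]) (h : 'I_3 -> R[i]) l :
  (forall x b, q (upd w g x l b) = q x) ->
  \sum_x q x * h (w x l) = (\sum_a h a) * (\sum_(x | letter l ord0 x) q x).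
Proof.
move=> q_upd; rewrite (partition_big (fun x => w x l) xpredT) //= mulr_suml.
apply: eq_bigr => a _; rewrite mulr_sumr.
rewrite (eq_bigr (fun x => h a * q x)) => [|x /eqP->]; last exact: mulrC.
rewrite (@sum_letter_swap X d' 1 w g wK gK _ _ l a ord0).
apply: eq_bigr => x xl; congr (_ * _).
have -> : swap w g l a ord0 x = upd w g x l a; last exact: q_upd.
rewrite -(@swap_upd X d' 1 w g wK gK); have /eqP -> := xl.
by congr g; apply/ffunP => i; rewrite !ffunE tpermC.
Qed.

Definition fourier (u : X -> R) (l : 'I_d) : R[i] := \sum_x C (u x) * om ^+ w x l.

Let i1 : 'I_3 := lift ord0 ord0.
Let i2 : 'I_3 := lift ord0 (lift ord0 ord0).

Lemma sum3 (T : nmodType) (F : 'I_3 -> T) : \sum_a F a = F ord0 + F i1 + F i2.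
Proof. by rewrite !big_ord_recl big_ord0 addr0 addrA. Qed.

Let N_neq0 l : (N l)%:R != 0 :> R.
Proof. by rewrite pnatr_eq0 -lt0n (@letter_gt0 X d' 1 w g gK). Qed.

Lemma fourierE u l : fourier u l = C (N l)%:R *
  (C (mean u l ord0) + C (mean u l i1) * om + C (mean u l i2) * om ^+ 2).
Proof.
rewrite /fourier (partition_big (fun x => w x l) xpredT) //=.
rewrite (eq_bigr (fun a : 'I_3 => C (N l)%:R * (C (mean u l a) * om ^+ a))) => [|a _].
  by rewrite -mulr_sumr sum3 /= mulr1.
rewrite mulrA -rmorphM /= /letter_mean card_letter3 [(N l)%:R * _]mulrC divfK //.
by rewrite rmorph_sum mulr_suml; apply: eq_bigr => x /eqP->.
Qed.

Lemma sum_mean (u : RX) l : u \in V tau -> mean u l ord0 + mean u l i1 + mean u l i2 = 0.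
Proof.
move=> uV; rewrite -sum3; apply: (sum_letter_mean wK gK).
exact: (@sum_V_eq0 R X e d' 1 w g wK gK we).
Qed.

(** Each factor is a function of the letter at l plus a residual independent of it. The residuals
    sum to 0, which kills the mixed terms; the product of residuals is killed by the sum of the cube
    roots of unity. What is left is [fourier3], and 3 N is |X|. *)
Lemma fourier_mul (u v : RX) l : u \in V tau -> v \in V tau ->
  C (3 * (N l)%:R) * fourier (fun x => u x * v x) l = ((fourier u l * fourier v l)^*)%C.
Proof.
move=> uV vV; pose r (u : RX) x := u x - mean u l (w x l).
have r_upd (f : RX) : f \in V tau -> forall x b, r f (upd w g x l b) = r f x.
  move=> fV x b; rewrite /r (@w_upd X d' 1 w g gK) eqxx.
  exact: (@residual_upd R X e d' 1 w g wK gK we).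
have r0 (f : RX) : f \in V tau -> \sum_(x | letter l ord0 x) C (r f x) = 0.
  move=> fV; rewrite -rmorph_sum /=.
  by rewrite (@sum_letter_residual R X d' 1 w g gK).
have om_sum : \sum_(a < 3) om ^+ a = 0 by rewrite sum3 /= expr0 expr1 cube_root_sum.
have -> : fourier (fun x => u x * v x) l =
    \sum_x 1 * (C (mean u l (w x l) * mean v l (w x l)) * om ^+ w x l)
  + \sum_x C (r u x) * (C (mean v l (w x l)) * om ^+ w x l)
  + \sum_x C (r v x) * (C (mean u l (w x l)) * om ^+ w x l)
  + \sum_x C (r u x) * C (r v x) * om ^+ w x l.
  rewrite -!big_split; apply: eq_bigr => x _ /=; rewrite /r.
  by rewrite !(rmorphM, rmorphB) /=; ring.
rewrite (@sum_mul_letter _ (fun a => C (mean u l a * mean v l a) * om ^+ a)) //.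
rewrite (@sum_mul_letter _ (fun a => C (mean v l a) * om ^+ a)) => [|x b]; last by rewrite r_upd.
rewrite (@sum_mul_letter _ (fun a => C (mean u l a) * om ^+ a)) => [|x b]; last by rewrite r_upd.
rewrite (@sum_mul_letter _ (fun a => om ^+ a)) => [|x b]; last by rewrite !r_upd.
rewrite !r0 // !mulr0 om_sum mul0r !addr0 sumr_const.
have -> : #|letter l ord0| = N l by exact: card_letter3.
have -> : \sum_a C (mean u l a * mean v l a) * om ^+ a = C (mean u l ord0 * mean v l ord0)
    + C (mean u l i1 * mean v l i1) * om + C (mean u l i2 * mean v l i2) * om ^+ 2.
  by rewrite sum3 /= expr0 expr1 mulr1.
rewrite !fourierE; have F := fourier3 (sum_mean l uV) (sum_mean l vV).
apply: eq_trans (esym (conjc_scale _ _ _)).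
apply: eq_trans (congr1 (fun y => C (N l)%:R * C (N l)%:R * y) F).
have -> : C (3 * (N l)%:R) = 3 * C (N l)%:R by rewrite rmorphM rmorph_nat.
have -> : C (N l)%:R = (N l)%:R := rmorph_nat _ _.
ring.
Qed.

(** A coefficient determines the three means at its position, as they add up to 0, and the sums over
    letters determine an element of the eigenspace. *)
Lemma fourier_inj (u v : RX) : u \in V tau -> v \in V tau ->
  fourier u =1 fourier v -> u = v.
Proof.
move=> uV vV uv; apply/eqP; rewrite -subr_eq0; apply/eqP.
have : u - v \in V tau by rewrite rpredB.
have : forall l, fourier (u - v) l = 0.
  move=> l; rewrite -(subrr (fourier u l)) {2}uv /fourier -sumrB.
  by apply: eq_bigr => x _; rewrite -mulrBl -rmorphB !ffunE.
move: (u - v) => f f0 fV.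
have Af : adjacency_fun e f = tau *: f by apply/eqP; rewrite -mem_leigenspace.
apply: (eigenvector_eq0 (hamming_sym we) (good := fun _ => True)
  (fun W _ f => @adjacency_subword_inner R X e d' 1 w g wK gK we W f) _ Af) => [x|[S y] _].
  by exists (setT, x) => //; exact: (subword_vertex wK).
move=> /= /hamming_eigenvalue_inj/eqP/cards1P[l ->]; rewrite inner_ind.
under eq_bigl => x do rewrite letter_subword.
move: (w y l) => a.
have /eqP := f0 l; rewrite fourierE mulf_eq0 => /orP[/eqP[/eqP]|/eqP].
  by rewrite (negPf (N_neq0 l)).
case/(cube_root_free (sum_mean l fV)) => m0 m1 m2.
suff /eqP : mean f l a = 0.
  by rewrite /letter_mean card_letter3 mulf_eq0 invr_eq0 (negPf (N_neq0 l)) orbF => /eqP.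
case: a => -[|[|[|//]]] i.
- by rewrite (_ : Ordinal i = ord0) //; exact: val_inj.
- by rewrite (_ : Ordinal i = i1) //; exact: val_inj.
- by rewrite (_ : Ordinal i = i2) //; exact: val_inj.
Qed.

(** Since the powers of [om] sum to 0, a coefficient only involves inner products with differences
    of letters, which belong to the eigenspace. Thus it does not see the projection. *)
Lemma fourier_proj (f h : RX) l : (forall t, t \in V tau -> inner f t = inner h t) ->
  fourier f l = fourier h l.
Proof.
move=> fh; have letter_sum (k : RX) a : \sum_(x | letter l a x) k x - \sum_(x | letter l ord0 x) k x
    = inner k (ind R (letter l a) - ind R (letter l ord0)).
  by rewrite innerDr innerNr !inner_ind.
have fh_letter a : \sum_(x | letter l a x) f x - \sum_(x | letter l ord0 x) f x =
   \sum_(x | letter l a x) h x - \sum_(x | letter l ord0 x) h x.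
  rewrite !letter_sum; apply: fh; rewrite mem_leigenspace.
  rewrite -[ind R (letter l ord0)]scale1r addrC -scaleNr.
  rewrite adjacency_fun_is_linear !(@adjacency_letter R X e d' 1 w g wK gK we).
  apply/eqP/ffunP => x.
  by rewrite !ffunE /= /GRing.scale /=; ring.
have fourier_diff k : fourier k l =
    \sum_a C (\sum_(x | letter l a x) k x - \sum_(x | letter l ord0 x) k x) * om ^+ a.
  rewrite /fourier (partition_big (fun x => w x l) xpredT) //=.
  transitivity (\sum_(a < 3) C (\sum_(x | letter l a x) k x) * om ^+ a).
    apply: eq_bigr => a _; rewrite rmorph_sum mulr_suml.
    by apply: eq_bigr => x /eqP->.
  rewrite [RHS](eq_bigr (fun a : 'I_3 => C (\sum_(x | letter l a x) k x) * om ^+ a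
    - C (\sum_(x | letter l ord0 x) k x) * om ^+ a)) => [|a _]; last by rewrite -mulrBl -rmorphB.
  by rewrite sumrB -[X in _ - X]mulr_sumr sum3 /= expr0 expr1 sum3 cube_root_sum mulr0 subr0.
by rewrite !fourier_diff; apply: eq_bigr => a _; rewrite fh_letter.
Qed.

Lemma hamming3_tree_equiv th n (t t' : tree n) :
  second_largest_eigenvalue e th -> parities (val t) = parities (val t') ->
  tree_equiv (@norton R X e th) t t'.
Proof.
move=> /(@hamming_second_largest R X e d' 1 w g wK gK we) ->.
have n0 l : 3 * (N l)%:R != 0 :> R by rewrite mulf_neq0 // ?N_neq0 // pnatr_eq0.
apply: (conj_tree_equiv (Phi := fun u : subvs_of (V tau) => fun l =>
  C (3 * (N l)%:R)^-1 * fourier (vsval u) l)) => [u v uv|u v l].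
  apply/val_inj/fourier_inj; [exact: subvsP..|] => l.
  apply: (@mulfI _ (C (3 * (N l)%:R)^-1)); last exact: uv.
  by rewrite fmorph_eq0 invr_eq0.
rewrite -(@fourier_proj (pmul (vsval u) (vsval v))); last by move=> k kV; exact: norton_proj.
apply: eq_trans (esym (conjc_scale _ _ _)).
apply: eq_trans (congr1 (fun y => C (3 * (N l)%:R)^-1 * C (3 * (N l)%:R)^-1 * y)
  (fourier_mul l (subvsP u) (subvsP v))).
have -> : fourier (pmul (vsval u) (vsval v)) l = fourier (fun x => vsval u x * vsval v x) l.
  by apply: eq_bigr => x _; rewrite ffunE.
have k : C (3 * (N l)%:R)^-1 * C (3 * (N l)%:R) = 1 by rewrite -rmorphM mulVf ?rmorph1.
by rewrite [RHS]mulrA -[X in _ = X * _]mulrA k mulr1.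
Qed.

End HammingThree.

(** * Johnson graphs *)

Section Johnson.
Variables (R : realType) (X : finType) (e : rel X) (n k : nat) (s : X -> {set 'I_n}).
Hypotheses (s_inj : injective s) (s_card : forall x, #|s x| = k).
Hypothesis s_surj : forall B : {set 'I_n}, #|B| = k -> exists x, s x = B.
Hypothesis es : forall x y, e x y = (#|s x :&: s y|.+1 == k)%N.
Hypotheses (k_gt0 : (0 < k)%N) (k_le : (2 * k <= n)%N).
Variable x0 : X.

Local Notation RX := {ffun X -> R^o}.
Local Notation A := (@adjacency_fun R X e).
Local Notation V := (passmx.leigenspace (adjacency R e)).

Lemma johnson_sym : symmetric e.
Proof. by move=> x y; rewrite !es setIC. Qed.

Definition vertex (B : {set 'I_n}) : X := odflt x0 [pick y | s y == B].

Lemma s_vertex (B : {set 'I_n}) : #|B| = k -> s (vertex B) = B.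
Proof.
move=> /s_surj[x xB]; rewrite /vertex; case: pickP => [y /eqP//|/(_ x)].
by rewrite xB eqxx.
Qed.

Lemma vertexK x : vertex (s x) = x.
Proof. exact/s_inj/s_vertex. Qed.

Let exch (x : X) (i j : 'I_n) := j |: (s x :\ i).

Lemma card_exch x i j : i \in s x -> j \notin s x -> #|exch x i j| = k.
Proof.
move=> ix jx; rewrite cardsU1 !inE (negPf jx) andbF /=.
by have := cardsD1 i (s x); rewrite ix s_card => ->.
Qed.

Lemma johnson_adjacency (f : RX) x :
  A f x = \sum_(i in s x) \sum_(j in ~: s x) f (vertex (exch x i j)).
Proof.
rewrite adjacencyE pair_big /=.
have [i0 _] : exists i, i \in s x0 by apply/card_gt0P; rewrite s_card.
pose h y := (odflt i0 [pick i in s x :\: s y], odflt i0 [pick j in s y :\: s x]).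
have diff1 y : e x y -> exists i j, s x :\: s y = [set i] /\ s y :\: s x = [set j].
  rewrite es => /eqP xy.
  have /eqP/cards1P[i iE] : #|s x :\: s y| = 1%N.
    by have := cardsID (s y) (s x); rewrite s_card; lia.
  have /eqP/cards1P[j jE] : #|s y :\: s x| = 1%N.
    by have := cardsID (s x) (s y); rewrite s_card setIC; lia.
  by exists i, j.
have pick1 (i : 'I_n) : odflt i0 [pick j in [set i]] = i.
  by case: pickP => [j /set1P->//|/(_ i)]; rewrite set11.
rewrite (reindex_onto (fun p => vertex (exch x p.1 p.2)) h) /= => [|y /diff1[i [j [xy yx]]]].
  apply: eq_bigl => -[i j] /=; rewrite inE.
  apply/andP/andP => [[/[dup] xe /diff1[i' [j' [xy yx]]] /eqP]|[ix jx]].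
    rewrite /h xy yx !pick1 => -[<- <-].
    have := set11 i'; rewrite -xy inE => /andP[_ ->].
    by have := set11 j'; rewrite -yx inE => /andP[->].
  have E := s_vertex (card_exch ix jx).
  have ij : i != j by apply: contraNneq jx => <-.
  have xy : s x :\: exch x i j = [set i].
    apply/setP => a; rewrite !inE; have [->|ai] := eqVneq a i; first by rewrite ix (negPf ij).
    by rewrite /=; case: (a \in s x); rewrite ?andbF ?andbT ?orbT ?orbF.
  have yx : exch x i j :\: s x = [set j].
    apply/setP => a; rewrite !inE; have [->|aj] := eqVneq a j; first by rewrite jx.
    by rewrite /=; case: (a \in s x); rewrite ?andbF.
  rewrite /h E xy yx !pick1 eqxx; split=> //; rewrite es E.
  by have := cardsID (exch x i j) (s x); rewrite xy cards1 s_card => <-; rewrite addn1.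
rewrite /h xy yx !pick1 -[RHS]vertexK; congr vertex; apply/setP => a.
have /setP/(_ a) := xy; have /setP/(_ a) := yx; rewrite !inE.
by case: (a \in s x); case: (a \in s y); case: (a == i); case: (a == j).
Qed.

Definition superset (W : {set 'I_n}) : pred X := [pred x | W \subset s x].

(** The usual (k - j)(n - k - j) - j, in the form in which the count below produces it. *)
Definition johnson_eigenvalue (j : nat) : R :=
  (k%:R - j%:R) * (n%:R - k%:R) - j%:R * (k%:R - j%:R + 1).

(** Exchanging i for j gives a superset of W exactly when W minus j lies in x and i is not in W, so
    the choices of i and j are independent. If W is not in x, a nonzero term requires that just one
    element of W be missing, and then i has k - |W| + 1 choices. *)
Lemma adjacency_superset (W : {set 'I_n}) :
  A (ind R (superset W)) = johnson_eigenvalue #|W| *: ind R (superset W)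
    + (k%:R - #|W|%:R + 1) *: \sum_(v in W) ind R (superset (W :\ v)).
Proof.
apply/ffunP => x; rewrite johnson_adjacency [RHS]ffunE !ffunE sum_ffunE /GRing.scale /=.
under [X in _ = _ + _ * X]eq_bigr do rewrite ffunE.
have exch_sub i j : i \in s x -> j \in ~: s x ->
    (W \subset exch x i j) = (W :\ j \subset s x) && (i \notin W).
  move=> ix; rewrite inE => jx.
  have ij : i != j by apply: contraNneq jx => <-.
  apply/subsetP/andP => [Wx|[/subsetP Wx iW] a aW].
    split; last by apply/negP => /Wx; rewrite !inE eqxx (negPf ij).
    by apply/subsetP => a; rewrite !inE => /andP[aj /Wx]; rewrite !inE (negPf aj) => /andP[].
  rewrite !inE; have [//|aj] := eqVneq a j; rewrite Wx ?inE ?aj // andbT.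
  by apply: contraNneq iW => <-.
have -> : \sum_(i in s x) \sum_(j in ~: s x) ind R (superset W) (vertex (exch x i j)) =
    #|s x :\: W|%:R * \sum_(j in ~: s x) (W :\ j \subset s x)%:R.
  rewrite exchange_big mulr_sumr; apply: eq_bigr => j jx /=.
  rewrite (eq_bigr (fun i => (W :\ j \subset s x)%:R * (i \notin W)%:R)) => [|i ix].
    rewrite -mulr_sumr mulrC -sum1_card natr_sum big_mkcond [in RHS]big_mkcond; congr (_ * _).
    by apply: eq_bigr => i _; rewrite !inE; case: (i \in s x); case: (i \in W).
  rewrite ffunE /superset /= s_vertex ?exch_sub ?card_exch //; last by rewrite inE in jx.
  by case: (_ \subset _); case: (_ \in _); rewrite /= ?mulr1 ?mulr0.
have cardD : #|s x :\: W|%:R = k%:R - #|s x :&: W|%:R :> R.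
  by rewrite -(s_card x) -(cardsID W (s x)) natrD addrC addKr.
rewrite cardD; have [Wx|Wx] := boolP (W \subset s x).
  have -> : s x :&: W = W by apply/setIidPr.
  rewrite (eq_bigr (fun _ => 1)) => [|j _]; last by rewrite (subset_trans (subsetDl _ _)).
  rewrite [X in _ = _ + _ * X](eq_bigr (fun _ => 1)) => [|j _]; last first.
    by rewrite /superset /= (subset_trans (subsetDl _ _)).
  rewrite !sumr_const; have -> : #|~: s x|%:R = n%:R - k%:R :> R.
    by rewrite -[in n%:R](card_ord n) -(cardsC (s x)) s_card natrD addrC addKr.
  by rewrite /johnson_eigenvalue /superset /= Wx /=; ring.
rewrite /superset /= (negPf Wx) mulr0 add0r.
(* In either sum only an element of W missing from [s x] can contribute. *)
have -> : \sum_(v in W) (W :\ v \subset s x)%:R = \sum_(v in ~: s x) (W :\ v \subset s x)%:R :> R.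
  rewrite big_mkcond [RHS]big_mkcond; apply: eq_bigr => v _; rewrite inE.
  have [vW|vW] := boolP (v \in W); have [vx|vx] := boolP (v \in s x) => //=.
    case: (boolP (_ \subset _)) => // Wvx; case/negP: Wx.
    apply/subsetP => a aW; have [->//|av] := eqVneq a v.
    by apply: (subsetP Wvx); rewrite !inE av.
  have -> : W :\ v = W.
    by apply/setP => a; rewrite !inE; have [->|] := eqVneq a v; rewrite ?(negPf vW).
  by rewrite (negPf Wx).
rewrite !mulr_sumr; apply: eq_bigr => v; rewrite inE => vx.
case: (boolP (_ \subset _)) => [Wvx|]; rewrite ?mulr0 // !mulr1.
have vW : v \in W.
  apply: contraNT Wx => vW; apply: subset_trans Wvx; apply/subsetP => a aW.
  by rewrite !inE aW andbT; apply: contraNneq vW => <-.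
have -> : s x :&: W = W :\ v.
  apply/setP => a; rewrite !inE; have [->|av] := eqVneq a v; first by rewrite (negPf vx).
  case aW: (a \in W); rewrite ?andbF // andbT.
  by apply: (subsetP Wvx); rewrite !inE av aW.
by rewrite [in RHS](cardsD1 v) vW natrD /=; ring.
Qed.

Lemma superset0 : superset set0 =1 predT.
Proof. by move=> x; exact: sub0set. Qed.

Local Notation K := (johnson_eigenvalue 0).
Local Notation tau := (johnson_eigenvalue 1).

Lemma johnson_adjacency_const : A (ind R predT) = K *: ind R predT.
Proof.
have := adjacency_superset set0.
by rewrite big_set0 scaler0 addr0 cards0 !(eq_indicator R superset0).
Qed.

Lemma johnson_adjacency_point a :
  A (ind R (superset [set a])) = tau *: ind R (superset [set a]) + k%:R *: ind R predT.
Proof.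
have := adjacency_superset [set a].
by rewrite big_set1 cards1 setDv (eq_indicator R superset0) subrK.
Qed.

Lemma johnson_adjacency_pair a b : a != b -> A (ind R (superset [set a; b])) =
  johnson_eigenvalue 2 *: ind R (superset [set a; b])
  + (k%:R - 1) *: (ind R (superset [set a]) + ind R (superset [set b])).
Proof.
move=> ab; have := adjacency_superset [set a; b].
rewrite big_setU1 ?inE //= big_set1 cards2 ab.
have -> : [set a; b] :\ a = [set b].
  by apply/setP => c; rewrite !inE; have [->|] := eqVneq c a; rewrite ?(negPf ab).
have -> : [set a; b] :\ b = [set a].
  by apply/setP => c; rewrite !inE; have [->|] := eqVneq c b; rewrite ?orbF // eq_sym (negPf ab).
have -> : k%:R - 2 + 1 = k%:R - 1 :> R by ring.
by move=> ->; rewrite [in RHS](addrC (ind R (superset [set a]))) .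
Qed.

Lemma adjacency_superset_inner (W : {set 'I_n}) (f : RX) :
  (forall H : {set 'I_n}, (#|H| <= k)%N -> (#|H| < #|W|)%N -> inner f (ind R (superset H)) = 0) ->
  (#|W| <= k)%N ->
  inner f (A (ind R (superset W))) = johnson_eigenvalue #|W| * inner f (ind R (superset W)).
Proof.
move=> f0 Wk; rewrite adjacency_superset innerDr !innerZr inner_sumr.
rewrite big1 ?mulr0 ?addr0 // => v vW.
by have := cardsD1 v W; rewrite vW => W1; apply: f0; lia.
Qed.

Lemma superset_vertex x : superset (s x) =1 pred1 x.
Proof.
move=> y; apply/idP/eqP => [|->]; last exact: subxx.
by rewrite /superset /= => xy; apply/s_inj/esym/eqP; rewrite eqEcard xy !s_card leqnn.
Qed.

(** The gap factors as (j - 1)(n - j). *)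
Lemma johnson_eigenvalue_lt j : (1 < j <= k)%N -> johnson_eigenvalue j < tau.
Proof.
case/andP => j1 jk.
have n2 : 2 * k%:R <= n%:R :> R by rewrite -natrM ler_nat.
have jk' : j%:R <= k%:R :> R by rewrite ler_nat.
have j1' : 1 + 1 <= j%:R :> R by rewrite -(natrD _ 1 1) ler_nat.
rewrite /johnson_eigenvalue -subr_gt0.
have -> : (k%:R - 1) * (n%:R - k%:R) - 1 * (k%:R - 1 + 1)
   - ((k%:R - j%:R) * (n%:R - k%:R) - j%:R * (k%:R - j%:R + 1))
   = (j%:R - 1) * ((n%:R - k%:R - j%:R) + (k%:R - 1)+ 1) :> R by ring.
by apply: mulr_gt0; lra.
Qed.

Lemma johnson_gap : tau < K.
Proof.
have n0 : 0 < n%:R :> R by rewrite ltr0n; lia.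
by rewrite /johnson_eigenvalue; lra.
Qed.

Lemma separating_vertex a b : a != b -> exists x, (a \in s x) && (b \notin s x).
Proof.
move=> ab; have [i0 i0x] : exists i, i \in s x0 by apply/card_gt0P; rewrite s_card.
have [j0 j0x] : exists j, j \in ~: s x0.
  by apply/card_gt0P; have := cardsC (s x0); rewrite card_ord s_card; lia.
rewrite inE in j0x; pose i := if b \in s x0 then b else i0.
pose j := if a \in s x0 then j0 else a.
have [ax|ax] := boolP (a \in s x0); have [bx|bx] := boolP (b \in s x0).
- exists (vertex (exch x0 b j0)); rewrite s_vertex ?card_exch // !inE ab ax orbT /=.
  by rewrite eqxx orbF; apply: contraNneq j0x => <-.
- by exists x0; rewrite ax.
- exists (vertex (exch x0 b a)); rewrite s_vertex ?card_exch // !inE !eqxx /=.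
  by rewrite orbF eq_sym.
- exists (vertex (exch x0 i0 a)); rewrite s_vertex ?card_exch // !inE !eqxx /=.
  by rewrite (negPf bx) andbF orbF eq_sym.
Qed.

Lemma difference_eigenvector a b :
  ind R (superset [set a]) - ind R (superset [set b]) \in V tau.
Proof.
rewrite mem_leigenspace -[ind R (superset [set b])]scale1r addrC -scaleNr.
rewrite adjacency_fun_is_linear !johnson_adjacency_point; apply/eqP/ffunP => x.
by rewrite !ffunE /= /GRing.scale /=; ring.
Qed.

Lemma difference_neq0 a b : a != b ->
  ind R (superset [set a]) - ind R (superset [set b]) != 0.
Proof.
move=> /separating_vertex[x /andP[ax bx]]; apply/eqP => /ffunP/(_ x).
by rewrite !ffunE /superset /= !sub1set ax (negPf bx) subr0 => /eqP; rewrite oner_eq0.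
Qed.

Lemma johnson_second_largest th : second_largest_eigenvalue e th -> th = tau.
Proof.
have n1 : (1 < n)%N by lia.
apply: (second_largest_eigenvalueE johnson_sym (good := fun W : {set 'I_n} => (#|W| <= k)%N)
  (rk := fun W : {set 'I_n} => #|W|)
  (fun W gW f f0 => @adjacency_superset_inner W f f0 gW)
  _ (leigenvalue_valency x0 johnson_adjacency_const) _ johnson_gap) => [x||W Wk].
- by exists (s x); rewrite ?s_card //; exact: superset_vertex.
- apply/leigenvalueP.
  exists (ind R (superset [set Ordinal (ltnW n1)]) - ind R (superset [set Ordinal n1])).
    exact: difference_neq0.
  by apply/eqP; rewrite -mem_leigenspace difference_eigenvector.
have [W1|W1] := ltnP 1 #|W|; first by right; rewrite ltW ?johnson_eigenvalue_lt ?W1.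
by case: #|W| W1 => [|[|//]] _; [left|right].
Qed.

Lemma johnson_norton_eq0 th : n = (2 * k)%N -> second_largest_eigenvalue e th ->
  forall u v : subvs_of (V th), norton u v = 0.
Proof.
move=> nk /johnson_second_largest->.
have cardC x : #|~: s x| = k by have := cardsC (s x); rewrite card_ord s_card; lia.
pose c x := vertex (~: s x).
have sc x : s (c x) = ~: s x by rewrite s_vertex.
have cc : involutive c by move=> x; apply: s_inj; rewrite !sc setCK.
apply: (norton_eq0 (s := c)) => // f fV.
apply: (eigenvector_antisymmetric johnson_sym (good := fun W : {set 'I_n} => (#|W| <= k)%N)
  (rk := fun W : {set 'I_n} => #|W|)
  (fun W gW f f0 => @adjacency_superset_inner W f f0 gW) _ _ _ _ johnson_adjacency_const _ fV) => //.
- by move=> x; exists (s x); rewrite ?s_card //; exact: superset_vertex.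
- move=> x y; rewrite !es !sc -setCU.
  have := cardsC (s x :|: s y); rewrite card_ord cardsU !s_card.
  by have := subset_leq_card (subsetIl (s x) (s y)); rewrite s_card => le E; congr (_.+1 == _); lia.
- move=> W Wk; have [W1|W1] := ltnP 1 #|W|.
    by move=> E; have := @johnson_eigenvalue_lt #|W|; rewrite W1 Wk E ltxx => /(_ isT).
  case W2: #|W| W1 => [|[|//]] _.
    by move=> E; have := johnson_gap; rewrite E ltxx.
  by move/eqP/cards1P: W2 => [a ->] _ x; rewrite /superset /= !sub1set sc inE.
- by rewrite gt_eqF ?johnson_gap.
Qed.

Lemma johnson_totally_nonassociative th : (2 * k < n)%N -> (4 <= n)%N ->
  second_largest_eigenvalue e th -> totally_nonassociative (@norton R X e th).
Proof.
move=> kn n4 /johnson_second_largest->.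
have n1 : (1 < n)%N by lia. have n2 : (2 < n)%N by lia.
pose a := Ordinal (ltnW n1); pose b := Ordinal n1; pose b' := Ordinal n2.
pose c : RX := ind R (superset [set a]) - (k%:R / n%:R) *: ind R predT.
pose z : RX := ind R (superset [set b]) - ind R (superset [set b']).
have n0 : n%:R != 0 :> R by rewrite pnatr_eq0; lia.
have kn' : 2 * k%:R < n%:R :> R by rewrite -natrM ltr_nat.
have n4' : 4 <= n%:R :> R by rewrite ler_nat.
have n20 : n%:R - 2 != 0 :> R by apply: lt0r_neq0; lra.
have A_lin := @adjacency_fun_is_linear R X e.
have cV : c \in V tau.
  rewrite mem_leigenspace /c addrC -scaleNr A_lin johnson_adjacency_point johnson_adjacency_const.
  apply/eqP/ffunP => x; rewrite !ffunE /= /GRing.scale /= /johnson_eigenvalue.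
  by field.
pose mu : R := (n%:R - 2 * k%:R) / n%:R.
(* Two points have common vertices when k > 1, so c z need not be a multiple of z. With this
   coefficient the remainder h below satisfies the equation of the eigenvalue of rank 2: the
   difference of the eigenvalues of ranks 1 and 2 is n - 2, and a pair contributes k - 1 times its
   points. *)
pose kap : R := (k%:R - 1) / (n%:R - 2).
pose nu : R := kap - k%:R / n%:R.
have mu0 : mu != 0 by rewrite mulf_neq0 ?invr_neq0 // lt0r_neq0 //; lra.
have nuE : nu = - (mu / (n%:R - 2)) by rewrite /nu /kap /mu; field; rewrite n0 n20.
have bb' : b != b' by [].
apply: (probe_totally_nonassociative cV (difference_eigenvector b b')
  (difference_neq0 bb') mu0 (nu := nu)).
- move=> t; rewrite mem_leigenspace => /eqP At.
  have -> : pmul c c - mu *: c = (k%:R / n%:R - (k%:R / n%:R) ^+ 2) *: ind R predT.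
    apply/ffunP => x; rewrite !ffunE /= /GRing.scale /= /mu.
    by case: (superset [set a] x) => /=; field.
  rewrite innerZl (eigenvectors_orthogonal johnson_sym johnson_adjacency_const At) ?mulr0 //.
  by rewrite gt_eqF ?johnson_gap.
- move=> t; rewrite mem_leigenspace => /eqP At.
  pose h : RX := ind R (superset [set a; b]) - ind R (superset [set a; b']) - kap *: z.
  have -> : pmul c z - nu *: z = h.
    apply/ffunP => x; rewrite /h /z !ffunE /= /GRing.scale /= /superset /= !subUset !sub1set /nu.
    by case: (a \in s x); case: (b \in s x); case: (b' \in s x) => /=; ring.
  apply: (eigenvectors_orthogonal johnson_sym (a := johnson_eigenvalue 2) _ At).
    have zE : A z = tau *: z by apply/eqP; rewrite -mem_leigenspace difference_eigenvector.
    rewrite /h addrC -scaleNr A_lin zE -[ind R (superset [set a; b'])]scale1r.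
    rewrite [in A _]addrC -[in A _]scaleNr A_lin !johnson_adjacency_pair //.
    apply/ffunP => x; rewrite !ffunE /= /GRing.scale /= /johnson_eigenvalue /kap.
    by field.
  by rewrite lt_eqF //; rewrite /johnson_eigenvalue; lra.
- by rewrite nuE oppr_eq0 mulf_neq0 ?invr_neq0.
- rewrite nuE normrN normf_div ltr_pdivrMr ?normr_gt0 // ltr_pMr ?normr_gt0 //.
  by rewrite ger0_norm; lra.
Qed.

End Johnson.

(** * Dual polar graphs *)

(* The common features of symplectic, quadratic and Hermitian spaces: B is
   linear in its first argument and reflexive, S is the set of singular vectors,
   and a subspace is isotropic when it consists of pairwise orthogonal singular
   vectors. *)
Record polar_space (F : finFieldType) (N : nat) (B : 'rV[F]_N -> 'rV[F]_N -> F)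
    (S : pred 'rV[F]_N) (iso : pred {vspace 'rV[F]_N}) : Prop := PolarSpace {
  polar_linear : forall w, scalar (B ^~ w);
  polar_refl : forall u v, B u v = 0 -> B v u = 0;
  singularD : forall u v, S u -> S v -> B u v = 0 -> S (u + v);
  singularZ : forall a u, S u -> S (a *: u);
  singular_self : forall u, S u -> B u u = 0;
  singular_nondegenerate : forall u, S u -> (forall w, B w u = 0) -> u = 0;
  singular_shift : forall v w, S v -> B w v != 0 -> exists t, S (w + t *: v);
  isotropicP : forall U, iso U <->
    (forall u, u \in U -> S u) /\ (forall u v, u \in U -> v \in U -> B u v = 0)
}.

Section Polar.
Variables (F : finFieldType) (N : nat) (B : 'rV[F]_N -> 'rV[F]_N -> F).
Variables (S : pred 'rV[F]_N) (iso : pred {vspace 'rV[F]_N}).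
Hypothesis PS : polar_space B S iso.
Local Notation V := 'rV[F]_N.
Implicit Types (u v w : V) (U W H Y x y z : {vspace V}).

Lemma polar0l w : B 0 w = 0.
Proof.
by have := polar_linear PS w (-1) 0 0; rewrite scaler0 addr0 mulN1r addNr.
Qed.

Lemma polarDl u v w : B (u + v) w = B u w + B v w.
Proof. by have := polar_linear PS w 1 u v; rewrite scale1r mul1r. Qed.

Lemma polarZl a u w : B (a *: u) w = a * B u w.
Proof. by have := polar_linear PS w a u 0; rewrite addr0 polar0l addr0. Qed.

Lemma polar_eq0C u v : (B u v == 0) = (B v u == 0).
Proof. by apply/eqP/eqP => /(polar_refl PS). Qed.

Definition perp_fun v : V -> F^o := fun w => B w v.

Lemma perp_fun_linear v : linear (perp_fun v).
Proof. by move=> a u w; rewrite /perp_fun polarDl polarZl. Qed.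

Definition perp1 v : {vspace V} :=
  lker (linfun (HB.pack (perp_fun v)
    (GRing.isSemilinear.Build F V F^o _ (perp_fun v)
       (GRing.semilinear_linear (perp_fun_linear v))) : {linear V -> F^o})).

Lemma mem_perp1 v w : (w \in perp1 v) = (B w v == 0).
Proof. by rewrite memv_ker lfunE. Qed.

Lemma dim_perp1 U v : (\dim U <= (\dim (U :&: perp1 v)).+1)%N.
Proof.
have := limg_ker_dim (linfun (HB.pack (perp_fun v)
    (GRing.isSemilinear.Build F V F^o _ (perp_fun v)
       (GRing.semilinear_linear (perp_fun_linear v))) : {linear V -> F^o})) U.
rewrite -/(perp1 v); set I := (_ @: U)%VS => E.
have I1 : (\dim I <= 1)%N by rewrite (leq_trans (dimvS (subvf I))) // dimvf.
apply: leq_trans (eq_leq (esym E)) _.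
exact: leq_trans (leq_add (leqnn _) I1) (eq_leq (addn1 _)).
Qed.

Definition perps U (s : seq V) := foldr (fun v Y => Y :&: perp1 v)%VS U s.

Lemma mem_perps U s w : (w \in perps U s) = (w \in U) && all (fun v => B w v == 0) s.
Proof.
elim: s => [|v s IHs] /=; first by rewrite andbT.
by rewrite memv_cap IHs mem_perp1 -andbA [X in _ && X]andbC.
Qed.

Lemma dim_perps U s : (\dim U <= \dim (perps U s) + size s)%N.
Proof.
elim: s => [|v s IHs] /=; first by rewrite addn0.
by apply: leq_trans IHs _; rewrite addnS -addSn leq_add2r dim_perp1.
Qed.

(** B is linear only on the left, so reflexivity is used to move the basis vectors there. *)
Lemma orth_basis w U : (forall u, u \in U -> B w u = 0) <-> all (fun v => B w v == 0) (vbasis U).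
Proof.
split=> [wU|/allP wU u uU]; first by apply/allP => u /vbasis_mem/wU->.
apply: (polar_refl PS); apply/eqP; rewrite -mem_perp1; apply: subvP uU.
rewrite -(span_basis (vbasisP U)); apply/span_subvP => v vU.
by rewrite mem_perp1 polar_eq0C wU.
Qed.

Definition perp Y U := perps Y (vbasis U).

Lemma perpP Y U w : reflect (w \in Y /\ forall u, u \in U -> B w u = 0) (w \in perp Y U).
Proof.
by rewrite mem_perps; apply: (iffP andP) => -[wY /orth_basis].
Qed.

Lemma dim_perp Y U : (\dim Y <= \dim (perp Y U) + \dim U)%N.
Proof. by have := dim_perps Y (vbasis U); rewrite size_tuple. Qed.

Lemma isotropic_singular U u : iso U -> u \in U -> S u.
Proof. by move=> /(isotropicP PS)[US _] /US. Qed.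

Lemma isotropic_orth U u v : iso U -> u \in U -> v \in U -> B u v = 0.
Proof. by move=> /(isotropicP PS)[_ UB]; exact: UB. Qed.

Lemma isotropicS U W : (U <= W)%VS -> iso W -> iso U.
Proof.
move=> /subvP UW isoW; apply/(isotropicP PS); split=> [u /UW|u v /UW uW /UW vW].
  exact: isotropic_singular.
exact: isotropic_orth uW vW.
Qed.

Lemma isotropicD_line U v : iso U -> S v -> (forall u, u \in U -> B u v = 0) -> iso (U + <[v]>)%VS.
Proof.
move=> isoU Sv Uv; have vU u : u \in U -> B v u = 0 by move=> /Uv/(polar_refl PS).
apply/(isotropicP PS); split=> [_ /memv_addP[u uU [_ /vlineP[a ->] ->]]|].
  apply: (singularD PS); [exact: isotropic_singular uU|exact: (singularZ PS)|].
  by apply: (polar_refl PS); rewrite polarZl vU // mulr0.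
move=> _ w /memv_addP[u uU [_ /vlineP[a ->] ->]] /memv_addP[u' u'U [_ /vlineP[a' ->] ->]].
rewrite polarDl polarZl (polar_refl PS (u := _ + _) (v := u)).
  rewrite (polar_refl PS (u := _ + _) (v := v)) ?mulr0 ?addr0 //.
  by rewrite polarDl polarZl Uv // (singular_self PS Sv) mulr0 addr0.
by rewrite polarDl polarZl vU // (isotropic_orth isoU) // mulr0 addr0.
Qed.

Lemma isotropic_line v : S v -> iso <[v]>%VS.
Proof.
move=> Sv; rewrite -[<[v]>%VS]add0v; apply: isotropicD_line => //.
  apply/(isotropicP PS); split=> [u|u w]; rewrite !memv0 => /eqP->; last by rewrite polar0l.
  by rewrite -(scale0r v); exact: (singularZ PS).
by move=> u; rewrite memv0 => /eqP->; rewrite polar0l.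
Qed.

Lemma maximal_isotropicP W : reflect (iso W /\ forall U, iso U -> (W <= U)%VS -> U = W)
  (maximal_isotropic iso W).
Proof.
apply: (iffP andP) => -[isoW maxW]; split=> //.
  by move=> U isoU WU; apply/eqP; move/forallP/(_ U): maxW; rewrite isoU WU.
by apply/forallP => U; apply/implyP => isoU; apply/implyP => WU; rewrite (maxW U).
Qed.

Lemma maximal_isotropic_mem W v : maximal_isotropic iso W -> S v ->
  (forall u, u \in W -> B u v = 0) -> v \in W.
Proof.
move=> /maximal_isotropicP[isoW maxW] Sv Wv.
by rewrite -(maxW _ (isotropicD_line isoW Sv Wv) (addvSl _ _)) memvE addvSr.
Qed.

Lemma isotropic_extend U : iso U -> exists2 W, maximal_isotropic iso W & (U <= W)%VS.
Proof.
move=> isoU; pose P W := iso W && (U <= W)%VS.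
have PU : P U by rewrite /P isoU subvv.
case: (arg_maxnP (fun W : {vspace V} => \dim W) PU) => W /andP[isoW UW] Wmax.
exists W => //; apply/maximal_isotropicP; split=> // Y isoY WY.
have := Wmax Y; rewrite /P isoY (subv_trans UW WY) => /(_ isT) dimY.
by apply/eqP; rewrite eq_sym eqEdim WY; exact: dimY.
Qed.

(** Were y larger, the vectors of y orthogonal to a complement C of x :&: y in x would form a space
    larger than x :&: y. One of them outside x would be singular and orthogonal to all of x, against
    maximality. *)
Lemma maximal_isotropic_leq x y : maximal_isotropic iso x -> maximal_isotropic iso y ->
  (\dim y <= \dim x)%N.
Proof.
move=> xm ym; have [isoy _] := maximal_isotropicP _ ym; have [isox _] := maximal_isotropicP _ xm.
rewrite leqNgt; apply/negP => xy; pose C := (x :\: y)%VS.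
have dC : (\dim (x :&: y) + \dim C = \dim x)%N by rewrite dimv_cap_compl.
have /subvPn[v /perpP[vy vC] vx] : ~~ (perp y C <= x)%VS.
  apply/negP => Zx; have : (perp y C <= x :&: y)%VS.
    by rewrite subv_cap Zx; apply/subvP => v /perpP[].
  by move/dimvS; have := dim_perp y C; lia.
case/negP: vx; apply: (maximal_isotropic_mem xm); first exact: isotropic_singular isoy vy.
move=> u; rewrite -(addv_diff_cap x y) => /memv_addP[c cC [w wxy ->]].
move: wxy; rewrite memv_cap => /andP[_ wy].
by rewrite polarDl (polar_refl PS (vC c cC)) (isotropic_orth isoy) ?addr0.
Qed.

Lemma maximal_isotropic_dim x y : maximal_isotropic iso x -> maximal_isotropic iso y ->
  \dim x = \dim y.
Proof. by move=> xm ym; apply/eqP; rewrite eqn_leq !maximal_isotropic_leq. Qed.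

(** If U were larger than a complement C of its orthogonal, a nonzero vector of U would be
    orthogonal to C, hence to everything. In characteristic 2 the polar form of a quadratic form may
    have a radical, but no nonzero singular vector lies in it. *)
Lemma dim_perp_isotropic U : iso U -> (\dim (perp fullv U) + \dim U <= N)%N.
Proof.
move=> isoU; pose C := (perp fullv U)^C%VS.
have dC : (\dim (perp fullv U) + \dim C = N)%N.
  have := dimv_compl (perp fullv U); rewrite dimvf /dim /= mul1n => ->.
  by rewrite subnKC // (leq_trans (dimvS (subvf _))) // dimvf /dim /= mul1n.
rewrite -[X in (_ <= X)%N]dC leq_add2l leqNgt; apply/negP => UC.
have : perp U C != 0%VS by rewrite -dimv_eq0; have := dim_perp U C; lia.
rewrite -vpick0; case/eqP; set z := vpick _.
have /perpP[zU zC] : z \in perp U C by exact: memv_pick.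
apply: (singular_nondegenerate PS); first exact: isotropic_singular isoU zU.
move=> w; have : w \in (perp fullv U + C)%VS.
  by rewrite (_ : _ + _ = fullv)%VS ?memvf // addv_complf.
case/memv_addP => p /perpP[_ pU] [c cC ->].
by rewrite polarDl pU // add0r (polar_refl PS (zC c cC)).
Qed.

Lemma dim_isotropic_le U : iso U -> (2 * \dim U <= N)%N.
Proof.
move=> isoU; have := dim_perp_isotropic isoU.
have : (U <= perp fullv U)%VS.
  by apply/subvP => u uU; apply/perpP; split=> [|v vU]; rewrite ?memvf ?(isotropic_orth isoU).
by move/dimvS; lia.
Qed.

Lemma exists_perp_not_perp x H : iso x -> (H <= x)%VS -> (\dim H < \dim x)%N ->
  exists2 w, (forall u, u \in H -> B w u = 0) & exists2 v, v \in x & B w v != 0.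
Proof.
move=> isox Hx dHx; have /subvPn[w /perpP[_ wH] wx] : ~~ (perp fullv H <= perp fullv x)%VS.
  apply/negP => /dimvS; have := dim_perp_isotropic isox; have := dim_perp fullv H.
  by rewrite dimvf /dim /= mul1n; lia.
exists w => //; apply: contrapT => no_v; case/negP: wx; apply/perpP; split; first exact: memvf.
move=> v vx; apply/eqP; apply: contrapT => /negP wv; apply: no_v.
by exists v.
Qed.

(** Dimensions give a vector w orthogonal to H but not to some v of x. Adding a multiple of v makes
    it singular and keeps it orthogonal to H. *)
Lemma exists_other_maximal x H : maximal_isotropic iso x -> (H <= x)%VS ->
  (\dim H).+1 = \dim x ->
  exists b, [/\ S b, b \notin x, forall u, u \in H -> B u b = 0 & iso (H + <[b]>)%VS].
Proof.
move=> xm Hx dH; have [isox _] := maximal_isotropicP _ xm.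
have [w wH [v vx wv]] : exists2 w, (forall u, u \in H -> B w u = 0) &
    exists2 v, v \in x & B w v != 0.
  by apply: (exists_perp_not_perp isox) => //; lia.
have Sv := isotropic_singular isox vx.
have [t Sb] := singular_shift PS Sv wv; pose b := w + t *: v.
have Hb u : u \in H -> B u b = 0.
  move=> uH; apply: (polar_refl PS); rewrite polarDl polarZl wH // add0r.
  by rewrite (isotropic_orth isox vx) ?mulr0 // (subvP Hx).
exists b; split=> //; last by apply: isotropicD_line => //; exact: isotropicS isox.
apply: contra wv => bx; have := isotropic_orth isox bx vx.
by rewrite polarDl polarZl (singular_self PS Sv) mulr0 addr0 => ->.
Qed.

End Polar.

Lemma dist_eq1 (X : finType) (e : rel X) x y : irreflexive e -> (dist e x y == 1%N) = e x y.
Proof.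
move=> e_irr; have walk0 u v : walk e 0 u v = (u == v).
  apply/existsP/idP => [[p]|/eqP->]; first by rewrite (tuple0 p) /=.
  by exists [tuple]; rewrite /= eqxx.
have walk1 u v : walk e 1 u v = e u v.
  apply/existsP/idP => [[p]|uv].
    by case/tupleP: p => a p; rewrite (tuple0 p) /= andbT => /andP[ua /eqP <-].
  by exists [tuple v]; rewrite /= uv eqxx.
(* [dist] searches only below #|X|; two distinct vertices bring length 1 into the range. *)
have := max_card (pred2 x y); rewrite card2 /dist.
case: #|X| => [|n]; first by case: (x == y).
rewrite /= walk0; case: eqVneq => [->|xy] /=; first by rewrite e_irr.
by case: n => //= n _; rewrite walk1; case: (e x y).
Qed.

(** * Lines, eigenvalues and points of a dual polar graph *)

Section PolarGraph.
Variables (R : realType) (F : finFieldType) (N : nat) (B : 'rV[F]_N -> 'rV[F]_N -> F).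
Variables (S : pred 'rV[F]_N) (iso : pred {vspace 'rV[F]_N}).
Hypothesis PS : polar_space B S iso.
Variables (X : finType) (e : rel X) (f : X -> {vspace 'rV[F]_N}) (d : nat).
Hypotheses (f_inj : injective f) (f_max : forall x, maximal_isotropic iso (f x)).
Hypothesis f_surj : forall W, maximal_isotropic iso W -> exists x, f x = W.
Hypothesis e_f : forall x y, e x y = ((\dim (f x :&: f y)).+1 == d)%N.
Hypotheses (f_dim : forall x, \dim (f x) = d) (d_ge2 : (1 < d)%N).
Hypothesis dr : distance_regular e.
Variable x0 : X.

Local Notation V := 'rV[F]_N.
Local Notation RX := {ffun X -> R^o}.
Local Notation A := (@adjacency_fun R X e).
Local Notation perp1 := (perp1 PS).
Implicit Types (W H : {vspace V}) (p : V) (x y z : X).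

Let e_sym : symmetric e. Proof. by case: dr. Qed.
Let e_irr : irreflexive e. Proof. by case: dr. Qed.

Let f_iso x : iso (f x). Proof. by case/maximal_isotropicP: (f_max x). Qed.

Lemma dim_cap_lt x y : x <> y -> (\dim (f x :&: f y) < d)%N.
Proof.
move=> xy; rewrite ltnNge; apply/negP => dle; apply/xy/f_inj/eqP.
have xE : (f x :&: f y)%VS = f x by apply/eqP; rewrite eqEdim capvSl f_dim.
by rewrite eqEdim !f_dim leqnn andbT -xE capvSr.
Qed.

Lemma maximal_of_dim W : iso W -> \dim W = d -> exists x, f x = W.
Proof.
move=> isoW dW; case: (isotropic_extend isoW) => U Umax WU.
have [x xU] := f_surj Umax; exists x; apply/esym/eqP.
by rewrite eqEdim xU WU -xU f_dim dW leqnn.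
Qed.

Lemma perp1_cap z p : S p -> p \notin f z ->
  \dim (f z :&: perp1 p) = d.-1.
Proof.
move=> Sp pz; have := dim_perp1 PS (f z) p; rewrite f_dim => d_le.
suff : (\dim (f z :&: perp1 p) < d)%N by lia.
rewrite -(f_dim z) ltnNge; apply/negP => dle; case/negP: pz.
apply: (maximal_isotropic_mem PS (f_max z) Sp) => u uz.
have : u \in (f z :&: perp1 p)%VS.
  by rewrite (_ : (_ :&: _)%VS = f z) //; apply/eqP; rewrite eqEdim capvSl.
by rewrite memv_cap mem_perp1 => /andP[_ /eqP].
Qed.

Lemma neighbour_cap z x p : S p -> p \notin f z -> e z x -> p \in f x ->
  (f z :&: f x = f z :&: perp1 p)%VS.
Proof.
move=> Sp pz zx px; apply/eqP; rewrite eqEdim (perp1_cap Sp pz).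
move: zx; rewrite e_f => /eqP <-; rewrite leqnn andbT subv_cap capvSl /=.
apply/subvP => u; rewrite memv_cap mem_perp1 => /andP[_ ux].
by rewrite (isotropic_orth PS (f_iso x)).
Qed.

(** The neighbour is forced: it is spanned by p and the hyperplane of z orthogonal to p. *)
Lemma neighbour_through_uniq z x y p : p \notin f z ->
  e z x -> e z y -> p \in f x -> p \in f y -> x = y.
Proof.
move=> pz zx zy px py; have Sp := isotropic_singular PS (f_iso x) px.
have space u : e z u -> p \in f u -> f u = (f z :&: perp1 p + <[p]>)%VS.
  move=> zu pu; apply/esym/eqP; rewrite eqEdim f_dim dimD_line ?perp1_cap ?prednK //.
  - by rewrite leqnn andbT subv_add -(neighbour_cap Sp pz zu pu) capvSr -memvE.
  - exact: ltnW.
  - by rewrite memv_cap (negPf pz).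
by apply: f_inj; rewrite (space x zx px) (space y zy py).
Qed.

Lemma neighbour_through z p : S p -> p \notin f z -> exists x, e z x && (p \in f x).
Proof.
move=> Sp pz; have d0 := ltnW d_ge2.
have pz' : p \notin (f z :&: perp1 p)%VS by rewrite memv_cap (negPf pz).
have [||x xE] := @maximal_of_dim (f z :&: perp1 p + <[p]>)%VS.
- apply: (isotropicD_line PS (isotropicS PS (capvSl _ _) (f_iso z)) Sp).
  by move=> u; rewrite memv_cap mem_perp1 => /andP[_ /eqP].
- by rewrite dimD_line // perp1_cap // prednK.
have px : p \in f x by rewrite xE memvE addvSr.
exists x; rewrite px andbT e_f eqn_leq; apply/andP; split.
  by apply: dim_cap_lt => zx; rewrite zx px in pz.
rewrite -[X in (X <= _)%N](prednK d0) ltnS -(perp1_cap Sp pz) dimvS //.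
by rewrite subv_cap capvSl xE addvSl.
Qed.

(** In the dual polar space a subspace H of dimension d - 1 is a line, whose points are the vertices
    above H; y itself is left out. *)
Definition line_nbrs y H := [set x | e y x && ((f y :&: f x)%VS == H)].

Lemma line_nbrs_ex y H : (H <= f y)%VS -> (\dim H).+1 = d ->
  exists2 x, x \in line_nbrs y H & exists2 b, b \in f x & b \notin f y.
Proof.
move=> Hy dH; have [|b [Sb by' Hb isoHb]] := exists_other_maximal PS (f_max y) Hy.
  by rewrite f_dim.
have bH : b \notin H by apply: contra by' => /(subvP Hy).
have [x xE] := maximal_of_dim isoHb ltac:(by rewrite dimD_line).
have bx : b \in f x by rewrite xE memvE addvSr.
have HE : (f y :&: f x)%VS = H.
  apply/esym/eqP; rewrite eqEdim subv_cap Hy xE addvSl /= -ltnS dH -xE.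
  by apply: dim_cap_lt => yx; rewrite yx bx in by'.
exists x; last by exists b.
by rewrite inE HE eqxx e_f HE dH eqxx.
Qed.

(** The common neighbours of y and x1 are the other points of their line: if z missed a vector of H,
    then y and x1 would be two neighbours of z through it. This ties the size of a line to an
    intersection number of the graph. *)
Lemma card_line_nbrs y H x1 : x1 \in line_nbrs y H ->
  #|line_nbrs y H| = #|[pred z | (dist e y z == 1%N) && (dist e x1 z == 1%N)]|.+1.
Proof.
rewrite inE => /andP[yx1 /eqP HE]; rewrite (cardsD1 x1) inE yx1 HE eqxx add1n.
congr _.+1; apply: eq_card => z; rewrite !inE !dist_eq1 //.
have HS : (H <= f y)%VS by rewrite -HE capvSl.
have HS1 : (H <= f x1)%VS by rewrite -HE capvSr.
have dH : (\dim H).+1 = d by move: yx1; rewrite e_f HE => /eqP.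
apply/and3P/andP => [[zx1 yz /eqP zH]|[yz x1z]].
  split=> //; rewrite e_f eqn_leq; apply/andP; split.
    by apply: dim_cap_lt => E; rewrite E eqxx in zx1.
  by rewrite -dH ltnS dimvS // subv_cap HS1 -zH capvSr.
split=> //; first by apply: contraTneq x1z => ->; rewrite e_irr.
have Hz : (H <= f z)%VS.
  apply/subvP => p pH; apply: contrapT => /negP pz.
  have E : y = x1.
    apply: (neighbour_through_uniq pz); rewrite 1?e_sym //.
      exact: subvP HS p pH.
    exact: subvP HS1 p pH.
  by rewrite E e_irr in yx1.
rewrite eq_sym eqEdim subv_cap HS Hz /=.
by move: yz; rewrite e_f -dH eqSS => /eqP ->.
Qed.

Lemma hyperplane_ex y : exists2 H, (H <= f y)%VS & (\dim H).+1 = d.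
Proof.
have : (0 < #|hyperplanes (f y) 0|)%N.
  rewrite card_hyperplanes ?sub0v // dimv0 subn0 f_dim; case: d d_ge2 => // k _.
  by rewrite qnumS addn_gt0 expn_gt0 (ltnW (card_field_gt1 F)) orbT.
by case/card_gt0P => H; rewrite inE f_dim => /and3P[_ Hy /eqP]; exists H.
Qed.

Lemma line_nbrs_const : exists2 s : nat, (0 < s)%N &
  forall y H, (H <= f y)%VS -> (\dim H).+1 = d -> #|line_nbrs y H| = s.
Proof.
have [H0 H0x dH0] := hyperplane_ex x0.
have [x1 x1n _] := line_nbrs_ex H0x dH0.
exists #|line_nbrs x0 H0|; first by apply/card_gt0P; exists x1.
move=> y H Hy dH; have [y1 y1n _] := line_nbrs_ex Hy dH.
rewrite (card_line_nbrs x1n) (card_line_nbrs y1n); congr _.+1.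
case: dr => _ _ _; apply; move: x1n y1n; rewrite !inE => /andP[a _] /andP[b _].
by have := dist_eq1 x0 x1 e_irr; have := dist_eq1 y y1 e_irr; rewrite a b => /eqP-> /eqP->.
Qed.

Definition above W : pred X := [pred x | (W <= f x)%VS].

Section LineSize.
Variable s : nat.
Hypothesis s_gt0 : (0 < s)%N.
Hypothesis card_line : forall y H, (H <= f y)%VS -> (\dim H).+1 = d -> #|line_nbrs y H| = s.

Lemma card_nbrs_above W y : (W <= f y)%VS ->
  #|[set x | e y x & (W <= f x)%VS]| = (s * qnum F (d - \dim W))%N.
Proof.
move=> Wy; rewrite -sum1_card.
rewrite (partition_big (fun x => (f y :&: f x)%VS) (mem (hyperplanes (f y) W))) /=.
  rewrite (eq_bigr (fun=> s)) => [|H]; last first.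
    rewrite inE f_dim => /and3P[WH Hy /eqP dH]; rewrite -(card_line Hy dH) -sum1_card.
    apply: eq_bigl => x; rewrite !inE; case: eqP => [HE|]; rewrite ?andbF // !andbT.
    by rewrite (subv_trans WH) ?andbT // -HE capvSr.
  by rewrite sum_nat_const card_hyperplanes // f_dim mulnC.
move=> x; rewrite !inE f_dim => /andP[yx Wx].
by rewrite subv_cap Wy Wx capvSl -e_f.
Qed.

(** The neighbour of y through p is the only candidate; it contains W precisely when W meets y in a
    hyperplane of W. *)
Lemma card_nbrs_above_out W y p : iso W -> p \in W -> p \notin f y ->
  #|[set x | e y x & (W <= f x)%VS]| = ((\dim (W :&: f y)).+1 == \dim W)%N.
Proof.
move=> isoW pW py; have Sp := isotropic_singular PS isoW pW.
have [x /andP[yx px]] := neighbour_through Sp py.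
have cap_lt : (\dim (W :&: f y) < \dim W)%N.
  rewrite ltnNge; apply: contra py => dle.
  have : p \in (W :&: f y)%VS; last by rewrite memv_cap => /andP[].
  by rewrite (_ : (_ :&: _)%VS = W) //; apply/eqP; rewrite eqEdim capvSl.
have -> : ((\dim (W :&: f y)).+1 == \dim W) = (W <= f x)%VS.
  apply/idP/idP => [/eqP dW|Wx].
    have WE : W = (W :&: f y + <[p]>)%VS.
      apply/esym/eqP; rewrite eqEdim subv_add capvSl -memvE pW /=.
      by rewrite dimD_line ?dW // memv_cap (negPf py) andbF.
    rewrite WE subv_add -memvE px andbT; apply/subvP => u; rewrite memv_cap => /andP[uW uy].
    have : u \in (f y :&: f x)%VS; last by rewrite memv_cap => /andP[].
    rewrite (neighbour_cap Sp py yx px) memv_cap uy mem_perp1.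
    by rewrite (isotropic_orth PS isoW) ?eqxx.
  have := dimv_sum_cap W (f y :&: f x).
  have : (\dim (W + f y :&: f x) <= d)%N.
    by rewrite -(f_dim x) dimvS // subv_add Wx capvSr.
  have : (\dim (W :&: (f y :&: f x)) <= \dim (W :&: f y))%N.
    by rewrite dimvS // subv_cap capvSl (subv_trans (capvSr _ _)) ?capvSl.
  by move: yx; rewrite e_f => /eqP; lia.
case: (boolP (W <= f x)%VS) => Wx.
  transitivity #|[set x]|; last by rewrite cards1.
  apply: eq_card => u; rewrite !inE; apply/andP/eqP => [[yu Wu]|->//].
  by apply: (neighbour_through_uniq py); rewrite ?(subvP Wu).
apply: eq_card0 => u; rewrite !inE; apply/negP => /andP[yu Wu].
case/negP: Wx; rewrite (neighbour_through_uniq py yx yu px) //.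
exact: subvP Wu p pW.
Qed.

(** The classical s [d - j] - [j] with q-integers, s being a power of q in the classical
    families. *)
Definition polar_eigenvalue (j : nat) : R := s%:R * (qnum F (d - j))%:R - (qnum F j)%:R.

(** For y above W, all hyperplanes of W lie below y, and the term - [dim W] compensates for them.
    For y not above W, at most one hyperplane of W lies below y, namely W :&: y, matching the at
    most one neighbour above W. *)
Lemma adjacency_above W : iso W ->
  A (ind R (above W)) = polar_eigenvalue (\dim W) *: ind R (above W)
   + \sum_(H in hyperplanes W 0) ind R (above H).
Proof.
move=> isoW; apply/ffunP => y; rewrite adjacencyE [RHS]ffunE sum_ffunE [(_ *: _ : RX) y]ffunE.
under [X in _ = _ + X]eq_bigr do rewrite ffunE.
have -> : \sum_(x | e y x) ind R (above W) x = #|[set x | e y x & (W <= f x)%VS]|%:R.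
  rewrite -sum1_card natr_sum; under [RHS]eq_bigl => x do rewrite inE.
  rewrite big_mkcondr; apply: eq_bigr => x _; rewrite ffunE /above /=.
  by case: (_ <= _)%VS.
rewrite [ind R _ _]ffunE /GRing.scale /=; have [Wy|] := boolP (above W y).
  rewrite card_nbrs_above // (eq_bigr (fun=> 1)) => [|H]; last first.
    by rewrite inE => /and3P[_ HW _]; rewrite /above /= (subv_trans HW).
  rewrite sumr_const card_hyperplanes ?sub0v // dimv0 subn0 natrM /polar_eigenvalue.
  by rewrite /=; ring.
move=> Wy; have /subvPn[p pW py] := Wy.
rewrite (card_nbrs_above_out isoW pW py) mulr0 add0r.
case: eqP => dW.
  rewrite (bigD1 (W :&: f y)%VS) /=; last by rewrite inE sub0v capvSl dW eqxx.
  rewrite /above /= capvSr big1 ?addr0 // => H; rewrite inE => /andP[/and3P[_ HW /eqP dH] HWy].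
  case: (boolP (H <= f y)%VS) => // Hy; case/eqP: HWy.
  by apply/eqP; rewrite eqEdim subv_cap HW Hy -ltnS dW -dH leqnn.
rewrite big1 // => H; rewrite inE => /and3P[_ HW /eqP dH]; rewrite /above /=.
case: (boolP (H <= f y)%VS) => // Hy; case: dW.
apply/eqP; rewrite eqn_leq; apply/andP; split.
  rewrite ltnNge; apply/negP => dle; case/negP: py.
  have : p \in (W :&: f y)%VS; last by rewrite memv_cap => /andP[].
  by rewrite (_ : (_ :&: _)%VS = W) //; apply/eqP; rewrite eqEdim capvSl.
by rewrite -dH ltnS dimvS // subv_cap HW Hy.
Qed.

Local Notation K := (polar_eigenvalue 0).
Local Notation tau := (polar_eigenvalue 1).

Lemma above0 : above 0 =1 predT.
Proof. by move=> x; exact: sub0v. Qed.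

Lemma iso0 : iso 0%VS.
Proof. exact: (isotropicS PS (sub0v _) (f_iso x0)). Qed.

Lemma hyperplanes0 : hyperplanes (0 : {vspace V}) 0 = set0.
Proof. by apply/setP => H; rewrite !inE dimv0 andbF andbF. Qed.

Lemma hyperplanes_line p : p != 0 -> hyperplanes <[p]> 0 = [set 0%VS].
Proof.
move=> p0; apply/setP => H; rewrite !inE sub0v dim_line // eqSS dimv_eq0 /=.
by rewrite andb_idl // => /eqP ->; exact: sub0v.
Qed.

Lemma polar_adjacency_const : A (ind R predT) = K *: ind R predT.
Proof.
have := adjacency_above iso0.
by rewrite hyperplanes0 big_set0 addr0 dimv0 !(eq_indicator R above0).
Qed.

Lemma polar_adjacency_point p : S p -> p != 0 ->
  A (ind R (above <[p]>)) = tau *: ind R (above <[p]>) + 1 *: ind R predT.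
Proof.
move=> Sp p0; have := adjacency_above (isotropic_line PS Sp).
by rewrite hyperplanes_line // big_set1 dim_line // (eq_indicator R above0) scale1r.
Qed.

Lemma adjacency_above_inner W : iso W -> forall g : RX,
  (forall H, iso H -> (\dim H < \dim W)%N -> inner g (ind R (above H)) = 0) ->
  inner g (A (ind R (above W))) = polar_eigenvalue (\dim W) * inner g (ind R (above W)).
Proof.
move=> isoW g g0; rewrite adjacency_above // innerDr innerZr inner_sumr.
rewrite big1 ?addr0 // => H; rewrite inE => /and3P[_ HW /eqP dH].
by apply: g0; [exact: (isotropicS PS HW isoW)|rewrite -dH].
Qed.

Lemma above_vertex x : above (f x) =1 pred1 x.
Proof.
move=> y; apply/idP/eqP => [|->]; last exact: subvv.
by rewrite /above /= => xy; apply/f_inj/esym/eqP; rewrite eqEdim xy !f_dim leqnn.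
Qed.

Lemma polar_gapE : K - tau = 1 * (s * #|F| ^ d.-1).+1%:R.
Proof.
have q0 : qnum F 0 = 0%N by rewrite /qnum big_ord0.
have q1 : qnum F 1 = 1%N by rewrite /qnum big_ord1.
rewrite /polar_eigenvalue subn0 q0 q1; case: d d_ge2 => // k _.
rewrite subn1 [k.+1.-1]/= qnumS natrD -[(s * _).+1%:R]natr1 natrM; ring.
Qed.

Lemma polar_gap : tau < K.
Proof. by rewrite -subr_gt0 polar_gapE mul1r ltr0n. Qed.

Lemma polar_eigenvalue_le W : iso W -> polar_eigenvalue (\dim W) = K \/
  polar_eigenvalue (\dim W) <= tau.
Proof.
move=> _; case: (\dim W) => [|j]; [by left|right].
rewrite /polar_eigenvalue lerB // ?ler_nat ?qnum_leq //.
by rewrite ler_wpM2l ?ler0n // ler_nat qnum_leq // leq_sub2l.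
Qed.

(** Write x0 = H + <p>, take a in another vertex x1 above H and b = a + r with r in H nonzero: b is
    not orthogonal to p because r is and a is not. A second vertex x2 through a hyperplane of x1
    containing a but not r separates a from b. *)
Lemma exists_points : exists p a b x,
  [/\ S p /\ p != 0, S a /\ a != 0, S b /\ b != 0, B a p != 0 /\ B b p != 0
    & above <[a]> x && ~~ above <[b]> x].
Proof.
have [H Hx dH] := hyperplane_ex x0.
have /subvPn[p px pH] : ~~ (f x0 <= H)%VS.
  by apply/negP => /dimvS; rewrite f_dim -dH ltnn.
have [x1 + [a ax1 ax0]] := line_nbrs_ex Hx dH; rewrite inE => /andP[_ /eqP HE].
have Hx1 : (H <= f x1)%VS by rewrite -HE capvSr.
have Sp := isotropic_singular PS (f_iso _) px.
have Sa := isotropic_singular PS (f_iso _) ax1.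
have xE : f x0 = (H + <[p]>)%VS.
  by apply/esym/eqP; rewrite eqEdim subv_add Hx -memvE px f_dim (dimD_line pH) dH leqnn.
have ap : B a p != 0.
  move: (ax0); apply: contra => /eqP ap; apply: (maximal_isotropic_mem PS (f_max x0) Sa) => u.
  rewrite xE => /memv_addP[h hH [_ /vlineP[c ->] ->]].
  rewrite (polarDl PS) (polarZl PS) (isotropic_orth PS (f_iso x1) (subvP Hx1 _ hH) ax1) add0r.
  by rewrite (polar_refl PS ap) mulr0.
have [r rH r0] : exists2 r, r \in H & r != 0.
  by exists (vpick H); rewrite ?memv_pick // vpick0 -dimv_eq0 -lt0n -ltnS dH.
have a0 : a != 0 by move: (ax0); apply: contraNneq => ->; rewrite mem0v.
have p0 : p != 0 by move: (pH); apply: contraNneq => ->; rewrite mem0v.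
have rx1 : r \in f x1 by rewrite (subvP Hx1).
have br : a + r \in f x1 by rewrite rpredD.
have ra : r \notin <[a]>%VS.
  move: (ax0); apply: contra => /vlineP[k rk].
  have k0 : k != 0 by move: (r0); apply: contraNneq => k0; rewrite rk k0 scale0r.
  by rewrite -(scalerK k0 a) -rk rpredZ // (subvP Hx).
have [H' aH' rH'] : exists2 H', H' \in hyperplanes (f x1) <[a]> & r \notin H'.
  (* Fewer hyperplanes of [f x1] contain both a and r than contain a. *)
  apply/exists_inP; rewrite -negb_forall_in; apply/negP => /forall_inP all_r.
  have sub : hyperplanes (f x1) <[a]> \subset hyperplanes (f x1) (<[a]> + <[r]>).
    apply/subsetP => H1 H1a; have rH1 := all_r _ H1a.
    by move: H1a; rewrite !inE subv_add => /and3P[-> -> ->]; rewrite -memvE rH1.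
  have ax1' : (<[a]> <= f x1)%VS by rewrite -memvE.
  have ax1r : (<[a]> + <[r]> <= f x1)%VS by rewrite subv_add ax1' -memvE.
  have := subset_leq_card sub; rewrite !card_hyperplanes // f_dim dimD_line // dim_line //.
  case: d d_ge2 => [|[|k]] // _; rewrite !subSS !subn0 qnumS.
  by rewrite leqNgt -[X in (X < _)%N]addn0 ltn_add2l expn_gt0 (ltnW (card_field_gt1 F)).
move: aH'; rewrite inE f_dim => /and3P[aH' H'x1 /eqP dH'].
have [x2 + _] := line_nbrs_ex H'x1 dH'; rewrite inE => /andP[_ /eqP x12].
exists p, a, (a + r), x2; split=> //.
- split; first exact: (isotropic_singular PS (f_iso _) br).
  move: (ra); apply: contraNneq => /eqP; rewrite addrC addr_eq0 => /eqP ->.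
  by rewrite rpredN memv_line.
- by split=> //; rewrite (polarDl PS) (isotropic_orth PS (f_iso x0) (subvP Hx _ rH) px) addr0.
rewrite /above /= -!memvE; apply/andP; split.
  by have : (H' <= f x2)%VS; [rewrite -x12 capvSr|move/subvP; apply; rewrite memvE].
move: (rH'); apply: contra => br2; have : a + r \in H' by rewrite -x12 memv_cap br.
by move=> arH'; rewrite -(addKr a r) rpredD // rpredN memvE.
Qed.

Lemma orth_above a p x : B a p != 0 -> above <[p]> x -> above <[a]> x = false.
Proof.
rewrite /above /= -!memvE => ap px; apply: contraNF ap => ax.
by rewrite (isotropic_orth PS (f_iso x)).
Qed.

Lemma polar_second_largest th : second_largest_eigenvalue e th -> th = tau.
Proof.
apply: (second_largest_eigenvalueE e_sym (good := fun W => iso W) (rk := fun W => \dim W)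
  adjacency_above_inner _ (leigenvalue_valency x0 polar_adjacency_const) _ polar_gap
  polar_eigenvalue_le) => [x|].
  by exists (f x); [exact: f_iso|exact: above_vertex].
have [p [a [b [x [_ [Sa a0] [Sb b0] _ /andP[ax bx]]]]]] := exists_points.
apply/leigenvalueP; exists (ind R (above <[a]>) - ind R (above <[b]>)).
  by apply/eqP => /ffunP/(_ x); rewrite !ffunE ax (negPf bx) subr0 => /eqP; rewrite oner_eq0.
rewrite -[ind R (above <[b]>)]scale1r addrC -scaleNr.
rewrite adjacency_fun_is_linear !polar_adjacency_point //; apply/ffunP => y.
by rewrite !ffunE /= /GRing.scale /=; ring.
Qed.

Lemma polar_totally_nonassociative th : (3 <= s * #|F| ^ d.-1)%N ->
  second_largest_eigenvalue e th -> totally_nonassociative (@norton R X e th).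
Proof.
move=> s3 /polar_second_largest ->.
have [p [a [b [x [[Sp p0] [Sa a0] [Sb b0] [ap bp] /andP[ax bx]]]]]] := exists_points.
apply: (points_totally_nonassociative e_sym polar_adjacency_const _ (polar_adjacency_point Sp p0)
  (polar_adjacency_point Sa a0) (polar_adjacency_point Sb b0) polar_gapE _ _ _ (x0 := x)) => //.
- by rewrite gt_eqF ?polar_gap.
- exact: leqW.
- by move=> y; exact: orth_above ap.
- by move=> y; exact: orth_above bp.
- by rewrite ax (negPf bx).
Qed.

Lemma polar_parities th m (t t' : tree m) : (s * #|F| ^ d.-1 = 2)%N ->
  second_largest_eigenvalue e th -> tree_equiv (@norton R X e th) t t' ->
  parities (val t) = parities (val t').
Proof.
move=> s2 /polar_second_largest ->.
have [p [a [b [x [[Sp p0] [Sa a0] [Sb b0] [ap bp] /andP[ax bx]]]]]] := exists_points.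
apply: (points_parities e_sym polar_adjacency_const _ (polar_adjacency_point Sp p0)
  (polar_adjacency_point Sa a0) (polar_adjacency_point Sb b0) polar_gapE _ _ _ (x0 := x)) => //.
- by rewrite gt_eqF ?polar_gap.
- by rewrite s2.
- by move=> y; exact: orth_above ap.
- by move=> y; exact: orth_above bp.
- by rewrite ax (negPf bx).
- by rewrite s2.
Qed.

End LineSize.

Lemma maximal_line_nbr H v x : (H <= f x)%VS -> (\dim H).+1 = d -> S v ->
  (forall u, u \in H -> B u v = 0) -> v \notin f x ->
  exists2 z, z \in line_nbrs x H & v \in f z.
Proof.
move=> Hx dH Sv Hv vx; have vH : v \notin H by move: vx; apply: contra => /(subvP Hx).
have [||z zE] := @maximal_of_dim (H + <[v]>)%VS.
- exact: (isotropicD_line PS (isotropicS PS Hx (f_iso x)) Sv Hv).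
- by rewrite dimD_line.
have vz : v \in f z by rewrite zE memvE addvSr.
have HE : (f x :&: f z)%VS = H.
  apply/esym/eqP; rewrite eqEdim subv_cap Hx zE addvSl /= -ltnS dH -zE.
  by apply: dim_cap_lt => xz; rewrite xz vz in vx.
by exists z => //; rewrite inE HE eqxx e_f HE dH eqxx.
Qed.

Lemma line_size_ge2 :
  (forall U W, maximal_isotropic iso U -> maximal_isotropic iso W ->
     (\dim (U :&: W)).+1 = \dim U ->
     exists v, [/\ S v, forall u, u \in (U :&: W)%VS -> B u v = 0, v \notin U & v \notin W]) ->
  forall s, (forall y H, (H <= f y)%VS -> (\dim H).+1 = d -> #|line_nbrs y H| = s) ->
  (2 <= s)%N.
Proof.
move=> third s card_line; have [H Hx dH] := hyperplane_ex x0.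
have [x1 x1n _] := line_nbrs_ex Hx dH; have := x1n; rewrite inE => /andP[_ /eqP HE].
have [|v [Sv Hv vx0 vx1]] := third _ _ (f_max x0) (f_max x1); first by rewrite HE f_dim.
rewrite HE in Hv; have [x2 x2n vx2] := maximal_line_nbr Hx dH Sv Hv vx0.
have <- : #|[set x1; x2]| = 2%N by rewrite cards2; case: eqVneq vx1 => // ->; rewrite vx2.
rewrite -(card_line x0 H) //.
apply: subset_leq_card; apply/subsetP => x; rewrite !inE.
by move=> /orP[]/eqP->; move: x1n x2n; rewrite !inE.
Qed.

(** * Hyperbolic quadrics *)

Section Hyperbolic.
Hypothesis N_le : (N <= 2 * d)%N.
Hypothesis singular_add_orth : forall u w, S u -> S w -> S (u + w) -> B u w = 0.

(** The orthogonal of H is x + y by dimension, and modulo H it is a hyperbolic plane, with two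
    singular lines only. A third vertex would contain u + w with u in x and w in y; its being
    singular makes u and w orthogonal, which forces w into x. *)
Lemma hyperbolic_line x y z H : (\dim H).+1 = d ->
  y \in line_nbrs x H -> z \in line_nbrs x H -> y = z.
Proof.
move=> dH; rewrite !inE => /andP[xy /eqP Hxy] /andP[xz /eqP Hxz].
apply: contrapT => yz.
have Hx : (H <= f x)%VS by rewrite -Hxy capvSl.
have Hy : (H <= f y)%VS by rewrite -Hxy capvSr.
have Hz : (H <= f z)%VS by rewrite -Hxz capvSr.
have isoH : iso H := isotropicS PS Hx (f_iso x).
have perpH w : iso w -> (H <= w)%VS -> (w <= perp PS fullv H)%VS.
  move=> isow Hw; apply/subvP => u uw; apply/perpP; split=> [|h hH]; first exact: memvf.
  by rewrite (isotropic_orth PS isow) // (subvP Hw).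
have sumE : (f x + f y)%VS = perp PS fullv H.
  apply/eqP; rewrite eqEdim subv_add !perpH //=.
  have := dim_perp_isotropic PS isoH; have := dimv_sum_cap (f x) (f y).
  rewrite Hxy !f_dim; lia.
have /subvPn[c cz cx] : ~~ (f z <= H)%VS by apply/negP => /dimvS; rewrite f_dim -dH ltnn.
have : c \in (f x + f y)%VS by rewrite sumE (subvP (perpH _ (f_iso z) Hz)).
case/memv_addP => u ux [w wy cE].
have Sc := isotropic_singular PS (f_iso z) cz.
have uw : B u w = 0.
  apply: singular_add_orth; rewrite -?cE //.
    exact: (isotropic_singular PS (f_iso x) ux).
  exact: (isotropic_singular PS (f_iso y) wy).
have cxF : c \notin f x by apply/negP => cx'; case/negP: cx; rewrite -Hxz memv_cap cx'.
have wx : w \notin f x by move: cxF; apply: contra => wx; rewrite cE rpredD.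
have cyF : c \notin f y.
  apply/negP => cy; apply: yz; apply/f_inj/eqP.
  have E g : c \in f g -> (H <= f g)%VS -> f g = (H + <[c]>)%VS.
    move=> cg Hg; apply/esym/eqP.
    by rewrite eqEdim subv_add Hg -memvE cg f_dim dimD_line // dH leqnn.
  by rewrite (E y) // (E z).
have uH : u \notin H by move: cyF; apply: contra => uH; rewrite cE rpredD // (subvP Hy).
have xE : f x = (H + <[u]>)%VS.
  by apply/esym/eqP; rewrite eqEdim subv_add Hx -memvE ux f_dim dimD_line // dH leqnn.
case/negP: wx; apply: (maximal_isotropic_mem PS (f_max x)).
  exact: (isotropic_singular PS (f_iso y) wy).
move=> v; rewrite xE => /memv_addP[h hH [_ /vlineP[k ->] ->]].
rewrite (polarDl PS) (polarZl PS) uw mulr0 addr0.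
by rewrite (isotropic_orth PS (f_iso y) (subvP Hy _ hH) wy).
Qed.

Lemma hyperbolic_line_size s :
  (forall y H, (H <= f y)%VS -> (\dim H).+1 = d -> #|line_nbrs y H| = s) -> s = 1%N.
Proof.
move=> card_line; have [H Hx dH] := hyperplane_ex x0.
have [x1 x1n _] := line_nbrs_ex Hx dH; rewrite -(card_line x0 H) //.
rewrite (_ : line_nbrs x0 H = [set x1]) ?cards1 //; apply/setP => z; rewrite inE.
by apply/idP/eqP => [zn|->//]; rewrite (hyperbolic_line dH zn x1n).
Qed.

(* The generators of the hyperbolic quadric in PG(3, 2) form two reguli of
   three lines each. *)
Lemma hyperbolic_complete_bipartite : d = 2%N -> #|F| = 2%N ->
  exists side : X -> bool, (forall x y, e x y = (side x != side y))
    /\ forall b, #|[set x | side x == b]| = 3%N.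
Proof.
move=> d2 q2.
(* As d = 2, a point is a line of the dual polar space and so lies on only two vertices. *)
have share x y z p : p != 0 -> p \in f x -> p \in f y -> p \in f z -> x <> y -> y = z \/ x = z.
  move=> p0 px py pz xy; have [|xz] := eqVneq x z; [by right|left].
  have line g : p \in f g -> x <> g -> g \in line_nbrs x <[p]>.
    move=> pg xg; have E : (<[p]> = f x :&: f g)%VS.
      apply/eqP; rewrite eqEdim subv_cap -!memvE px pg dim_line //=.
      by have := dim_cap_lt xg; rewrite d2.
    by rewrite inE -E eqxx e_f -E dim_line // d2.
  apply: (hyperbolic_line (H := <[p]>)); rewrite ?dim_line ?d2 //; first exact: line.
  by apply: line => //; apply/eqP.
have edge x y : e x y -> exists2 p, p != 0 & p \in (f x :&: f y)%VS.
  rewrite e_f d2 eqSS => /eqP xy; exists (vpick (f x :&: f y)); last exact: memv_pick.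
  by rewrite vpick0 -dimv_eq0 xy.
have adj x y p : x <> y -> p != 0 -> p \in f x -> p \in f y -> e x y.
  move=> xy p0 px py; rewrite e_f eqn_leq dim_cap_lt //= d2 ltnS lt0n dimv_eq0.
  by apply/negP => /eqP xy0; case/eqP: p0; apply/eqP; rewrite -memv0 -xy0 memv_cap px.
have triangle x y z : e x y -> e x z -> e y z = false.
  move=> xy xz; apply/negP => yz.
  have [p p0] := edge _ _ xy; rewrite memv_cap => /andP[px py].
  have nxy : x <> y by move=> E; rewrite E e_irr in xy.
  have pz : p \in f z.
    apply: contrapT => /negP pz; apply: nxy.
    by apply: (neighbour_through_uniq pz); rewrite 1?e_sym // e_sym.
  case: (share _ _ _ _ p0 px py pz nxy) => E; first by rewrite E e_irr in yz.
  by rewrite E e_irr in xz.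
(* If x misses the common point of y and u, its neighbour through that point is y or u, hence u. *)
have same x y u : e x y = false -> e y u -> e x u.
  move=> xy yu; have [p p0] := edge _ _ yu; rewrite memv_cap => /andP[py pu].
  have [px|px] := boolP (p \in f x).
    apply: (adj _ _ p) => // xu; move: xy.
    by rewrite xu e_sym yu.
  have [x' /andP[xx' px']] := neighbour_through (isotropic_singular PS (f_iso y) py) px.
  have yu' : y <> u by move=> E; rewrite E e_irr in yu.
  by case: (share _ _ _ _ p0 py pu px' yu') => E; rewrite ?E //; rewrite E xx' in xy.
have [s s0 card_line] := line_nbrs_const; have s1 := hyperbolic_line_size card_line.
have nbrs y : #|[set x | e y x]| = 3%N.
  transitivity #|[set x | e y x & (0 <= f x)%VS]|.
    by apply: eq_card => x; rewrite !inE sub0v andbT.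
  rewrite (card_nbrs_above card_line) ?sub0v // dimv0 d2 s1 /qnum !big_ord_recl big_ord0.
  by rewrite q2.
pose side x := e x0 x; exists side; split=> [x y|b].
  rewrite /side; case xx: (e x0 x); case yy: (e x0 y) => /=.
  - exact: triangle xx yy.
  - by rewrite e_sym; apply: (same _ x0) => //; rewrite e_sym.
  - by apply: (same _ x0) => //; rewrite e_sym.
  - apply/negP => xy; have := same _ _ _ xx xy; by rewrite yy.
have [H Hx dH] := hyperplane_ex x0; have [x1 + _] := line_nbrs_ex Hx dH.
rewrite inE => /andP[x01 _]; case: b.
  by rewrite -(nbrs x0); apply: eq_card => x; rewrite !inE /side; case: (e x0 x).
rewrite -(nbrs x1); apply: eq_card => x; rewrite !inE /side.
case xx: (e x0 x) => /=; first by rewrite (triangle _ _ _ x01 xx).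
by apply/esym; rewrite e_sym; apply: (same _ x0) => //; rewrite e_sym.
Qed.

End Hyperbolic.
End PolarGraph.

(** * The complete bipartite graph with sides of size three *)

Section CompleteBipartite.
Variables (R : realType) (X : finType) (e : rel X) (side : X -> bool).
Hypothesis e_side : forall x y, e x y = (side x != side y).
Hypothesis card_side : forall b, #|[set x | side x == b]| = 3%N.

Local Notation RX := {ffun X -> R^o}.
Local Notation V := (passmx.leigenspace (adjacency R e) 0).
Local Notation om := (cube_root R).
Local Notation C x := (x%:C%C : R[i]).

Let pt (b : bool) (i : 'I_3) : X := enum_val (cast_ord (esym (card_side b)) i).

Lemma side_pt b i : side (pt b i) = b.
Proof. by have := enum_valP (cast_ord (esym (card_side b)) i); rewrite inE => /eqP. Qed.

Lemma pt_inj b : injective (pt b).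
Proof. by move=> i j /enum_val_inj/cast_ord_inj. Qed.

Lemma pt_ex x : exists i, x = pt (side x) i.
Proof.
have xs : x \in [set y | side y == side x] by rewrite inE.
exists (cast_ord (card_side (side x)) (enum_rank_in xs x)).
by rewrite /pt cast_ordK enum_rankK_in.
Qed.

Let i1 : 'I_3 := lift ord0 ord0.
Let i2 : 'I_3 := lift ord0 (lift ord0 ord0).

Lemma sum_side (T : nmodType) (f : X -> T) b :
  \sum_(x | side x == b) f x = f (pt b ord0) + f (pt b i1) + f (pt b i2).
Proof.
have -> : \sum_(x | side x == b) f x = \sum_(i < 3) f (pt b i).
  rewrite (reindex_onto (pt b) (fun x => odflt ord0 [pick i | pt b i == x])) /=.
    apply: eq_bigl => i; rewrite side_pt eqxx /=.
    by case: pickP => [j /eqP/pt_inj->|/(_ i)]; rewrite eqxx.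
  move=> x /eqP xb; have [i xi] := pt_ex x; rewrite xb in xi.
  by case: pickP => [j /eqP//|/(_ i)]; rewrite -xi eqxx.
by rewrite !big_ord_recl big_ord0 addr0 addrA.
Qed.

Lemma mem_bipartite_eigenspace (f : RX) : f \in V <-> forall b, \sum_(x | side x == b) f x = 0.
Proof.
have AE x : adjacency_fun e f x = \sum_(y | side y == ~~ side x) f y.
  rewrite adjacencyE; apply: eq_bigl => y; rewrite e_side.
  by case: (side x); case: (side y).
rewrite mem_leigenspace; split=> [/eqP/ffunP Af b|sum0].
  have := Af (pt (~~ b) ord0); rewrite AE side_pt negbK => ->.
  by rewrite ffunE /GRing.scale /= mul0r.
by apply/eqP/ffunP => x; rewrite AE sum0 ffunE /GRing.scale /= mul0r.
Qed.

Definition side_fourier (u : RX) b : R[i] :=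
  C (u (pt b ord0)) + C (u (pt b i1)) * om + C (u (pt b i2)) * om ^+ 2.

Lemma side_fourier_proj (f h : RX) b : (forall t, t \in V -> inner f t = inner h t) ->
  side_fourier f b = side_fourier h b.
Proof.
move=> fh; pose dl i : RX := ind R (pred1 (pt b i)) - ind R (pred1 (pt b ord0)).
have inner_dl (k : RX) i : inner k (dl i) = k (pt b i) - k (pt b ord0).
  by rewrite innerDr innerNr !inner_ind !big_pred1_eq.
have dlV i : dl i \in V.
  apply/mem_bipartite_eigenspace => c; under eq_bigr => x _ do rewrite !ffunE.
  rewrite sumrB; have one j : \sum_(x | side x == c) (pred1 (pt b j) x)%:R = (b == c)%:R :> R.
    rewrite big_mkcond (bigD1 (pt b j)) //= big1 ?addr0.
      by rewrite side_pt eqxx; case: (b == c).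
    by move=> x /negPf->; case: ifP.
  by rewrite !one subrr.
have diff i : f (pt b i) - f (pt b ord0) = h (pt b i) - h (pt b ord0).
  by rewrite -!inner_dl fh.
have E (k : RX) : side_fourier k b = C (k (pt b i1) - k (pt b ord0)) * om
    + C (k (pt b i2) - k (pt b ord0)) * om ^+ 2.
  have om2 : om ^+ 2 = - 1 - om.
    by apply/eqP; rewrite -subr_eq0 -(cube_root_sum R); apply/eqP; ring.
  by rewrite /side_fourier !rmorphB /= om2; ring.
by rewrite !E !diff.
Qed.

Lemma bipartite_tree_equiv n (t t' : tree n) :
  parities (val t) = parities (val t') -> tree_equiv (@norton R X e 0) t t'.
Proof.
have sum0 (u : subvs_of V) b : vsval u (pt b ord0) + vsval u (pt b i1) + vsval u (pt b i2) = 0.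
  by have /mem_bipartite_eigenspace/(_ b) := subvsP u; rewrite sum_side.
have k3 : C 3^-1 * C 3 = 1 by rewrite -rmorphM mulVf ?rmorph1 // pnatr_eq0.
apply: (conj_tree_equiv (Phi := fun u : subvs_of V => fun b => C 3^-1 * side_fourier (vsval u) b)).
  move=> u v uv; apply: val_inj; apply/eqP; rewrite -subr_eq0; apply/eqP/ffunP => x.
  have [i ->] := pt_ex x; move: (side x) => b {x}; rewrite [RHS]ffunE.
  have {}uv : side_fourier (vsval u) b = side_fourier (vsval v) b.
    apply: (@mulfI _ (C 3^-1)); last exact: uv.
    by rewrite fmorph_eq0 invr_eq0 pnatr_eq0.
  have [||w0 w1 w2] := @cube_root_free R (vsval (u - v) (pt b ord0))
    (vsval (u - v) (pt b i1)) (vsval (u - v) (pt b i2)).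
  - exact: sum0.
  - rewrite -(subrr (side_fourier (vsval u) b)) {2}uv /side_fourier linearB /= !ffunE !rmorphB /=.
    by ring.
  rewrite -[val u - val v]/(vsval u - vsval v) -linearB.
  case: i => -[|[|[|//]]] i.
  - by rewrite (_ : Ordinal i = ord0) //; exact: val_inj.
  - by rewrite (_ : Ordinal i = i1) //; exact: val_inj.
  - by rewrite (_ : Ordinal i = i2) //; exact: val_inj.
move=> u v b.
rewrite -(@side_fourier_proj (pmul (vsval u) (vsval v))); last by move=> k kV; exact: norton_proj.
apply: eq_trans (esym (conjc_scale _ _ _)).
apply: eq_trans (congr1 (fun y => C 3^-1 * C 3^-1 * y) (fourier3 (sum0 u b) (sum0 v b))).
have c3 : C 3 = 3 := rmorph_nat _ 3.
rewrite /side_fourier !ffunE -c3 [RHS]mulrA -[X in _ = X * _]mulrA k3 mulr1.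
by [].
Qed.

End CompleteBipartite.

(** Without edges A = 0, which has no two distinct eigenvalues. This also supplies a vertex. *)
Lemma exists_edge (R : realType) (X : finType) (e : rel X) (th : R) :
  second_largest_eigenvalue e th -> exists x y, e x y.
Proof.
move=> [th_eig [th0 [th0_eig th_lt _]]]; apply: contrapT => no_edge.
have A0 (f : {ffun X -> R^o}) : adjacency_fun e f = 0.
  apply/ffunP => x; rewrite adjacencyE ffunE big1 // => y xy.
  by case: no_edge; exists x, y.
have eig0 a : passmx.leigenvalue (adjacency R e) a -> a = 0.
  case/leigenvalueP => f f0; rewrite A0 => /esym/eqP.
  by rewrite scaler_eq0 (negPf f0) orbF => /eqP.
by move: th_lt; rewrite (eig0 _ th_eig) (eig0 _ th0_eig) ltxx.
Qed.

Section DualPolarGraph.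
Variables (R : realType) (F : finFieldType) (N : nat) (B : 'rV[F]_N -> 'rV[F]_N -> F).
Variables (S : pred 'rV[F]_N) (iso : pred {vspace 'rV[F]_N}).
Hypothesis PS : polar_space B S iso.
Variables (X : finType) (e : rel X) (d : nat) (th : R).
Hypothesis e_iso : graph_iso e (dual_polar_rel (isotropic := iso) d).
Hypotheses (dr : distance_regular e) (th2 : second_largest_eigenvalue e th).
Hypotheses (d_ge2 : (2 <= d)%N) (dim_le : forall U, iso U -> (\dim U <= d)%N).

(* A common dimension d - 1 of the maximal isotropic subspaces would make the
   graph reflexive, and a smaller one would make it edgeless. *)
Lemma dual_polar_embedding : exists f : X -> {vspace 'rV[F]_N},
  [/\ injective f, forall x, maximal_isotropic iso (f x),
      forall W, maximal_isotropic iso W -> exists x, f x = W,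
      forall x y, e x y = ((\dim (f x :&: f y)).+1 == d)%N
    & forall x, \dim (f x) = d].
Proof.
have [phi [psi phiK psiK] phi_e] := e_iso; exists (fun x => val (phi x)).
have max x : maximal_isotropic iso (val (phi x)) by exact: valP.
have iso_phi x : iso (val (phi x)) by have [] := maximal_isotropicP _ _ (max x).
have e_val x y : e x y = ((\dim (val (phi x) :&: val (phi y))).+1 == d)%N by rewrite -phi_e.
split=> // [x y /val_inj/(can_inj phiK)//|W Wmax|x].
  by exists (psi (exist _ W Wmax)); rewrite psiK.
have [x1 [y1 xy]] := exists_edge th2; move: xy; rewrite e_val => /eqP xy.
rewrite (maximal_isotropic_dim PS (max x) (max x1)).
have := dim_le (iso_phi x1); have := dimvS (capvSl (val (phi x1)) (val (phi y1))).
have [_ e_irr _ _] := dr; have := e_irr x1; rewrite e_val capvv => /eqP; lia.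
Qed.

Let vertex_ex : exists x : X, True.
Proof. by have [x _] := exists_edge th2; exists x. Qed.

(** Either alternative yields 3 <= s q^(d-1): the second one gives s >= 2, while q^(d-1) >= 2
    always. *)
Lemma dual_polar_totally_nonassociative :
  (3 <= #|F| ^ d.-1)%N \/
  (forall x y, maximal_isotropic iso x -> maximal_isotropic iso y ->
     (\dim (x :&: y)).+1 = \dim x ->
     exists v, [/\ S v, forall u, u \in (x :&: y)%VS -> B u v = 0, v \notin x & v \notin y]) ->
  totally_nonassociative (@norton R X e th).
Proof.
move=> big; have [f [f_inj f_max f_surj e_f f_dim]] := dual_polar_embedding.
have [x0 _] := vertex_ex.
have [s s_gt0 card_line] := line_nbrs_const PS f_inj f_max f_surj e_f f_dim d_ge2 dr x0.
apply: (polar_totally_nonassociative PS f_inj f_max f_surj e_f f_dim d_ge2 dr x0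
  s_gt0 card_line) => //.
case: big => [q3|third]; first by rewrite (leq_trans q3) // leq_pmull.
have s2 := line_size_ge2 PS f_inj f_max f_surj e_f f_dim d_ge2 x0 third card_line.
have q2 : (2 <= #|F| ^ d.-1)%N.
  apply: leq_trans (card_field_gt1 F) _; rewrite -{1}(expn1 #|F|).
  by rewrite leq_pexp2l ?(ltnW (card_field_gt1 F)) // -ltnS prednK // ltnW.
exact: leq_trans (leq_mul s2 q2).
Qed.

Lemma dual_polar_D22_equiv m (t t' : tree m) : N = 4%N -> d = 2%N -> #|F| = 2%N ->
  (forall u w, S u -> S w -> S (u + w) -> B u w = 0) ->
  tree_equiv (@norton R X e th) t t' <-> parities (val t) = parities (val t').
Proof.
move=> N4 d2 q2 orth; have [f [f_inj f_max f_surj e_f f_dim]] := dual_polar_embedding.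
have [x0 _] := vertex_ex.
have N_le : (N <= 2 * d)%N by rewrite N4 d2.
have [s s_gt0 card_line] := line_nbrs_const PS f_inj f_max f_surj e_f f_dim d_ge2 dr x0.
have s1 := hyperbolic_line_size PS f_inj f_max f_surj e_f f_dim d_ge2 x0 N_le orth card_line.
split=> [|tt'].
  apply: (polar_parities PS f_inj f_max f_surj e_f f_dim d_ge2 dr x0 s_gt0 card_line) => //.
  by rewrite s1 q2 d2.
have [side [e_side card_side]] := hyperbolic_complete_bipartite PS f_inj f_max f_surj e_f
  f_dim d_ge2 dr x0 N_le orth d2 q2.
(* For s = 1 and d = 2 the second eigenvalue is [1] - [1]. *)
rewrite (_ : th = 0); first exact: (bipartite_tree_equiv e_side card_side).
rewrite (polar_second_largest PS f_inj f_max f_surj e_f f_dim d_ge2 dr x0 s_gt0 card_line th2).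
by rewrite /polar_eigenvalue s1 d2 /qnum big_ord1 mul1r subrr.
Qed.

End DualPolarGraph.

(** * Quadratic, symplectic and Hermitian spaces as polar spaces *)

Section Quadratic.
Variables (F : finFieldType) (N : nat) (Q : 'rV[F]_N -> F).
Hypothesis Q_nondeg : nondegenerate_quadratic_form Q.
Local Notation V := 'rV[F]_N.
Local Notation B := (polar_form Q).

Let QZ a u : Q (a *: u) = a ^+ 2 * Q u. Proof. by case: Q_nondeg => -[]. Qed.
Let Blin v : scalar (B ^~ v). Proof. by case: Q_nondeg => -[]. Qed.

Lemma polar_formC u v : B u v = B v u.
Proof. by rewrite /polar_form [v + u]addrC addrAC. Qed.

Lemma quadraticD u v : Q (u + v) = Q u + Q v + B u v.
Proof. by rewrite /polar_form; ring. Qed.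

Lemma quadratic_polar_space : polar_space B (fun v => Q v == 0) (quadratic_isotropic Q).
Proof.
have BZl a u w : B (a *: u) w = a * B u w.
  have B0 : B 0 w = 0 by have := Blin w (-1) 0 0; rewrite scaler0 addr0 mulN1r addNr.
  by have := Blin w a u 0; rewrite addr0 B0 addr0.
split=> //.
- by move=> u v; rewrite polar_formC.
- by move=> u v /eqP Qu /eqP Qv uv; rewrite quadraticD Qu Qv uv !addr0.
- by move=> a u /eqP Qu; rewrite QZ Qu mulr0.
- move=> u /eqP Qu; rewrite /polar_form Qu -(scale1r u) -scalerDl QZ Qu mulr0.
  by rewrite !subr0.
- move=> u /eqP Qu u_perp; case: Q_nondeg => _; apply=> // v.
  by rewrite polar_formC u_perp.
(* As Q v = 0, the value of Q at w + t v is affine in t with slope B w v. *)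
- move=> v w /eqP Qv Bwv; exists (- Q w / B w v).
  rewrite quadraticD QZ Qv mulr0 addr0 [B w _]polar_formC BZl [B v w]polar_formC.
  by rewrite divfK // subrr.
move=> U; split=> [/forall_inP QU|[QU _]]; last by apply/forall_inP.
split=> // u v uU vU; have /eqP := QU _ (rpredD uU vU).
by rewrite quadraticD (eqP (QU u uU)) (eqP (QU v vU)) !add0r.
Qed.

Lemma quadratic_add_orth u w : Q u == 0 -> Q w == 0 -> Q (u + w) == 0 -> B u w = 0.
Proof. by move=> /eqP Qu /eqP Qw; rewrite quadraticD Qu Qw !add0r => /eqP. Qed.

(** Since 2 dim x < N, the orthogonal of H = x :&: y is larger than x + y. A vector of it outside x
    + y, corrected to be orthogonal to a in x and b in y, is added to a + t b. As B a b is nonzero,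
    t can be chosen to make the sum singular, in every characteristic. *)
Lemma quadratic_third : forall x y, maximal_isotropic (quadratic_isotropic Q) x ->
  maximal_isotropic (quadratic_isotropic Q) y ->
  (2 * \dim x < N)%N -> (\dim (x :&: y)).+1 = \dim x ->
  exists v, [/\ Q v == 0, forall u, u \in (x :&: y)%VS -> B u v = 0, v \notin x & v \notin y].
Proof.
move=> x y xm ym xN dH; have PS := quadratic_polar_space.
set H := (x :&: y)%VS in dH *.
have [isox _] := maximal_isotropicP _ _ xm; have [isoy _] := maximal_isotropicP _ _ ym.
have dxy := maximal_isotropic_dim PS xm ym.
have Hx : (H <= x)%VS by exact: capvSl.
have Hy : (H <= y)%VS by exact: capvSr.
have /subvPn[a ax aH] : ~~ (x <= H)%VS by apply/negP => /dimvS; lia.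
have /subvPn[b by' bH] : ~~ (y <= H)%VS by apply/negP => /dimvS; lia.
have xE : x = (H + <[a]>)%VS.
  by apply/esym/eqP; rewrite eqEdim subv_add Hx -memvE ax dimD_line // dH leqnn.
have Qa : Q a == 0 := isotropic_singular PS isox ax.
have Qb : Q b == 0 := isotropic_singular PS isoy by'.
have Bab : B a b != 0.
  move: bH; apply: contra => /eqP ab; rewrite memv_cap by' andbT.
  apply: (maximal_isotropic_mem PS xm Qb) => u; rewrite xE => /memv_addP[h hH [_ /vlineP[k ->] ->]].
  by rewrite (polarDl PS) (polarZl PS) ab mulr0 addr0 (isotropic_orth PS isoy (subvP Hy _ hH) by').
have /subvPn[c /perpP[_ cH] cxy] : ~~ (perp PS fullv H <= x + y)%VS.
  apply/negP => /dimvS; have := dim_perp PS fullv H; rewrite dimvf /dim /= mul1n.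
  have := dimv_sum_cap x y; rewrite -/H -dxy; move: xN dH; clear.
  move: (\dim x) (\dim H) (\dim (x + y)) (\dim (perp _ _ _)) => dx dH dS dP; lia.
have axy : a \in (x + y)%VS by rewrite (subvP (addvSl _ _)).
have bxy : b \in (x + y)%VS by rewrite (subvP (addvSr _ _)).
have aH0 u (uH : u \in H) : B a u = 0 := isotropic_orth PS isox ax (subvP Hx _ uH).
have bH0 u (uH : u \in H) : B b u = 0 := isotropic_orth PS isoy by' (subvP Hy _ uH).
have [c' [c'a c'b c'H c'xy]] : exists c', [/\ B c' a = 0, B c' b = 0,
    forall u, u \in H -> B c' u = 0 & c' \notin (x + y)%VS].
  pose c' := c - (B c b / B a b) *: a - (B c a / B a b) *: b.
  have cE u : B c' u = B c u - (B c b / B a b) * B a u - (B c a / B a b) * B b u.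
    by rewrite /c' -!scaleNr !(polarDl PS) !(polarZl PS) !mulNr.
  exists c'; split=> [|||].
  - by rewrite cE (singular_self PS Qa) [B b a]polar_formC mulr0 subr0 divfK // subrr.
  - by rewrite cE (singular_self PS Qb) mulr0 subr0 divfK // subrr.
  - by move=> u uH; rewrite cE cH // (aH0 _ uH) (bH0 _ uH) !mulr0 !subr0.
  move: cxy; apply: contra => c'xy.
  have -> : c = c' + (B c a / B a b) *: b + (B c b / B a b) *: a by rewrite /c' !subrK.
  exact: (memvD (memvD c'xy (memvZ _ bxy)) (memvZ _ axy)).
pose t := - Q c' / B a b; pose v := a + t *: b + c'.
have vxy : v \notin (x + y)%VS.
  move: c'xy; apply: contra => vxy; have -> : c' = v - (a + t *: b) by rewrite /v addrC addKr.
  exact: (memvB vxy (memvD axy (memvZ _ bxy))).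
exists v; split.
- rewrite /v quadraticD [Q (a + _)]quadraticD (QZ t) (eqP Qa) (eqP Qb) mulr0 addr0 add0r.
  rewrite [B a _]polar_formC (polarZl PS) [B b a]polar_formC divfK // addNr add0r.
  by rewrite (polarDl PS) (polarZl PS) ![B _ c']polar_formC c'a c'b mulr0 addr0.
- move=> u uH; rewrite polar_formC /v !(polarDl PS) (polarZl PS).
  by rewrite (aH0 _ uH) (bH0 _ uH) (c'H _ uH) mulr0 !addr0.
- by move: vxy; apply: contra => vx; rewrite (subvP (addvSl _ _)).
- by move: vxy; apply: contra => vy; rewrite (subvP (addvSr _ _)).
Qed.

End Quadratic.

Section Symplectic.
Variables (F : finFieldType) (N : nat) (f : {hermitian 'rV[F]_N for true & idfun}).
Hypothesis f_symp : is_psymplectic f.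

(** In characteristic 2 this is part of [is_psymplectic]; otherwise skew symmetry gives 2 f u u =
    0. *)
Lemma symplectic_self u : f u u = 0.
Proof.
case: f_symp => _ _ alt; have [/alt->//|char2] := boolP (2%N \in [pchar F]).
have : f u u + f u u = 0 by rewrite {1}hermC expr1 mulN1r addNr.
rewrite -mulr2n -mulr_natl => /eqP; rewrite mulf_eq0 => /orP[/eqP two0|/eqP//].
by case/negP: char2; rewrite inE /= two0 eqxx.
Qed.

Lemma symplectic_polar_space : polar_space f predT (form_isotropic f).
Proof.
split=> //.
- by move=> w a u v; rewrite linearDl linearZl_LR.
- by move=> u v /eqP; rewrite herm_eq0C => /eqP.
- by move=> u _; exact: symplectic_self.
- move=> u _ u_perp; case: f_symp => /eqP rad0 _ _; apply/eqP; rewrite -memv0 -rad0.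
  by apply/mem_orthovP => w _; apply/eqP; rewrite herm_eq0C u_perp.
- by move=> v w _ _; exists 0.
move=> U; split=> [/orthovP UU|[_ UU]]; last exact/orthovP.
by split=> // u v uU vU; exact: UU.
Qed.

Lemma symplectic_third x y : maximal_isotropic (form_isotropic f) x ->
  maximal_isotropic (form_isotropic f) y -> (\dim (x :&: y)).+1 = \dim x ->
  exists v, [/\ predT v, forall u, u \in (x :&: y)%VS -> f u v = 0, v \notin x & v \notin y].
Proof.
move=> xm ym dH; have PS := symplectic_polar_space.
have [isox _] := maximal_isotropicP _ _ xm; have [isoy _] := maximal_isotropicP _ _ ym.
have dxy := maximal_isotropic_dim PS xm ym.
have /subvPn[a ax aH] : ~~ (x <= x :&: y)%VS by apply/negP => /dimvS; lia.
have /subvPn[b by' bH] : ~~ (y <= x :&: y)%VS by apply/negP => /dimvS; lia.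
rewrite memv_cap ax /= in aH; rewrite memv_cap by' andbT in bH.
exists (a + b); split=> //.
- move=> u; rewrite memv_cap => /andP[ux uy].
  apply: (polar_refl PS); rewrite (polarDl PS).
  by rewrite (isotropic_orth PS isox ax ux) (isotropic_orth PS isoy by' uy) addr0.
- by rewrite rpredDl.
- by rewrite rpredDr.
Qed.

End Symplectic.

Section Hermitian.
Variables (F : finFieldType) (N r : nat) (theta : {rmorphism F -> F}).
Variable f : {hermitian 'rV[F]_N for false & theta}.
Hypotheses (cardF : #|F| = (r ^ 2)%N) (theta_r : forall x, theta x = x ^+ r).
Hypothesis f_unitary : is_unitary f.

Lemma frobenius_size_ge2 : (2 <= r)%N.
Proof. by have := card_field_gt1 F; rewrite cardF; case: r => [|[|]]. Qed.

Lemma thetaK : involutive theta.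
Proof. by move=> x; rewrite !theta_r -exprM mulnn -cardF expf_card. Qed.

(** The polynomial X^r + X has at most r roots among the r^2 elements of the field. *)
Lemma trace_neq0 : exists x : F, x + theta x != 0.
Proof.
apply: contrapT => no_x; pose p : {poly F} := 'X^r + 'X.
have r2 := frobenius_size_ge2.
have size_p : size p = r.+1 by rewrite size_polyDl size_polyXn // size_polyX.
have p0 : p != 0 by rewrite -size_poly_eq0 size_p.
have := max_poly_roots p0 (rs := enum F); rewrite size_p -cardE cardF enum_uniq.
have -> : all (root p) (enum F).
  apply/allP => x _; rewrite /root !hornerE -theta_r addrC.
  by apply/negP => /negP x0; apply: no_x; exists x.
by move=> /(_ isT isT); rewrite -mulnn; nia.
Qed.

Lemma trace_surjective a : theta a = a -> exists x, x + theta x = a.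
Proof.
move=> aF; have [x x0] := trace_neq0; exists (a * x / (x + theta x)).
rewrite fmorph_div rmorphM rmorphD /= thetaK aF [theta x + x]addrC.
by rewrite -mulrDl -mulrDr mulfK.
Qed.

Lemma hermitian_polar_space : polar_space f (fun v => f v v == 0) (form_isotropic f).
Proof.
have fC u v : f u v = theta (f v u) by rewrite hermC expr0 mul1r.
have fDl u v w : f (u + v) w = f u w + f v w by exact: linearDl.
have fDr u v w : f u (v + w) = f u v + f u w by exact: linearDr.
have fZl a u v : f (a *: u) v = a * f u v by exact: linearZl_LR.
have fZr a u v : f u (a *: v) = theta a * f u v by exact: linearZr_LR.
split=> //.
- by move=> w a u v; rewrite linearDl linearZl_LR.
- by move=> u v /eqP; rewrite herm_eq0C => /eqP.
- move=> u v /eqP fu /eqP fv uv; rewrite fDl !fDr fu fv uv (fC v) uv rmorph0.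
  by rewrite !addr0.
- by move=> a u /eqP fu; rewrite fZl fZr fu !mulr0.
- by move=> u /eqP.
- move=> u _ u_perp; case: f_unitary => /eqP rad0 _; apply/eqP; rewrite -memv0 -rad0.
  by apply/mem_orthovP => w _; apply/eqP; rewrite herm_eq0C u_perp.
(* As f v v = 0, the value of f at w + t v is f w w plus a trace. Since f w w is fixed by [theta],
   its opposite is the trace of some x, and t is solved from theta t * f w v = x. *)
- move=> v w /eqP fv fwv; have fww : theta (- f w w) = - f w w by rewrite rmorphN -fC.
  have [x xE] := trace_surjective fww; exists (theta (x / f w v)).
  rewrite fDl !fDr !fZl !fZr fv !mulr0 addr0 /= thetaK.
  rewrite (fC v w) -rmorphM divfK // -addrA xE subrr //.
move=> U; split=> [/orthovP UU|[_ UU]]; last exact/orthovP.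
by split=> [u uU|u v uU vU]; [apply/eqP|]; exact: UU.
Qed.

End Hermitian.

(** * The three families *)

Lemma johnson_embedding (X : finType) (e : rel X) n k : is_johnson e n k ->
  exists s : X -> {set 'I_n}, [/\ injective s, forall x, #|s x| = k,
    forall B : {set 'I_n}, #|B| = k -> exists x, s x = B
    & forall x y, e x y = (#|s x :&: s y|.+1 == k)%N].
Proof.
move=> [phi [psi phiK psiK] phi_e]; exists (fun x => val (phi x)); split.
- by move=> x y /val_inj/(can_inj phiK).
- by move=> x; apply/eqP/(valP (phi x)).
- by move=> B /eqP Bk; exists (psi (exist _ B Bk)); rewrite psiK.
- by move=> x y; rewrite -phi_e.
Qed.

Lemma zero_product_trivial (S : Type) (op : S -> S -> S) (c : S) :
  (forall a b, op a b = c) -> (forall m, num_classes op m = 1%N) /\ associative op.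
Proof.
move=> opc; split=> [m|a b b']; last by rewrite !opc.
apply: num_classes_trivial => t t' z.
case: m t t' => [|m] t t'; first by rewrite (tree0 t t').
have node (u : tree m.+1) : paren op z (val u) = c.
  by case: (val u) (valP u) => //= l r _; exact: opc.
by rewrite !node.
Qed.

(** Both graphs are the triangle, so J(3, 1) needs no treatment of its own. *)
Lemma johnson31_hamming (X : finType) (e : rel X) : is_johnson e 3 1 -> is_hamming e 1 3.
Proof.
case/johnson_embedding => s [s_inj s_card s_surj es].
pose w x : {ffun 'I_1 -> 'I_3} := [ffun => odflt ord0 [pick i in s x]].
have w_set (x : X) : s x = [set w x ord0].
  have /eqP/cards1P[a xa] := s_card x; rewrite ffunE xa.
  by case: pickP => [b /set1P->//|/(_ a)]; rewrite set11.
have w_inj : injective w by move=> x y xy; apply: s_inj; rewrite !w_set xy.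
pose g (v : {ffun 'I_1 -> 'I_3}) := sval (cid (s_surj _ (cards1 (v ord0)))).
have s_g v : s (g v) = [set v ord0] by exact: svalP (cid (s_surj _ (cards1 (v ord0)))).
have gK : cancel g w.
  move=> v; apply/ffunP => i; rewrite (ord1 i); apply/esym/set1_inj.
  by rewrite -w_set s_g.
exists w; first by exists g => // x; apply: w_inj; rewrite gK.
move=> x y; rewrite es !w_set /hamming_rel; have [xy|xy] := eqVneq (w x ord0) (w y ord0).
  rewrite xy setIid cards1 eq_card0 // => i.
  by rewrite (ord1 i) !inE xy eqxx.
rewrite disjoint_setI0 ?cards0; last by rewrite disjoints1 inE.
rewrite (eq_card (_ : _ =i predT)) ?card_ord // => i.
by rewrite (ord1 i) !inE xy.
Qed.

Lemma hamming_embedding (X : finType) (e : rel X) d m : is_hamming e d m ->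
  exists (w : X -> {ffun 'I_d -> 'I_m}) (g : {ffun 'I_d -> 'I_m} -> X),
  [/\ cancel w g, cancel g w & forall x y, hamming_rel (w x) (w y) = e x y].
Proof. by move=> [w [g wK gK] we]; exists w, g. Qed.

Section Main.
Variables (R : realType) (X : finType) (e : rel X) (th : R).
Hypotheses (dr : distance_regular e) (th2 : second_largest_eigenvalue e th).
Local Notation star := (@norton R X e th).

Let vertex_ex : exists x : X, True.
Proof. by have [x _] := exists_edge th2; exists x. Qed.

Lemma theorem1p1_associative :
  (exists2 k : nat, (1 <= k)%N & is_johnson e (2 * k)%N k) \/
  (exists2 d : nat, (1 <= d)%N & is_hamming e d 2) ->
  (forall m : nat, num_classes star m = 1%N) /\ associative star.
Proof.
move=> fam; apply: (zero_product_trivial (c := 0)); case: fam => [[k k1]|[d d1]].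
  move=> /johnson_embedding[s [s_inj s_card s_surj es]]; have [x0 _] := vertex_ex.
  exact: (johnson_norton_eq0 s_inj s_card s_surj es k1 (leqnn _) x0 erefl th2).
case: d d1 => // d _ /hamming_embedding[w [g [wK gK we]]].
exact: (@hamming_norton_eq0 R X e d 0 w g wK gK we th erefl th2).
Qed.

Lemma hamming3_equiv d m (t t' : tree m) : (1 <= d)%N -> is_hamming e d 3 ->
  tree_equiv star t t' <-> parities (val t) = parities (val t').
Proof.
case: d => // d _ /hamming_embedding[w [g [wK gK we]]]; split.
  exact: (@hamming_parities R X e d 1 w g wK gK we th m t t' erefl th2).
exact: (@hamming3_tree_equiv R X e d w g wK gK we th m t t' th2).
Qed.

Lemma isotropic_dim_le (F : finFieldType) N (B : 'rV[F]_N -> 'rV[F]_N -> F) S iso d :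
  @polar_space F N B S iso -> (N <= (2 * d).+1)%N -> forall U, iso U -> (\dim U <= d)%N.
Proof. by move=> PS Nd U /(dim_isotropic_le PS); lia. Qed.

Lemma theorem1p1_double_minus :
  [\/ is_johnson e 3 1, exists2 d : nat, (1 <= d)%N & is_hamming e d 3
    | is_dual_polar e PolarD 2 2] ->
  forall m, num_classes star m = num_classes (@double_minus R) m.
Proof.
move=> fam m; apply: eq_num_classes => t t'; rewrite double_minus_equiv.
case: fam => [/johnson31_hamming|[d d1]|[F q2 [Q [Q_nd [_ Qd]] Q_iso]]].
- exact: hamming3_equiv.
- exact: hamming3_equiv.
have PS := quadratic_polar_space Q_nd.
apply: (dual_polar_D22_equiv PS Q_iso dr th2 (leqnn _) Qd t t') => // u w.
exact: quadratic_add_orth.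
Qed.

(** Types C, B and 2D have a third maximal subspace on each line. Type D has q^(d-1) >= 3 unless q =
    d = 2, and the Hermitian types have q = r^2 >= 4. *)
Lemma theorem1p1_totally_nonassociative :
  [\/ exists n k : nat, [/\ 1 <= k, 2 * k < n, 4 <= n & is_johnson e n k]%N,
      exists d r : nat, [/\ 1 <= d, 4 <= r & is_hamming e d r]%N
    | exists (t : polar_type) (d q : nat),
        [/\ (2 <= d)%N, (t, d, q) <> (PolarD, 2%N, 2%N) & is_dual_polar e t d q]] ->
  totally_nonassociative star.
Proof.
case=> [[n [k [k1 kn n4 /johnson_embedding[s [s_inj s_card s_surj es]]]]]
       |[d [r [d1 r4]]]|[t [d [q [d2 tdq [F Fq]]]]]].
- have [x0 _] := vertex_ex.
  exact: (johnson_totally_nonassociative s_inj s_card s_surj es k1 (ltnW kn) x0 kn n4 th2).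
- case: d d1 => // d _; case: r r4 => [|[|r]] // r4 /hamming_embedding[w [g [wK gK we]]].
  exact: (@hamming_totally_nonassociative R X e d r w g wK gK we th r4 th2).
have q_pow : (3 <= #|F|)%N \/ (3 <= d)%N -> (3 <= #|F| ^ d.-1)%N.
  case=> [F3|d3]; first by rewrite (leq_trans F3) // -{1}(expn1 #|F|) leq_pexp2l; lia.
  apply: (@leq_trans (2 ^ 2)) => //; apply: (@leq_trans (2 ^ d.-1)).
    by rewrite leq_pexp2l //; lia.
  by rewrite leq_exp2r ?card_field_gt1; lia.
have third_dim N (B : 'rV[F]_N -> 'rV[F]_N -> F) S iso (x : {vspace 'rV[F]_N}) :
    @polar_space F N B S iso ->
    (forall U, iso U -> (\dim U <= d)%N) -> (2 * d < N)%N -> maximal_isotropic iso x ->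
    (2 * \dim x < N)%N.
  by move=> PS dim_le dN /maximal_isotropicP[/dim_le]; lia.
case: t tdq => tdq.
- move=> [f [f_symp f_iso]]; have PS := symplectic_polar_space f_symp.
  apply: (dual_polar_totally_nonassociative PS f_iso dr th2 d2).
    exact: (isotropic_dim_le PS (leqnSn _)).
  by right; exact: symplectic_third.
- move=> [Q Q_nd Q_iso]; have PS := quadratic_polar_space Q_nd.
  have dim_le := isotropic_dim_le PS (leqnn _).
  apply: (dual_polar_totally_nonassociative PS Q_iso dr th2 d2 dim_le).
  right=> x y xm ym; apply: (quadratic_third Q_nd xm ym).
  by apply: (third_dim _ _ _ _ _ PS dim_le _ xm); exact: ltnSn.
- move=> [Q [Q_nd [_ Q_le]] Q_iso]; have PS := quadratic_polar_space Q_nd.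
  apply: (dual_polar_totally_nonassociative PS Q_iso dr th2 d2 Q_le); left; apply: q_pow.
  have q1 := card_field_gt1 F; have [d2'|] := eqVneq d 2%N; last by move=> dn2; right; lia.
  left; rewrite ltn_neqAle q1 andbT; apply/eqP => q2.
  by apply: tdq; rewrite d2' -Fq -q2.
- move=> [Q [Q_nd [_ Q_le]] Q_iso]; have PS := quadratic_polar_space Q_nd.
  apply: (dual_polar_totally_nonassociative PS Q_iso dr th2 d2 Q_le).
  right=> x y xm ym; apply: (quadratic_third Q_nd xm ym).
  by apply: (third_dim _ _ _ _ _ PS Q_le _ xm); rewrite leqW.
- move=> [r [theta [f [cardF theta_r f_un f_iso]]]].
  have PS := hermitian_polar_space cardF theta_r f_un.
  apply: (dual_polar_totally_nonassociative PS f_iso dr th2 d2).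
    exact: (isotropic_dim_le PS (leqnn _)).
  by left; apply: q_pow; left; have := frobenius_size_ge2 cardF; rewrite cardF -mulnn; nia.
- move=> [r [theta [f [cardF theta_r f_un f_iso]]]].
  have PS := hermitian_polar_space cardF theta_r f_un.
  apply: (dual_polar_totally_nonassociative PS f_iso dr th2 d2).
    exact: (isotropic_dim_le PS (leqnSn _)).
  by left; apply: q_pow; left; have := frobenius_size_ge2 cardF; rewrite cardF -mulnn; nia.
Qed.

End Main.

Local Close Scope ring_scope.

Theorem theorem1p1 (R : realType) :
  [/\ forall (X : finType) (e : rel X) (theta1 : R),
        distance_regular e -> second_largest_eigenvalue e theta1 ->
        (exists2 k : nat, 1 <= k & is_johnson e (2 * k) k) \/
        (exists2 d : nat, 1 <= d & is_hamming e d 2) ->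
        (forall m : nat, num_classes (@norton R X e theta1) m = 1) /\
        associative (@norton R X e theta1),
      (forall (X : finType) (e : rel X) (theta1 : R),
        distance_regular e -> second_largest_eigenvalue e theta1 ->
        [\/ is_johnson e 3 1,
            exists2 d : nat, 1 <= d & is_hamming e d 3
          | is_dual_polar e PolarD 2 2] ->
        forall m : nat,
          num_classes (@norton R X e theta1) m = num_classes (@double_minus R) m) /\
      (num_classes (@double_minus R) 0 = 1 /\
       forall m : nat, 1 <= m ->
         num_classes (@double_minus R) m = 2 ^ m.+1 %/ 3)
    & forall (X : finType) (e : rel X) (theta1 : R),
        distance_regular e -> second_largest_eigenvalue e theta1 ->
        [\/ exists n k : nat,
              [/\ 1 <= k, 2 * k < n, 4 <= n & is_johnson e n k],
            exists d r : nat, [/\ 1 <= d, 4 <= r & is_hamming e d r]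
          | exists (t : polar_type) (d q : nat),
              [/\ 2 <= d, (t, d, q) <> (PolarD, 2, 2) & is_dual_polar e t d q]] ->
        totally_nonassociative (@norton R X e theta1)].
Proof.
split.
- by move=> X e theta1 _ th2 fam; exact: (theorem1p1_associative th2 fam).
- split; first by move=> X e theta1 dr th2 fam; exact: (theorem1p1_double_minus dr th2 fam).
  split; last by move=> m; exact: num_classes_double_minus.
  by apply: num_classes_trivial => t t' z; rewrite (tree0 t t').
- by move=> X e theta1 dr th2 fam; exact: (theorem1p1_totally_nonassociative dr th2 fam).
Qed.
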